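(* Let $T>0$, $\sigma\in\mathbb{N}^+$, let $u_0,\Phi\in H^\sigma$ with $\Phi$ real-valued, and $Q^{\frac12}\in\mathcal{L}_2^\sigma$. For $\varepsilon\in(0,1)$ let $u^\varepsilon$ be the mild solution of $$du^\varepsilon(t)={\bf i}\Delta u^\varepsilon(t)\,dt-{\bf i}\varepsilon^2\Phi(x)u^\varepsilon(t)\,dt+\varepsilon Q^{\frac12}dW(t),\qquad u^\varepsilon(0)=u_0,$$ and let $T_\varepsilon=T/\varepsilon^2$. Then there exists a constant $c>0$, independent of $\varepsilon$, such that $$\mathbb{E}\Big[\sup_{t\in[0,T_\varepsilon]}\|u^\varepsilon(t)\|_{H^\sigma}^2\Big]\le c .$$
   Context: $\mathbb{T}=[-\pi,\pi]$ with periodic boundary conditions; $L^2(\mathbb{T})$ is the space of periodic square-integrable functions $\mathbb{T}\to\mathbb{C}$. For $w\in L^2(\mathbb{T})$ write $w(x)=\frac1{\sqrt{2\pi}}\sum_{\ell\in\mathbb{Z}}\hat w_\ell{\rm e}^{{\bf i}\ell x}$, and $\|w\|_{H^s}=\big(\sum_{\ell\in\mathbb{Z}}(1+|\ell|^{2s})|\hat w_\ell|^2\big)^{1/2}$. $\mathcal{L}_2^s$ is the space of Hilbert–Schmidt operators from $L^2(\mathbb{T})$ to $H^s$. Noise: on a filtered probability space with normal filtration, $W(t,x)=\frac1{\sqrt{2\pi}}\sum_{\ell\in\mathbb{Z}}\beta_\ell(t){\rm e}^{{\bf i}\ell x}$ with $\{\beta_\ell\}_{\ell\in\mathbb{Z}}$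 i.i.d. standard Brownian motions. $Q$ is diagonal in the Fourier basis: $Q{\rm e}^{{\bf i}\ell x}=q_\ell{\rm e}^{{\bf i}\ell x}$ with $q_\ell\ge0$, and $Q^{\frac12}$ is Hilbert–Schmidt on $L^2(\mathbb{T})$. The functions $u_0$ and $\Phi$ are deterministic and independent of $\varepsilon$. The mild solution satisfies $u^\varepsilon(t)={\rm e}^{{\bf i}t\Delta}u_0-{\bf i}\varepsilon^2\int_0^t{\rm e}^{{\bf i}(t-s)\Delta}\Phi u^\varepsilon(s)\,ds+\varepsilon\int_0^t{\rm e}^{{\bf i}(t-s)\Delta}Q^{\frac12}\,dW(s)$ (it exists globally and is unique under the stated hypotheses). *)

(* Defs.v *)
From HB Require Import structures.
From mathcomp Require Import all_boot all_order all_algebra.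
From mathcomp Require Import all_classical all_reals all_analysis.
From mathcomp Require Import complex.

Set Implicit Arguments.
Unset Strict Implicit.
Unset Printing Implicit Defensive.

Import Order.TTheory GRing.Theory Num.Theory.
Import numFieldNormedType.Exports.

Local Open Scope classical_set_scope.
Local Open Scope ring_scope.

(* Elements of L^2(T), T = [-pi, pi], are represented by functions R -> R[i],
   of which only the values on [-pi, pi] matter, up to a.e. equality.
   Periodicity enters through the Fourier basis e^{ilx}, l : int. *)

Section torus.
Variable R : realType.
Notation C := (complex R).
Notation mu := (@lebesgue_measure R).
Implicit Types (w v : R -> C) (s t x : R) (l : int).

Definition torus : set R := `[- pi, pi].

Definition sqabs (z : C) : R := complex.Re z ^+ 2 + complex.Im z ^+ 2.

Definition expi (theta : R) : C := (cos theta +i* sin theta)%C.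

Definition realC (r : R) : C := (r +i* 0)%C.

Definition L2norm2 w : \bar R := (\int[mu]_(x in torus) (sqabs (w x))%:E)%E.

Definition L2norm w : \bar R := sqrte (L2norm2 w).

Definition L2T w : Prop :=
  [/\ measurable_fun torus (fun x => complex.Re (w x)),
      measurable_fun torus (fun x => complex.Im (w x))
    & (L2norm2 w < +oo)%E].

Definition L2sub w v : R -> C := fun x => w x - v x.

Definition L2eq w v : Prop := {ae mu, forall x, torus x -> w x = v x}.

Definition integralC (f : R -> C) : C :=
  ((\int[mu]_(x in torus) complex.Re (f x)) +i*
   (\int[mu]_(x in torus) complex.Im (f x)))%C.

(* \hat w_l, normalised so that
   w(x) = (2 pi)^{-1/2} \sum_l \hat w_l e^{ilx} in L^2(T). *)
Definition fourier w l : C :=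
  realC (Num.sqrt (2 * pi))^-1 *
  integralC (fun x => w x * expi (- (l%:~R * x))).

Definition basis l : R -> C :=
  fun x => realC (Num.sqrt (2 * pi))^-1 * expi (l%:~R * x).

(* The square of the H^s norm. *)
Definition Hnorm2 (s : nat) w : \bar R :=
  (\esum_(l in [set: int])
     ((1 + `|l%:~R : R| ^+ (2 * s)) * sqabs (fourier w l))%:E)%E.

Definition Hsob (s : nat) w : Prop := L2T w /\ (Hnorm2 s w < +oo)%E.

(* A Hilbert-Schmidt operator A on L^2(T) is represented by the images
   A l of the orthonormal basis vectors [basis l]. *)
Definition hilbert_schmidt (s : nat) (A : int -> R -> C) : Prop :=
  (forall l, L2T (A l)) /\ (\esum_(l in [set: int]) Hnorm2 s (A l) < +oo)%E.

(* Q^{1/2} for Q diagonal with eigenvalues q l on the Fourier basis. *)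
Definition Qhalf (q : int -> R) : int -> R -> C :=
  fun l x => realC (Num.sqrt (q l)) * basis l x.

(* v = e^{it Delta} w in L^2(T), using Delta e^{ilx} = - l^2 e^{ilx}.  This is
   a relation because v is only determined up to a.e. equality. *)
Definition schrodinger_group t w v : Prop :=
  [/\ L2T w, L2T v
    & forall l, fourier v l = expi (- (l%:~R ^+ 2 * t)) * fourier w l].

(* The L^2(T)-valued step function \sum_{k < n} 1_{]tau_k, tau_{k+1}]} w_k. *)
Record step_fun := StepFun {
  step_size : nat;
  step_node : nat -> R;
  step_coef : nat -> R -> C }.

Definition is_step_fun t (f : step_fun) : Prop :=
  [/\ 0 <= step_node f 0, step_node f (step_size f) <= t,
      forall k, (k < step_size f)%N -> step_node f k <= step_node f k.+1
    & forall k, (k < step_size f)%N -> L2T (step_coef f k)].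

Definition step_val (f : step_fun) s : R -> C := fun x =>
  \sum_(k < step_size f)
    (if (step_node f k < s) && (s <= step_node f k.+1)
     then step_coef f k x else 0).

(* The elementary integral of f against the increments of m. *)
Definition step_integral (f : step_fun) (m : R -> R) : R -> C := fun x =>
  \sum_(k < step_size f)
    realC (m (step_node f k.+1) - m (step_node f k)) * step_coef f k x.

(* fn tends to g a.e. on [0, t] and in L^p([0, t]; L^2(T)).  The a.e.
   convergence makes g strongly measurable. *)
Definition step_approx (p : nat) t (g : R -> R -> C) (fn : nat -> step_fun) :
    Prop :=
  [/\ forall n, is_step_fun t (fn n),
      {ae mu, forall s, s \in `[0, t] ->
         L2norm (L2sub (g s) (step_val (fn n) s)) @[n --> \oo] --> 0%E}
    & (\int[mu]_(s in `[0%R, t])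
         L2norm (L2sub (g s) (step_val (fn n) s)) ^+ p)%E @[n --> \oo]
       --> 0%E].

(* I = \int_0^t g(s) ds in L^2(T). *)
Definition bochner_integral t (g : R -> R -> C) (I : R -> C) : Prop :=
  [/\ forall s, s \in `[0, t] -> L2T (g s), L2T I
    & exists2 fn, step_approx 1 t g fn
      & L2norm (L2sub I (step_integral (fn n) id)) @[n --> \oo] --> 0%E].

(* The trace on L^2(T) of an open set; the Borel sets of L^2(T) are
   generated by these. *)
Definition L2open (U : set (R -> C)) : Prop :=
  forall w, L2T w -> U w ->
    exists2 r : R, 0 < r
      & forall v, L2T v -> (L2norm (L2sub v w) < r%:E)%E -> U v.

End torus.

Section stochastic.
Variables (R : realType) (d : measure_display) (Omega : measurableType d).
Variable P : probability Omega R.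
Notation C := (complex R).
Implicit Types (F : R -> set (set Omega)) (beta : int -> R -> Omega -> R).

(* X is an L^2(T)-valued random variable, measurable with respect to G. *)
Definition L2rv (G : set (set Omega)) (X : Omega -> R -> C) : Prop :=
  (forall w, L2T (X w)) /\ (forall U, L2open U -> G (X @^-1` U)).

Definition normal_filtration F : Prop :=
  [/\ forall t, 0 <= t -> sigma_algebra setT (F t) /\ F t `<=` measurable,
      forall s t, 0 <= s -> s <= t -> F s `<=` F t,
      forall A, measurable A -> P A = 0%E -> F 0 A
    & forall t A, 0 <= t -> (forall s, t < s -> F s A) -> F t A].

Definition sigma_generated (I : Type) (D : set I) (X : I -> Omega -> R) :
    set (set Omega) :=
  <<s [set A | exists2 i, D i & exists2 B, measurable B & A = X i @^-1` B] >>.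

Definition standard_brownian (b : R -> Omega -> R) : Prop :=
  [/\ {ae P, forall w, b 0 w = 0},
      {ae P, forall w, {within `[0, +oo[, continuous (fun t => b t w)}}
    & forall s t (B : set R), 0 <= s -> s < t -> measurable B ->
        P ((fun w => b t w - b s w) @^-1` B) =
        normal_prob 0 (Num.sqrt (t - s)) B].

(* Independent standard Brownian motions beta_l forming a cylindrical Wiener
   process with respect to F: for s < t the whole family of increments
   beta_l(t) - beta_l(s) is independent of F_s. *)
Definition iid_brownian F beta : Prop :=
  [/\ forall l, standard_brownian (beta l),
      forall l t (B : set R), 0 <= t -> measurable B ->
        F t (beta l t @^-1` B),
      forall s t A B, 0 <= s -> s < t -> F s A ->
        sigma_generated [set: int] (fun l w => beta l t w - beta l s w) B ->
        P (A `&` B) = (P A * P B)%E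
    & forall (J : seq int) (A : int -> set Omega), uniq J ->
        (forall l, l \in J -> sigma_generated `[0, +oo[ (beta l) (A l)) ->
        P (\big[setI/setT]_(l <- J) A l) = (\prod_(l <- J) P (A l))%E].

(* I = \int_0^t g(s) db(s) for a deterministic L^2(T)-valued integrand g: the
   limit in L^2(Omega; L^2(T)) of integrals of step functions. *)
Definition wiener_integral (b : R -> Omega -> R) (t : R) (g : R -> R -> C)
    (I : Omega -> R -> C) : Prop :=
  [/\ forall s, s \in `[0, t] -> L2T (g s), L2rv measurable I
    & exists2 fn, step_approx 2 t g fn
      & (\int[P]_w
           L2norm2 (L2sub (I w) (step_integral (fn n) (fun s => b s w))))%E
          @[n --> \oo] --> 0%E].

(* Z = \int_0^t Psi(s) dW(s), W = \sum_l beta_l e_l with e_l = basis l, for a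
   deterministic operator-valued Psi given by Psi s l = Psi(s) e_l: the sum in
   L^2(Omega; L^2(T)) of the integrals \int_0^t Psi(s) e_l dbeta_l(s). *)
Definition stochastic_integral beta (t : R) (Psi : R -> int -> R -> C)
    (Z : Omega -> R -> C) : Prop :=
  L2rv measurable Z /\
  exists2 I : int -> Omega -> R -> C,
    forall l, wiener_integral (beta l) t (fun s => Psi s l) (I l)
  & (\int[P]_w L2norm2 (L2sub (Z w)
       (fun x => (\sum_(k < N.*2.+1) I (k%:Z - N%:Z)%R w x)%R)))%E
      @[N --> \oo] --> 0%E.

(* Mild solution, on [0, +oo[, of
     du = i Delta u dt - i eps^2 Phi u dt + eps Q^{1/2} dW,  u(0) = u0:
   an adapted L^2(T)-valued process with a.s. continuous paths such that, for
   each t, the Duhamel formula holds a.s. in L^2(T). *)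
Definition mild_solution F beta (u0 : R -> C) (Phi : R -> R) (q : int -> R)
    (eps : R) (u : R -> Omega -> R -> C) : Prop :=
  [/\ forall t, 0 <= t -> L2rv (F t) (u t),
      {ae P, forall w, forall t, 0 <= t ->
         L2norm (L2sub (u s w) (u t w)) @[s --> within `[0, +oo[ (nbhs t)]
           --> 0%E}
    & forall t, 0 <= t ->
        exists (Psi : R -> int -> R -> C) (Z : Omega -> R -> C),
        [/\ forall s l, s \in `[0, t] ->
              schrodinger_group (t - s) (Qhalf q l) (Psi s l),
            stochastic_integral beta t Psi Z
          & {ae P, forall w, exists (v0 : R -> C) (f : R -> R -> C) (D : R -> C),
              [/\ schrodinger_group t u0 v0,
                  forall s, s \in `[0, t] ->
                    schrodinger_group (t - s)
                      (fun x => realC (Phi x) * u s w x) (f s),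
                  bochner_integral t f D
                & L2eq (u t w) (fun x =>
                    v0 x - (0 +i* (eps ^+ 2))%C * D x
                    + realC eps * Z w x)]}]].

End stochastic.

(* Main.v *)
(* Write a_l(t) = |\hat u_l(t)| and phi_m = (2 pi)^{-1/2} |\hat Phi_m|.  Since
   e^{it Delta} acts on Fourier coefficients by phases, Duhamel's formula gives
     a_l(t) <= Y_l + eps^2 \int_0^t (phi * a(s))_l ds,
     Y_l = |\hat u0_l| + eps sup_t |\hat Z_l(t)|,
   where Z is the stochastic convolution and the supremum is over a countable
   dense set of times.  Convolution with phi is bounded for the weighted l^2
   norm attached to H^sigma, so for lam large, depending on Phi only, Picard
   iteration yields a(t) <= e^{lam eps^2 t} A with ||A||^2 <= 8 ||Y||^2; on
   [0, T / eps^2] the exponential is at most e^{lam T}, uniformly in eps.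

   Finally e^{i l^2 t} \hat Z_l(t) is a Wiener integral of
   sqrt(q_l) e^{i l^2 s}, hence a martingale, and Doob's inequality bounds
   E sup_t |\hat Z_l(t)|^2 by a multiple of q_l T / eps^2.  The factor eps^2 in
   front of it cancels the length of the time interval. *)

(* The mild solution is a priori only a continuous path in L^2, so Gronwall's lemma cannot be
   applied to its H^sigma norm, which might be infinite. All coefficients, however, are bounded on
   [0, T / eps^2] by some constant K that depends on the path. Feeding this bound into Duhamel's
   inequality n times replaces it by the n-th Picard iterate, whose weighted norm is controlled,
   plus an error K / 2^n at every frequency; letting n grow on finite sets of frequencies removes K.
   Duhamel's formula holds almost surely at each fixed time, hence simultaneously only at countably
   many times. The coefficients are continuous in time, so the estimate extends from a dense set.
   Measurability of the supremum over all times is never established: its integral is a supremum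
   over simple functions, and a measurable majorant that dominates it almost surely is enough. The
   bound on the coefficients of Phi u rests on the uniform convergence of the Fourier series of Phi
   to Phi, hence on the uniqueness of Fourier coefficients; the latter is proved with trigonometric
   polynomials that approximate indicators of intervals. *)
Require Import Defs.
From HB Require Import structures.
From mathcomp Require Import all_boot all_order all_algebra.
From mathcomp Require Import all_classical all_reals all_analysis.
From mathcomp Require Import measurable_realfun complex.
From mathcomp Require Import ring lra zify.
Import Order.TTheory GRing.Theory Num.Theory.
Import numFieldNormedType.Exports.
Local Open Scope classical_set_scope.
Local Open Scope ring_scope.
Set Implicit Arguments.
Unset Strict Implicit.
Unset Printing Implicit Defensive.

(** * Integrals of nonnegative functions without measurability *)

Section lower_integral.
Context d (T : measurableType d) (R : realType).
Variable mu : {measure set T -> \bar R}.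
Implicit Types (D : set T) (f g : T -> \bar R).

(* The integral of a nonnegative function is a supremum over the simple
   functions below it, whether or not the function is measurable. *)
Lemma ge0_le_integral_lower D f g :
  (forall x, D x -> (0 <= f x)%E) -> (forall x, D x -> (f x <= g x)%E) ->
  (\int[mu]_(x in D) f x <= \int[mu]_(x in D) g x)%E.
Proof.
move=> f0 fg; have g0 x : D x -> (0 <= g x)%E.
  by move=> Dx; apply: le_trans (fg _ Dx); exact: f0.
rewrite !ge0_integralE//; apply: le_ereal_sup => _ [h hf <-].
exists h => // x; apply: le_trans (hf x) _; rewrite /patch.
by case: ifPn => // /set_mem; exact: fg.
Qed.

(** Raising [g] to +oo on a measurable null set that contains the exceptional points makes the
    domination pointwise and leaves the integral of [g] unchanged. No measurability is asked of [f],
    which will be a supremum over uncountably many times. *)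
Lemma ae_ge0_le_integral_lower f g : (forall x, (0 <= f x)%E) ->
  (forall x, (0 <= g x)%E) -> measurable_fun setT g ->
  {ae mu, forall x, (f x <= g x)%E} ->
  (\int[mu]_x f x <= \int[mu]_x g x)%E.
Proof.
move=> f0 g0 mg [N [mN muN0 subN]].
pose g' x := maxe (g x) ((cst +oo%E \_ N) x).
have mg' : measurable_fun setT g'.
  by apply: measurable_maxe => //; apply/(measurable_restrictT _ _).1.
have g'E x : ~ N x -> g' x = g x.
  by move=> xN; rewrite /g' patchE memNset// max_l.
apply: (@le_trans _ _ (\int[mu]_x g' x)%E).
  apply: ge0_le_integral_lower => // x _; have [xN|xN] := pselect (N x).
    by rewrite /g' patchE mem_set//= max_r leey.
  by rewrite g'E//; apply: contrapT => fg; apply: xN; exact: subN.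
rewrite le_eqVlt; apply/orP; left; apply/eqP.
apply: ge0_ae_eq_integral => //.
  by move=> x _; rewrite le_max g0.
exists N; split => // x /= /not_implyP[_].
by apply: contra_notP => /g'E.
Qed.

End lower_integral.

(** * Square-integrable functions *)

Section square_integrable.
Context d (T : measurableType d) (R : realType).
Variable mu : {measure set T -> \bar R}.
Implicit Types (f g h : T -> R).

Definition sqint f : Prop :=
  measurable_fun setT f /\ (\int[mu]_x (f x ^+ 2)%:E < +oo)%E.

Definition ip f g : R := \int[mu]_x (f x * g x).

Lemma sqint_integrable_mul f g : sqint f -> sqint g ->
  mu.-integrable setT (EFin \o (fun x => f x * g x)).
Proof.
move=> [mf If] [mg Ig].
have mfg : measurable_fun setT (fun x => f x * g x) by exact: measurable_funM.
apply/integrableP; split; first exact/measurable_EFinP.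
apply: (@le_lt_trans _ _
  (\int[mu]_x ((f x ^+ 2)%:E + (g x ^+ 2)%:E))%E).
  apply: ge0_le_integral_lower => // x _ /=.
  rewrite -EFinD lee_fin ler_norml; apply/andP; split.
    by rewrite -subr_ge0; have := sqr_ge0 (f x + g x); have := sqr_ge0 (f x);
       have := sqr_ge0 (g x); nra.
  by have := sqr_ge0 (f x - g x); have := sqr_ge0 (f x);
     have := sqr_ge0 (g x); nra.
rewrite ge0_integralD//=.
- by rewrite lte_add_pinfty.
- by move=> x _; rewrite lee_fin sqr_ge0.
- by apply/measurable_EFinP; exact: measurable_funX.
- by move=> x _; rewrite lee_fin sqr_ge0.
- by apply/measurable_EFinP; exact: measurable_funX.
Qed.

Lemma ipC f g : ip f g = ip g f.
Proof. by rewrite /ip; apply: eq_Rintegral => x _; rewrite mulrC. Qed.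

Lemma ip_ge0 f : 0 <= ip f f.
Proof. by apply: Rintegral_ge0 => x _; rewrite -expr2 sqr_ge0. Qed.

Lemma integral_sqrE f : sqint f -> (\int[mu]_x (f x ^+ 2)%:E)%E = (ip f f)%:E.
Proof.
move=> [mf If]; rewrite /ip /Rintegral.
under [in RHS]eq_integral do rewrite -expr2.
rewrite fineK// ge0_fin_numE//.
by apply: integral_ge0 => x _; rewrite lee_fin sqr_ge0.
Qed.

Lemma sqintD f g : sqint f -> sqint g -> sqint (fun x => f x + g x).
Proof.
move=> [mf If] [mg Ig]; split; first exact: measurable_funD.
apply: (@le_lt_trans _ _
  (\int[mu]_x (2%:E * (f x ^+ 2)%:E + 2%:E * (g x ^+ 2)%:E))%E).
  apply: ge0_le_integral_lower => x _; first by rewrite lee_fin sqr_ge0.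
  rewrite -!EFinM -EFinD lee_fin; have := sqr_ge0 (f x - g x); nra.
rewrite ge0_integralD//=.
- by rewrite !ge0_integralZl//= ?lte_add_pinfty ?lte_mul_pinfty//;
    try (by move=> x _; rewrite lee_fin sqr_ge0);
    apply/measurable_EFinP; exact: measurable_funX.
- by move=> x _; rewrite mule_ge0// lee_fin sqr_ge0.
- by apply: emeasurable_funM => //; apply/measurable_EFinP; exact: measurable_funX.
- by move=> x _; rewrite mule_ge0// lee_fin sqr_ge0.
- by apply: emeasurable_funM => //; apply/measurable_EFinP; exact: measurable_funX.
Qed.

Lemma sqintZ c f : sqint f -> sqint (fun x => c * f x).
Proof.
move=> [mf If]; split; first exact: measurable_funM.
rewrite (eq_integral (fun x => ((c ^+ 2)%:E * (f x ^+ 2)%:E)%E)); last first.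
  by move=> x _; rewrite -EFinM exprMn.
rewrite ge0_integralZl//= ?lte_mul_pinfty ?lee_fin ?sqr_ge0//.
  by apply/measurable_EFinP; exact: measurable_funX.
by move=> x _; rewrite lee_fin sqr_ge0.
Qed.

Lemma sqint0 : sqint (fun=> 0).
Proof.
split; first exact: measurable_cst.
by rewrite integral0_eq// => x _; rewrite expr0n.
Qed.

Lemma sqintB f g : sqint f -> sqint g -> sqint (fun x => f x - g x).
Proof.
move=> hf /(sqintZ (-1)) hg; have := sqintD hf hg.
by congr sqint; apply/funext => x; rewrite mulN1r.
Qed.

Lemma sqint_sum (I : Type) (s : seq I) (F : I -> T -> R) :
  (forall i, sqint (F i)) -> sqint (fun x => \sum_(i <- s) F i x).
Proof.
move=> hF; elim: s => [|i s ih].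
  by have := sqint0; congr sqint; apply/funext => x; rewrite big_nil.
have := sqintD (hF i) ih; congr sqint.
by apply/funext => x; rewrite big_cons.
Qed.

Lemma sqint_le f g : measurable_fun setT f -> sqint g ->
  (forall x, `|f x| <= `|g x|) -> sqint f.
Proof.
move=> mf [mg Ig] fg; split => //; apply: le_lt_trans Ig.
apply: ge0_le_integral_lower => x _; first by rewrite lee_fin sqr_ge0.
by rewrite lee_fin -(real_normK (num_real (f x))) -(real_normK (num_real (g x)))
  lerXn2r ?nnegrE.
Qed.

Lemma sqint_max f g : sqint f -> sqint g -> sqint (fun x => Num.max (f x) (g x)).
Proof.
move=> hf hg; have [mf _] := hf; have [mg _] := hg.
apply: (@sqint_le _ (fun x => `|f x| + `|g x|)).
- exact: measurable_maxr.
- apply: sqintD.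
    apply: sqint_le hf _; first exact: measurableT_comp.
    by move=> x; rewrite normr_id.
  apply: sqint_le hg _; first exact: measurableT_comp.
  by move=> x; rewrite normr_id.
- move=> x; rewrite [leRHS]ger0_norm ?addr_ge0//.
  by case: (leP (f x) (g x)) => _; rewrite ?lerDl ?lerDr.
Qed.

Lemma ipDl f g h : sqint f -> sqint g -> sqint h ->
  ip (fun x => f x + g x) h = ip f h + ip g h.
Proof.
move=> hf hg hh; rewrite /ip -RintegralD//; try exact: sqint_integrable_mul.
by apply: eq_Rintegral => x _; rewrite mulrDl.
Qed.

Lemma ipZl c f h : sqint f -> sqint h -> ip (fun x => c * f x) h = c * ip f h.
Proof.
move=> hf hh; rewrite /ip -RintegralZl//; last exact: sqint_integrable_mul.
by apply: eq_Rintegral => x _; rewrite mulrA.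
Qed.

Lemma ipBl f g h : sqint f -> sqint g -> sqint h ->
  ip (fun x => f x - g x) h = ip f h - ip g h.
Proof.
move=> hf hg hh; rewrite -mulN1r -ipZl// -ipDl//; last exact: sqintZ.
by congr ip; apply/funext => x; rewrite mulN1r.
Qed.

Lemma ip_suml (I : Type) (s : seq I) (F : I -> T -> R) h :
  (forall i, sqint (F i)) -> sqint h ->
  ip (fun x => \sum_(i <- s) F i x) h = \sum_(i <- s) ip (F i) h.
Proof.
move=> hF hh; elim: s => [|i s ih].
  rewrite big_nil /ip /Rintegral integral0_eq// => x _.
  by rewrite big_nil mul0r.
rewrite big_cons -ih -ipDl//; last exact: sqint_sum.
by congr ip; apply/funext => x; rewrite big_cons.
Qed.

Lemma ipDr f g h : sqint f -> sqint g -> sqint h ->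
  ip h (fun x => f x + g x) = ip h f + ip h g.
Proof. by move=> *; rewrite ipC ipDl// !(ipC h). Qed.

Lemma ipZr c f h : sqint f -> sqint h -> ip h (fun x => c * f x) = c * ip h f.
Proof. by move=> *; rewrite ipC ipZl// (ipC h). Qed.

Lemma ipBr f g h : sqint f -> sqint g -> sqint h ->
  ip h (fun x => f x - g x) = ip h f - ip h g.
Proof. by move=> *; rewrite ipC ipBl// !(ipC h). Qed.

Lemma ip_sumr (I : Type) (s : seq I) (F : I -> T -> R) h :
  (forall i, sqint (F i)) -> sqint h ->
  ip h (fun x => \sum_(i <- s) F i x) = \sum_(i <- s) ip h (F i).
Proof.
by move=> hF hh; rewrite ipC ip_suml//; apply: eq_bigr => i _; rewrite ipC.
Qed.

Lemma ip_le f g f' g' : sqint f -> sqint g -> sqint f' -> sqint g' ->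
  (forall x, f x * g x <= f' x * g' x) -> ip f g <= ip f' g'.
Proof. by move=> *; apply: le_Rintegral => //; exact: sqint_integrable_mul. Qed.

Lemma ip_sqrD f g : sqint f -> sqint g ->
  ip (fun x => f x + g x) (fun x => f x + g x) <= 2 * ip f f + 2 * ip g g.
Proof.
move=> hf hg; have h0 := ip_ge0 (fun x => f x - g x).
have hB := sqintB hf hg; have hD := sqintD hf hg.
rewrite ipDl// !ipDr//; rewrite ipBl// !ipBr// in h0.
by move: h0; rewrite !(ipC g f); lra.
Qed.

Lemma ip_sqrB f g : sqint f -> sqint g ->
  ip (fun x => f x - g x) (fun x => f x - g x) <= 2 * ip f f + 2 * ip g g.
Proof.
move=> hf hg; have h0 := ip_ge0 (fun x => f x + g x).
have hB := sqintB hf hg; have hD := sqintD hf hg.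
rewrite ipBl// !ipBr//; rewrite ipDl// !ipDr// in h0.
by move: h0; rewrite !(ipC g f); lra.
Qed.

Lemma ip_CS f g : sqint f -> sqint g -> ip f g ^+ 2 <= ip f f * ip g g.
Proof.
move=> hf hg.
have h c : 0 <= ip f f - 2 * c * ip f g + c ^+ 2 * ip g g.
  have := ip_ge0 (fun x => f x - c * g x); have hc := sqintZ c hg.
  rewrite ipBl//; last exact: sqintB.
  by rewrite !ipBr// !ipZl// !ipZr// (ipC g f); lra.
have [g0|g0] := eqVneq (ip g g) 0.
  rewrite g0 mulr0.
  have h' c : 0 <= ip f f - c * ip f g by have := h (c / 2); rewrite g0; lra.
  have [->|fg0] := eqVneq (ip f g) 0; first by rewrite expr0n.
  (* If [g] has norm zero the quadratic polynomial is affine in c; at this c it would take the value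
     -1. *)
  have := h' ((ip f f + 1) / ip f g); rewrite divfK//; lra.
have gp : 0 < ip g g by rewrite lt_def g0 ip_ge0.
have := h (ip f g / ip g g); rewrite -(pmulr_rge0 _ gp).
suff -> : ip g g * (ip f f - 2 * (ip f g / ip g g) * ip f g +
  (ip f g / ip g g) ^+ 2 * ip g g) = ip f f * ip g g - ip f g ^+ 2 by lra.
by field.
Qed.

End square_integrable.

(** * Moments of the normal distribution *)

Section density.
Context d (T : measurableType d) (R : realType).
Variables mu nu : {measure set T -> \bar R}.
Variable g : T -> R.
Hypothesis g0 : forall x, 0 <= g x.
Hypothesis mg : measurable_fun setT g.
Hypothesis nuE : forall A, measurable A -> nu A = (\int[mu]_(x in A) (g x)%:E)%E.

Import HBNNSimple.

(** Both sides are monotone limits over the simple approximations of [f], and on an indicator the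
    identity is [nuE]. It turns expectations of functions of a Brownian increment into Gaussian
    integrals. *)
Lemma ge0_integral_density (f : T -> \bar R) : (forall x, (0 <= f x)%E) ->
  measurable_fun setT f ->
  (\int[nu]_x f x = \int[mu]_x (f x * (g x)%:E))%E.
Proof.
move=> f0 mf; pose h := nnsfun_approx measurableT mf.
have fE x : f x = lim ((EFin \o h n) x @[n --> \oo]).
  by apply/esym/cvg_lim => //; exact: cvg_nnsfun_approx.
have hnd x : {homo (fun n => (EFin \o h n) x) : a b / (a <= b)%N >-> (a <= b)%E}.
  by move=> a b ab; rewrite lee_fin; exact/lefP/nd_nnsfun_approx.
transitivity (lim ((\int[nu]_x (EFin \o h n) x)%E @[n --> \oo])).
  under eq_integral do rewrite fE.
  apply: monotone_convergence => [//| | |x _].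
  - by move=> n; apply/measurable_EFinP.
  - by move=> n x _; rewrite lee_fin.
  - exact: hnd.
transitivity (lim ((\int[mu]_x ((EFin \o h n) x * (g x)%:E))%E @[n --> \oo])); last first.
  have fgE x : (f x * (g x)%:E)%E = lim (((EFin \o h n) x * (g x)%:E)%E @[n --> \oo]).
    by apply/esym/cvg_lim => //; apply: cvgeZr => //; exact: cvg_nnsfun_approx.
  under [RHS]eq_integral do rewrite fgE.
  symmetry; apply: monotone_convergence => [//| | |].
  - by move=> n; apply/emeasurable_funM; apply/measurable_EFinP.
  - by move=> n x _; rewrite mule_ge0// lee_fin.
  - by move=> x _ a b ab; rewrite lee_wpmul2r ?lee_fin//; exact: hnd.
congr (limn _); apply/funext => n.
transitivity (\int[nu]_x
   (\sum_(y \in range (h n)) (y * \1_(h n @^-1` [set y]) x)%:E))%E.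
  by apply: eq_integral => t tE; rewrite /= fimfunE -fsumEFin.
rewrite ge0_integral_fsum//; last 2 first.
  by move=> r; apply/measurable_EFinP; exact: measurable_funM.
  by move=> m y _; exact: nnfun_muleindic_ge0.
transitivity (\int[mu]_x (\sum_(y \in range (h n))
    (y * \1_(h n @^-1` [set y]) x)%:E * (g x)%:E))%E; last first.
  apply: eq_integral => x _.
  rewrite -ge0_mule_fsuml => [|y]; last exact: nnfun_muleindic_ge0.
  by rewrite fsumEFin // -(fimfunE _ x).
rewrite ge0_integral_fsum//; last 2 first.
  - move=> y; apply: emeasurable_funM; apply/measurable_EFinP => //.
    exact: measurable_funM.
  - by move=> m y Ey; apply: mule_ge0; [exact: nnfun_muleindic_ge0|rewrite lee_fin].
apply: eq_fsbigr => r /set_mem[x0 _ rE].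
have r0 : 0 <= r by rewrite -rE.
under eq_integral do rewrite EFinM.
rewrite ge0_integralZl//=; last by apply/measurable_EFinP.
rewrite integral_indic// setIT nuE//.
under [RHS]eq_integral do rewrite EFinM -muleA.
rewrite ge0_integralZl//=; last 2 first.
  by apply: emeasurable_funM; apply/measurable_EFinP.
  by move=> x _; rewrite mule_ge0 ?lee_fin.
congr (_ * _)%E; rewrite [LHS]integral_mkcond; apply: eq_integral => x _.
rewrite patchE indicE; case: ifPn => _; first by rewrite mul1e.
by rewrite mul0e.
Qed.

End density.

Section normal_moments.
Context {R : realType}.
Variable s : R.
Hypothesis s_gt0 : 0 < s.
Notation mu := (@lebesgue_measure R).
Local Notation phi := (@normal_pdf R 0 s).

Let phi0 x : 0 <= phi x. Proof. exact: normal_pdf_ge0. Qed.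

Let mphi : measurable_fun setT phi. Proof. exact: measurable_normal_pdf. Qed.

Let phiE x : phi x = normal_peak s * expR (- x ^+ 2 / (s ^+ 2 *+ 2)).
Proof. by rewrite normal_pdfE ?gt_eqF// /normal_fun subr0. Qed.

Let phi_even x : phi (- x) = phi x.
Proof. by rewrite !phiE sqrrN. Qed.

Let cphi : continuous phi. Proof. by apply: continuous_normal_pdf; rewrite gt_eqF. Qed.

Let s0 : s != 0. Proof. by rewrite gt_eqF. Qed.

(** This primitive reduces the second moment to the fundamental theorem of calculus: (s^2 - x^2) phi
    is the derivative of s^2 x phi. *)
Let dphi x : @is_derive R R^o R^o x 1 (fun x : R => x * phi x : R)
  ((1 - x ^+ 2 / s ^+ 2) * phi x).
Proof.
have -> : (fun x : R => x * phi x : R) =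
    (fun x => x * (normal_peak s * expR (- x ^+ 2 / (s ^+ 2 *+ 2)))).
  by apply/funext => y; rewrite phiE.
rewrite phiE; apply: is_derive_eq.
rewrite /GRing.scale/= ?expr1 !mulr1.
have := s0; set e := expR _; set c := normal_peak s => s0'.
by field.
Qed.

Let cxphi : continuous (fun x : R => x * phi x : R).
Proof. by move=> x; apply: cvgM; [exact: cvg_id|exact: cphi]. Qed.

Let xphi_cvg : (x * phi x) @[x --> +oo] --> (0 : R).
Proof.
apply/cvgrPdist_lt => e e0; near=> x.
have x0 : 0 < x by near: x; exact: nbhs_pinfty_gt.
have xe : normal_peak s * (s ^+ 2 *+ 2) / e < x.
  by near: x; apply: nbhs_pinfty_gt; rewrite num_real.
rewrite sub0r normrN ger0_norm ?mulr_ge0 ?phi0 1?ltW//.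
have p0 : 0 < normal_peak s by apply: normal_peak_gt0.
have s2 : 0 < s ^+ 2 *+ 2 by rewrite pmulrn_lgt0// exprn_gt0.
(* From 1 + y <= e^y with y = x^2 / (2 s^2). *)
have h : expR (- x ^+ 2 / (s ^+ 2 *+ 2)) <= (s ^+ 2 *+ 2) / x ^+ 2.
  rewrite mulNr expRN -[leRHS]invrK lef_pV2 ?posrE ?expR_gt0 ?invr_gt0 ?divr_gt0 ?exprn_gt0//.
  by rewrite invf_div; apply: le_trans (expR_ge1Dx _); rewrite lerDr.
apply: (@le_lt_trans _ _ (normal_peak s * (s ^+ 2 *+ 2) / x)).
  rewrite phiE mulrCA -mulrA ler_wpM2l ?(ltW p0)//.
  apply: (@le_trans _ _ (x * ((s ^+ 2 *+ 2) / x ^+ 2))); first by rewrite ler_wpM2l ?(ltW x0).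
  by rewrite mulrCA expr2 invfM mulVKf ?gt_eqF.
by rewrite ltr_pdivrMr// (mulrC e) -ltr_pdivrMr.
Unshelve. all: by end_near. Qed.

Let tail_int : (\int[mu]_(x in `[s, +oo[) ((x ^+ 2 - s ^+ 2) * phi x)%:E =
  (s ^+ 3 * phi s)%:E)%E.
Proof.
have dF (x : R) : @is_derive R R^o R^o x 1 (fun x : R => - s ^+ 2 * (x * phi x) : R)
    ((x ^+ 2 - s ^+ 2) * phi x).
  have h := dphi x; apply: is_derive_eq.
  by rewrite /GRing.scale/=; field; exact: s0.
rewrite (@ge0_continuous_FTC2y _ _ (fun x => - s ^+ 2 * (x * phi x)) _ 0).
- by rewrite sub0e -EFinN; congr EFin; ring.
- move=> x sx; rewrite mulr_ge0// subr_ge0 lerXn2r ?nnegrE ?(ltW s_gt0)//.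
  by rewrite (le_trans (ltW s_gt0)).
- apply: continuous_subspaceT => x; apply: cvgM; last exact: cphi.
  by apply: (@cvgB _ R^o); [exact: exprn_continuous|exact: cvg_cst].
- rewrite -[X in _ --> X](mulr0 (- s ^+ 2)); apply: cvgM; [exact: cvg_cst|exact: xphi_cvg].
- by move=> x _; have := dF x; case.
- apply: cvg_at_right_filter; apply: cvgM; [exact: cvg_cst|exact: cxphi].
- by move=> x _; rewrite derive1E; have := dF x; case.
Qed.

Let head_int : (\int[mu]_(x in `[0%R, s]) ((s ^+ 2 - x ^+ 2) * phi x)%:E =
  (s ^+ 3 * phi s)%:E)%E.
Proof.
have dF (x : R) : @is_derive R R^o R^o x 1 (fun x : R => s ^+ 2 * (x * phi x) : R)
    ((s ^+ 2 - x ^+ 2) * phi x).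
  have h := dphi x; apply: is_derive_eq.
  by rewrite /GRing.scale/=; field; exact: s0.
have cF (x : R) : {for x, continuous (fun x : R => s ^+ 2 * (x * phi x) : R)}.
  by apply: cvgM; [exact: cvg_cst|exact: cxphi].
rewrite (@continuous_FTC2 _ _ (fun x => s ^+ 2 * (x * phi x))).
- by rewrite -EFinB; congr EFin; ring.
- exact: s_gt0.
- apply: continuous_subspaceT => x; apply: cvgM; last exact: cphi.
  by apply: (@cvgB _ R^o); [exact: cvg_cst|exact: exprn_continuous].
- split.
  + by move=> x _; have := dF x; case.
  + by apply: cvg_at_right_filter; exact: cF.
  + by apply: cvg_at_left_filter; exact: cF.
- by move=> x _; rewrite derive1E; have := dF x; case.
Qed.

(** The function (x^2 - s^2) phi changes sign at |x| = s, and its positive part [p] and negative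
    part [n] have the same integral 2 s^3 phi(s). Hence x^2 phi and s^2 phi have the same integral.
    Working with [p] and [n] keeps all integrands nonnegative, so finiteness of the moment is not
    presupposed. *)
Lemma normal_second_moment : (\int[mu]_x (x ^+ 2 * phi x)%:E = (s ^+ 2)%:E)%E.
Proof.
pose p (x : R) := Num.max (x ^+ 2 - s ^+ 2) 0 * phi x.
pose n (x : R) := Num.max (s ^+ 2 - x ^+ 2) 0 * phi x.
have p0 x : 0 <= p x by rewrite mulr_ge0// le_max lexx orbT.
have n0 x : 0 <= n x by rewrite mulr_ge0// le_max lexx orbT.
have cp : continuous p.
  move=> x; apply: cvgM; last exact: cphi.
  apply: (@continuous_max _ _ (fun x : R => x ^+ 2 - s ^+ 2) (fun=> 0)); last exact: cvg_cst.
  by apply: (@cvgB _ R^o); [exact: exprn_continuous|exact: cvg_cst].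
have cn : continuous n.
  move=> x; apply: cvgM; last exact: cphi.
  apply: (@continuous_max _ _ (fun x : R => s ^+ 2 - x ^+ 2) (fun=> 0)); last exact: cvg_cst.
  by apply: (@cvgB _ R^o); [exact: cvg_cst|exact: exprn_continuous].
have mx2 : measurable_fun setT (fun x : R => (x ^+ 2 * phi x)%:E).
  by apply/measurable_EFinP; apply: measurable_funM => //; exact: measurable_funX.
have pE : (\int[mu]_x (p x)%:E = 2%:E * (s ^+ 3 * phi s)%:E)%E.
  rewrite ge0_symfun_integralT//; last by move=> x; rewrite /p /= sqrrN phi_even.
  congr (_ * _)%E; rewrite -tail_int [LHS]integral_mkcond [RHS]integral_mkcond.
  apply: eq_integral => x _; rewrite !patchE.
  have -> : (x \in [set x | 0 <= x]) = (0 <= x) by apply/idP/idP; rewrite inE.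
  rewrite mem_setE in_itv/= andbT.
  case: (leP s x) => sx.
    rewrite (le_trans (ltW s_gt0) sx) /p max_l// subr_ge0 lerXn2r// ?nnegrE ?(ltW s_gt0)//.
    by rewrite (le_trans (ltW s_gt0)).
  case: (leP 0 x) => x0 //.
  by rewrite /p max_r ?mul0r// subr_le0 lerXn2r// ?nnegrE ltW.
have nE : (\int[mu]_x (n x)%:E = 2%:E * (s ^+ 3 * phi s)%:E)%E.
  rewrite ge0_symfun_integralT//; last by move=> x; rewrite /n /= sqrrN phi_even.
  congr (_ * _)%E; rewrite -head_int [LHS]integral_mkcond [RHS]integral_mkcond.
  apply: eq_integral => x _; rewrite !patchE.
  have -> : (x \in [set x | 0 <= x]) = (0 <= x) by apply/idP/idP; rewrite inE.
  rewrite mem_setE in_itv/=.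
  case: (leP 0 x) => x0 //=; case: (leP x s) => sx.
    by rewrite /n max_l// subr_ge0 lerXn2r// ?nnegrE// (ltW s_gt0).
  by rewrite /n max_r ?mul0r// subr_le0 lerXn2r// ?nnegrE ?(ltW s_gt0)// ltW.
have : (\int[mu]_x (x ^+ 2 * phi x + n x)%:E = \int[mu]_x (s ^+ 2 * phi x + p x)%:E)%E.
  apply: eq_integral => x _; congr EFin; rewrite /n /p -!mulrDl; congr (_ * _).
  by case: (leP (x ^+ 2) (s ^+ 2)) => h; [rewrite max_l ?max_r|rewrite max_r ?max_l];
    rewrite ?subr_le0 ?subr_ge0// ?(ltW h)//; ring.
under eq_integral do rewrite EFinD.
under [in RHS]eq_integral do rewrite EFinD.
have mn : measurable_fun setT n by exact: continuous_measurable_fun.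
have mp : measurable_fun setT p by exact: continuous_measurable_fun.
have sphi0 (c x : R) : (0 <= (c ^+ 2 * phi x)%:E)%E.
  by rewrite lee_fin mulr_ge0// sqr_ge0.
have mn' : measurable_fun setT (EFin \o n) by exact/measurable_EFinP.
have mp' : measurable_fun setT (EFin \o p) by exact/measurable_EFinP.
have msphi : measurable_fun setT (EFin \o (fun x : R => s ^+ 2 * phi x)).
  by apply/measurable_EFinP; exact: measurable_funM.
rewrite !ge0_integralD//.
rewrite pE nE; under [in RHS]eq_integral do rewrite EFinM.
have mphi' : measurable_fun setT (EFin \o phi) by exact/measurable_EFinP.
rewrite ge0_integralZl//= ?lee_fin ?sqr_ge0//.
rewrite integral_normal_pdf mule1 -EFinM.
by move/(congr1 (fun z => z - (2 * (s ^+ 3 * phi s))%:E)%E); rewrite !addeK.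
all: by move=> x _; rewrite lee_fin.
Qed.

(** Reflection x -> -x and evenness of the density. The statement compares positive and negative
    parts, so it makes sense before integrability is known; it gives the centering of Brownian
    increments. *)
Lemma normal_mean : (\int[mu]_x (Num.max x 0 * phi x)%:E =
  \int[mu]_x (Num.max (- x) 0 * phi x)%:E)%E.
Proof.
pose f (x : R) := (Num.max x 0 * phi x)%:E.
have mf : measurable_fun setT f.
  apply/measurable_EFinP; apply: measurable_funM => //.
  exact: measurable_maxr.
have f0 x : (0 <= f x)%E by rewrite lee_fin mulr_ge0// le_max lexx orbT.
have := ge0_integration_by_substitution0 mf f0.
rewrite [LHS]integral_mkcond [RHS]integral_mkcond.
rewrite [X in X = _](_ : _ = \int[mu]_x f x)%E; last first.
  apply: eq_integral => x _; rewrite patchE mem_setE in_itv/= andbT.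
  by case: (leP 0 x) => // x0; rewrite /f max_r ?mul0r// ltW.
move=> ->; apply: eq_integral => x _; rewrite patchE mem_setE in_itv/= /f phi_even.
by case: (leP x 0) => // x0; rewrite max_r ?mul0r// oppr_le0 ltW.
Qed.

End normal_moments.

(** * The Wiener integral of deterministic step functions *)

Section step_lists.
Context (R : realType).
Implicit Types (L : seq (R * R)) (t s : R).

Definition oc0 t : set R := `]0, t]%classic.

(* A list of pairs (c, t) stands for the step function
   \sum c 1_{]0, t]}. *)
Definition step_of L s : R := \sum_(p <- L) p.1 * \1_(oc0 p.2) s.

(** Clipping multiplies the step function by the indicator of ]0, t]; on the probabilistic side it
    stops the integral at time t. *)
Definition clip t L := [seq (p.1, Num.min t p.2) | p <- L].

Definition neg_list L := [seq (- p.1, p.2) | p <- L].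

(** A negative endpoint stands for an empty interval; [Num.max] sends it to b 0, which vanishes
    almost surely. The isometry thus holds for arbitrary lists. *)
Definition wiener (Omega : Type) (b : R -> Omega -> R) L w : R :=
  \sum_(p <- L) p.1 * b (Num.max 0 p.2) w.

Lemma measurable_oc0 t : measurable (oc0 t).
Proof. exact: measurable_itv. Qed.

Lemma lebesgue_measure_oc0 t : lebesgue_measure (oc0 t) = (Num.max 0 t)%:E.
Proof.
rewrite /oc0 lebesgue_measure_itv/= lte_fin.
by case: (leP t 0) => h; rewrite ?oppr0 ?adde0.
Qed.

Lemma oc0I s t : oc0 s `&` oc0 t = oc0 (Num.min s t).
Proof.
apply/seteqP; split => x /=; rewrite /oc0 /= !in_itv/= ?le_min.
  by move=> [/andP[-> ->] /andP[_ ->]].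
by move=> /andP[-> /andP[-> ->]].
Qed.

Lemma indic_oc0M s t x :
  \1_(oc0 s) x * \1_(oc0 t) x = \1_(oc0 (Num.min s t)) x :> R.
Proof. by rewrite -oc0I indicI. Qed.

Lemma indic_sqr_le1 (A : set R) x : (\1_A x : R) ^+ 2 <= 1.
Proof. by rewrite indicE; case: (x \in A); rewrite ?expr1n ?expr0n. Qed.

Lemma sqint_indic_oc0 t : sqint (@lebesgue_measure R) (\1_(oc0 t) : R -> R).
Proof.
have mt := measurable_oc0 t; split; first exact: measurable_indic.
under eq_integral => s _ do rewrite expr2 indic_oc0M minxx.
by rewrite integral_indic// setIT [X in (X < _)%E](lebesgue_measure_oc0 t) ltry.
Qed.

Lemma ip_indic_oc0 s t : ip (@lebesgue_measure R) (\1_(oc0 s)) (\1_(oc0 t)) =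
  Num.min (Num.max 0 s) (Num.max 0 t).
Proof.
rewrite /ip /Rintegral; under eq_integral do rewrite indic_oc0M.
rewrite integral_indic//; last exact: measurable_oc0.
by rewrite setIT [X in fine X](lebesgue_measure_oc0 _)/= maxEle minEle !maxEle !minEle; repeat case: ifP => //; lra.
Qed.

Lemma sqint_step_of L : sqint (@lebesgue_measure R) (step_of L).
Proof. by apply: sqint_sum => p; apply: sqintZ; exact: sqint_indic_oc0. Qed.

Lemma step_of_clip t L s : step_of (clip t L) s = \1_(oc0 t) s * step_of L s.
Proof.
rewrite /step_of big_map mulr_sumr; apply: eq_bigr => p _ /=.
by rewrite mulrCA indic_oc0M.
Qed.

Lemma step_of_cat L1 L2 s : step_of (L1 ++ L2) s = step_of L1 s + step_of L2 s.
Proof. by rewrite /step_of big_cat. Qed.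

Lemma step_of_neg L s : step_of (neg_list L) s = - step_of L s.
Proof. by rewrite /step_of big_map -sumrN; apply: eq_bigr => p _; rewrite mulNr. Qed.

Lemma clip_neg t L : clip t (neg_list L) = neg_list (clip t L).
Proof. by rewrite /clip /neg_list -!map_comp. Qed.

Lemma wiener_cat (Omega : Type) (b : R -> Omega -> R) L1 L2 w :
  wiener b (L1 ++ L2) w = wiener b L1 w + wiener b L2 w.
Proof. by rewrite /wiener big_cat. Qed.

Lemma wiener_neg (Omega : Type) (b : R -> Omega -> R) L w :
  wiener b (neg_list L) w = - wiener b L w.
Proof. by rewrite /wiener big_map -sumrN; apply: eq_bigr => p _; rewrite mulNr. Qed.

End step_lists.

Section running_max.
Context (R : realDomainType).

(** The value 0 is included, so the maximum is nonnegative and comparisons with it survive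
    squaring. *)
Fixpoint runmax (s : nat -> R) n : R :=
  if n is n'.+1 then Num.max (runmax s n') (s n) else Num.max 0 (s 0%N).

Lemma runmax_ge s i n : (i <= n)%N -> s i <= runmax s n.
Proof.
elim: n => [|n ih]; first by rewrite leqn0 => /eqP->; rewrite /= le_max lexx orbT.
rewrite leq_eqVlt => /orP[/eqP->|]; first by rewrite /= le_max lexx orbT.
by rewrite ltnS => /ih h; rewrite /= le_max h.
Qed.

Lemma runmax_ge0 s n : 0 <= runmax s n.
Proof. by elim: n => [|n ih] /=; rewrite le_max ?lexx ?ih. Qed.

Lemma runmax_le s n c : 0 <= c -> (forall i, (i <= n)%N -> s i <= c) ->
  runmax s n <= c.
Proof.
move=> c0; elim: n => [|n ih] h /=; rewrite ge_max ?c0 ?h//.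
by rewrite ih// => i /leqW; exact: h.
Qed.

End running_max.

(** * Brownian motion relative to a filtration *)

Section brownian.
Context (R : realType) (d : measure_display) (Omega : measurableType d).
Variable P : probability Omega R.
Variable F : R -> set (set Omega).
Variable b : R -> Omega -> R.
Hypothesis hF : normal_filtration P F.
Hypothesis bstd : standard_brownian P b.
Hypothesis bF : forall (t : R) (B : set R), 0 <= t -> measurable B -> F t (b t @^-1` B).
Hypothesis bind : forall (s t : R) A (B : set R), 0 <= s -> s < t -> F s A -> measurable B ->
  P (A `&` (fun w => b t w - b s w) @^-1` B) =
  (P A * P ((fun w => (b t w - b s w)%R) @^-1` B))%E.

Definition adapted t (X : Omega -> R) : Prop :=
  forall B : set R, measurable B -> F t (X @^-1` B).

Let F_sigma t : 0 <= t -> sigma_algebra setT (F t).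
Proof. by case: hF => h _ _ _ /h[]. Qed.

Let F_meas t : 0 <= t -> F t `<=` measurable.
Proof. by case: hF => h _ _ _ /h[]. Qed.

(** Viewing [F t] as the sigma-algebra it generates gives access to the calculus of measurable
    functions for adapted variables. *)
Lemma adaptedP t X : 0 <= t ->
  adapted t X <-> measurable_fun (setT : set (g_sigma_algebraType (F t))) (X : g_sigma_algebraType (F t) -> R).
Proof.
move=> t0; have sE : <<s F t >> = F t by rewrite sigma_algebra_id//; exact: F_sigma.
split.
  move=> aX _ B mB; rewrite setTI /measurable/= sE; exact: aX.
by move=> mX B mB; have := mX measurableT B mB; rewrite setTI /measurable/= sE.
Qed.

Lemma adapted_measurable t X : 0 <= t -> adapted t X -> measurable_fun setT X.
Proof. by move=> t0 aX _ B mB; rewrite setTI; apply: (F_meas t0); exact: aX. Qed.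

Lemma adapted_le s t X : 0 <= s -> s <= t -> adapted s X -> adapted t X.
Proof. by move=> s0 st aX B /aX; case: hF => _ h _ _; exact: h. Qed.

Lemma adapted_brownian s t : 0 <= s -> s <= t -> adapted t (b s).
Proof. by move=> s0 st; apply: adapted_le st _ => // B; exact: bF. Qed.

Lemma measurable_brownian t : 0 <= t -> measurable_fun setT (b t).
Proof. by move=> t0; apply: (adapted_measurable t0); exact: adapted_brownian. Qed.

Lemma brownian_increment_integral s t (f : R -> \bar R) : 0 <= s -> s < t ->
  (forall x, (0 <= f x)%E) -> measurable_fun setT f ->
  (\int[P]_w f (b t w - b s w)%R =
   \int[lebesgue_measure]_x (f x * (normal_pdf 0 (Num.sqrt (t - s)) x)%:E))%E.
Proof.
move=> s0 st f0 mf; have t0 := le_trans s0 (ltW st).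
have mY : @measurable_fun _ _ Omega (measurableTypeR R) setT (fun w => b t w - b s w).
  by apply: measurable_funB; exact: measurable_brownian.
pose Y : {mfun Omega >-> measurableTypeR R} :=
  @mfun_Sub _ _ Omega (measurableTypeR R) _ (mem_set mY).
rewrite -(@ge0_integral_density _ _ R lebesgue_measure (distribution P Y) (normal_pdf 0 (Num.sqrt (t - s))))//.
- by rewrite ge0_integral_distribution.
- by move=> x; exact: normal_pdf_ge0.
- exact: measurable_normal_pdf.
- move=> A mA; case: bstd => _ _ h; exact: h.
Qed.

Lemma sqint_brownian_increment s t : 0 <= s -> s <= t ->
  sqint P (fun w => b t w - b s w).
Proof.
move=> s0; rewrite le_eqVlt => /orP[/eqP->|st].
  by have := @sqint0 _ _ _ P; congr sqint; apply/funext => w; rewrite subrr.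
have t0 := le_trans s0 (ltW st).
split; first by apply: measurable_funB; exact: measurable_brownian.
rewrite (brownian_increment_integral (f := fun x => (x ^+ 2)%:E))//.
- under eq_integral do rewrite -EFinM.
  by rewrite normal_second_moment ?ltry// sqrtr_gt0 subr_gt0.
- by move=> x; rewrite lee_fin sqr_ge0.
- by apply/measurable_EFinP; exact: measurable_funX.
Qed.

Lemma brownian_increment_var s t : 0 <= s -> s <= t ->
  ip P (fun w => b t w - b s w) (fun w => b t w - b s w) = t - s.
Proof.
move=> s0 st; apply: EFin_inj; rewrite -integral_sqrE; last exact: sqint_brownian_increment.
move: st; rewrite le_eqVlt => /orP[/eqP->|st].
  by rewrite subrr integral0_eq// => w _; rewrite subrr expr0n.
rewrite (brownian_increment_integral (f := fun x => (x ^+ 2)%:E))//.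
- under eq_integral do rewrite -EFinM.
  by rewrite normal_second_moment ?sqrtr_gt0 ?subr_gt0// sqr_sqrtr// subr_ge0 ltW.
- by move=> x; rewrite lee_fin sqr_ge0.
- by apply/measurable_EFinP; exact: measurable_funX.
Qed.

Let sqint1 : sqint P (fun=> 1).
Proof.
split; first exact: measurable_cst.
rewrite expr1n (_ : (fun=> 1%:E) = cst 1%E)// integral_cst// mul1e.
by rewrite -ge0_fin_numE// fin_num_measure.
Qed.

Lemma brownian_increment_mean s t : 0 <= s -> s <= t ->
  \int[P]_w (b t w - b s w) = 0.
Proof.
move=> s0; rewrite le_eqVlt => /orP[/eqP->|st].
  by rewrite /Rintegral integral0_eq// => w _; rewrite subrr.
have t0 := le_trans s0 (ltW st).
have st0 : 0 < Num.sqrt (t - s) by rewrite sqrtr_gt0 subr_gt0.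
rewrite /Rintegral integralE.
have h (f : R -> R) : (forall x, 0 <= f x) -> measurable_fun setT f ->
  (\int[P]_w (f (b t w - b s w))%:E = \int[lebesgue_measure]_x (f x * normal_pdf 0 (Num.sqrt (t - s)) x)%:E)%E.
  move=> f0 mf; apply: (brownian_increment_integral (f := EFin \o f)) => //.
  exact/measurable_EFinP.
have m1 : measurable_fun setT (fun x : R => Num.max x 0) by exact: measurable_maxr.
have m2 : measurable_fun setT (fun x : R => Num.max (- x) 0) by exact: measurable_maxr.
have -> : (\int[P]_w (fun w => (b t w - b s w)%:E)^\+ w = \int[P]_w (Num.max (b t w - b s w) 0)%:E)%E.
  by apply: eq_integral => w _; rewrite funeposE EFin_max.
have -> : (\int[P]_w (fun w => (b t w - b s w)%:E)^\- w = \int[P]_w (Num.max (- (b t w - b s w)) 0)%:E)%E.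
  by apply: eq_integral => w _; rewrite funenegE EFin_max.
rewrite (h (fun x => Num.max x 0))//; last by move=> x; rewrite le_max lexx orbT.
rewrite (h (fun x => Num.max (- x) 0))//; last by move=> x; rewrite le_max lexx orbT.
rewrite normal_mean//.
(* The two parts coincide; [fine] would return 0 even if they were infinite. *)
by case: (\int[_]_x _)%E => [r| |]//=; rewrite subrr.
Qed.

(* The joint law of an F_s-measurable X and of the increment is a product
   measure, so Fubini and the centering of the increment give the result. *)
Lemma brownian_increment_orth s t X : 0 <= s -> s <= t -> adapted s X ->
  sqint P X -> ip P X (fun w => b t w - b s w) = 0.
Proof.
move=> s0 + aX hX; rewrite le_eqVlt => /orP[/eqP->|st].
  by rewrite /ip /Rintegral integral0_eq// => w _; rewrite subrr mulr0.
have t0 := le_trans s0 (ltW st).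
pose Y w := b t w - b s w.
have hY : sqint P Y by apply: sqint_brownian_increment => //; exact: ltW.
have [mX _] := hX; have [mY _] := hY.
have mX' : @measurable_fun _ _ Omega (measurableTypeR R) setT X by [].
have mY' : @measurable_fun _ _ Omega (measurableTypeR R) setT Y by [].
pose X' : {mfun Omega >-> measurableTypeR R} :=
  @mfun_Sub _ _ Omega (measurableTypeR R) _ (mem_set mX').
pose Y' : {mfun Omega >-> measurableTypeR R} :=
  @mfun_Sub _ _ Omega (measurableTypeR R) _ (mem_set mY').
have mXY : @measurable_fun _ _ Omega (measurableTypeR R * measurableTypeR R)%type
    setT (fun w => (X w, Y w)) by exact: measurable_fun_pair.
pose XY : {mfun Omega >-> (measurableTypeR R * measurableTypeR R)%type} :=
  @mfun_Sub _ _ Omega (measurableTypeR R * measurableTypeR R)%type _ (mem_set mXY).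
pose PX := distribution P X'; pose PY := distribution P Y'; pose PXY := distribution P XY.
pose f (z : measurableTypeR R * measurableTypeR R) : \bar R := (z.1 * z.2 : R)%:E.
have mf : measurable_fun setT f.
  by apply/measurable_EFinP; apply: measurable_funM.
(* On rectangles this is [bind], and rectangles determine the product measure. *)
have prodE A : measurable A -> (PX \x PY)%E A = PXY A.
  apply: product_measure_unique => {}A B mA mB.
  rewrite /PX /PY /PXY /distribution /pushforward.
  transitivity (P ((X @^-1` A) `&` (Y @^-1` B))).
    by congr (P _); apply/seteqP; split.
  by apply: bind => //; exact: aX.
have If : P.-integrable setT (f \o XY) by exact: sqint_integrable_mul.
have IPXY : PXY.-integrable setT f by exact: integrable_pushforward.
have IP : (PX \x PY)%E.-integrable setT f.
  apply/integrableP; split => //; have /integrableP[_ h] := IPXY.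
  by rewrite (eq_measure_integral PXY)// => A mA _; exact: prodE.
rewrite /ip /Rintegral.
have -> : (\int[P]_w (X w * Y w)%:E = \int[PX \x PY]_z f z)%E.
  rewrite (eq_measure_integral PXY)//; last by move=> A mA _; exact: prodE.
  by rewrite integral_distribution.
rewrite -integral12_prod_meas1// integral0_eq// => x _.
rewrite /fubini_F /f /=.
under eq_integral do rewrite EFinM.
have IY : P.-integrable setT (EFin \o Y).
  have := sqint_integrable_mul sqint1 hY; apply: eq_integrable => // w _ /=.
  by rewrite mul1r.
have mE : measurable_fun setT (EFin : measurableTypeR R -> \bar R).
  by apply/measurable_EFinP.
have IPY : PY.-integrable setT (EFin : measurableTypeR R -> \bar R).
  exact: integrable_pushforward.
rewrite integralZl//.
rewrite integral_distribution//.
have := brownian_increment_mean s0 (ltW st).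
rewrite /Rintegral => h.
rewrite -[X in (_ * X)%E]fineK ?integrable_fin_num//.
by rewrite h mule0.
Qed.

Let b0_ae : {ae P, forall w, b 0 w = 0}. Proof. by case: bstd. Qed.

Lemma sqint_brownian t : 0 <= t -> sqint P (b t).
Proof.
move=> t0; have mb0 := measurable_brownian (lexx 0).
have hb0 : sqint P (b 0).
  split => //; apply: (@le_lt_trans _ _ (\int[P]_w (cst 0 w))%E).
    apply: ae_ge0_le_integral_lower => //.
      by move=> w; rewrite lee_fin sqr_ge0.
    by move: b0_ae; apply: filterS => w /= ->; rewrite expr0n.
  by rewrite integral0 ltry.
have := sqintD (sqint_brownian_increment (lexx 0) t0) hb0.
by congr sqint; apply/funext => w; rewrite subrK.
Qed.

(** For s <= t the increment b t - b s is orthogonal to b s, and b s agrees almost surely with its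
    increment from time 0. *)
Lemma brownian_cov s t : 0 <= s -> 0 <= t -> ip P (b s) (b t) = Num.min s t.
Proof.
wlog st : s t / s <= t => [hw s0 t0|].
  case: (leP s t) => st; first by rewrite hw// min_l.
  by rewrite ipC hw ?min_l// ltW.
move=> s0 t0; rewrite min_l//.
have hs := sqint_brownian s0; have ht := sqint_brownian t0.
have := brownian_increment_orth s0 st (adapted_brownian s0 (lexx s)) hs.
rewrite ipBr// => /subr0_eq ->.
apply: (etrans _ (etrans (brownian_increment_var (lexx 0) s0) (subr0 s))).
have [mb _] := hs; have [mb' _] := sqint_brownian_increment (lexx 0) s0.
have m1 : measurable_fun setT (fun w => (b s w * b s w)%:E).
  by apply/measurable_EFinP; exact: measurable_funM.
have m2 : measurable_fun setT (fun w => ((b s w - b 0 w) * (b s w - b 0 w))%:E).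
  by apply/measurable_EFinP; exact: measurable_funM.
have m12 : ae_eq P setT (fun w => (b s w * b s w)%:E)
    (fun w => ((b s w - b 0 w) * (b s w - b 0 w))%:E).
  by apply: (filterS _ b0_ae) => w /= b0 _; rewrite b0 !subr0.
rewrite /ip /Rintegral; congr fine.
exact: (ae_eq_integral _ _ _ m1 m2).
Qed.

Lemma sqint_wiener L : sqint P (wiener b L).
Proof.
apply: sqint_sum => p; apply: sqintZ; apply: sqint_brownian.
by rewrite le_max lexx.
Qed.

(** Both sides are bilinear, and the covariance min(s, t) is the length of the intersection of ]0,
    s] and ]0, t]. Using intervals that all start at 0 avoids common refinements of partitions. *)
Lemma wiener_isometry L L' :
  ip P (wiener b L) (wiener b L') = ip lebesgue_measure (step_of L) (step_of L').
Proof.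
have hb (p : R * R) : sqint P (b (Num.max 0 p.2)).
  by apply: sqint_brownian; rewrite le_max lexx.
have hi (p : R * R) := @sqint_indic_oc0 R p.2.
rewrite ip_suml; [|by move=> p; exact: sqintZ|exact: sqint_wiener].
rewrite ip_suml; [|by move=> p; exact: sqintZ|exact: sqint_step_of].
apply: eq_bigr => p _; rewrite !ipZl//; [|exact: sqint_step_of|exact: sqint_wiener].
congr (_ * _); rewrite !ip_sumr//; [|by move=> r; exact: sqintZ..].
apply: eq_bigr => r _; rewrite !ipZr//; congr (_ * _).
by rewrite brownian_cov ?le_max ?lexx// ip_indic_oc0.
Qed.

Lemma adapted_wiener t L : 0 <= t -> adapted t (wiener b (clip t L)).
Proof.
move=> t0; apply/adaptedP => //; rewrite /wiener.
under eq_fun do rewrite big_map.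
apply: measurable_sum => p /=; apply: measurable_funM => //.
apply/adaptedP => //; apply: adapted_brownian; rewrite ?le_max ?lexx//.
by rewrite ge_max t0 ge_min lexx.
Qed.

(** The martingale property in weak form, tested against a square-integrable F_s-measurable
    variable: term by term, the part of the integral after time s is an increment orthogonal to [X].
    Conditional expectations are avoided. *)
Lemma wiener_martingale s t X L : 0 <= s -> s <= t -> adapted s X -> sqint P X ->
  ip P X (wiener b (clip t L)) = ip P X (wiener b (clip s L)).
Proof.
move=> s0 st aX hX; have t0 := le_trans s0 st.
have hb (x : R) : sqint P (b (Num.max 0 x)).
  by apply: sqint_brownian; rewrite le_max lexx.
rewrite !ip_sumr//; [|by move=> r; exact: sqintZ..].
rewrite !big_map; apply: eq_bigr => p _ /=; rewrite !ipZr//; congr (_ * _).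
case: (leP p.2 s) => ps.
  by rewrite !min_r// (le_trans ps).
rewrite (max_r s0).
have sm : s <= Num.min t p.2 by rewrite le_min st ltW.
rewrite (max_r (le_trans s0 sm)).
have := brownian_increment_orth s0 sm aX hX.
by rewrite ipBr//; [move/subr0_eq|apply: sqint_brownian; exact: le_trans sm|exact: sqint_brownian].
Qed.

(** * Doob's inequality in L^2 for step integrals *)

Section doob.
Variables (t : nat -> R) (L : seq (R * R)).
Hypothesis t0 : forall i, 0 <= t i.
Hypothesis tnd : forall i, t i <= t i.+1.

Let S i := wiener b (clip (t i) L).
Let M i w := runmax (S^~ w) i.

Let adapted_M i : adapted (t i) (M i).
Proof.
elim: i => [|i ih].
  apply/adaptedP => //; apply: measurable_maxr => //.
  by apply/adaptedP => //; exact: adapted_wiener.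
apply/adaptedP => //; apply: measurable_maxr; apply/adaptedP => //.
  exact: adapted_le (ih).
exact: adapted_wiener.
Qed.

Let sqint_M i : sqint P (M i).
Proof.
elim: i => [|i ih]; apply: sqint_max => //; try exact: sqint_wiener.
exact: sqint0.
Qed.

(* Pathwise, M' ^ 2 - M ^ 2 <= 2 S' (M' - M), since M' = S' whenever M' > M;
   the martingale property makes the resulting sum telescope. *)
Lemma doob_runmax n : ip P (M n) (M n) <= 4 * ip P (S n) (S n).
Proof.
have hS i : sqint P (S i) by exact: sqint_wiener.
(* Given [h], expanding 0 <= E (2 S - M)^2 produces the factor 4. *)
suff h : ip P (M n) (M n) <= 2 * ip P (S n) (M n).
  have hB := sqintB (sqintZ 2 (hS n)) (sqint_M n).
  have := ip_ge0 P (fun w => 2 * S n w - M n w).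
  have h2 := sqintZ 2 (hS n).
  by rewrite ipBl// !ipBr// !ipZl// !ipZr// (ipC _ (M n)); lra.
elim: n => [|n ih].
  rewrite -ipZl//; apply: ip_le => //; first exact: sqintZ.
  move=> w; rewrite /M /=; case: (leP 0 (S 0%N w)) => h; last by rewrite !mulr0.
  by rewrite -mulrA ler_peMl ?mulr_ge0// ler1n.
have hD := sqintD (sqint_M n.+1) (sqint_M n).
have hB := sqintB (sqint_M n.+1) (sqint_M n).
have : ip P (fun w => M n.+1 w - M n w) (fun w => M n.+1 w + M n w) <=
       ip P (fun w => M n.+1 w - M n w) (fun w => 2 * S n.+1 w).
  apply: ip_le => //; first exact: sqintZ.
  move=> w; rewrite /M /=; case: (leP (runmax (S^~ w) n) (S n.+1 w)) => h.
    by rewrite ler_wpM2l ?subr_ge0//; lra.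
  by rewrite subrr !mul0r.
rewrite ipZr// !ipBl// !ipDr// (ipC _ (M n) (M n.+1)) (ipC _ (M n.+1) (S n.+1)).
have := wiener_martingale L (t0 n) (tnd n) (adapted_M n) (sqint_M n).
rewrite -/(S n.+1) -/(S n) (ipC _ (M n) (S n)) => ->.
by lra.
Qed.

End doob.

(** * Maximal inequality for Wiener integrals of bounded deterministic functions *)

Section maximal.
Variables (kappa : R -> R) (K T : R).
Hypothesis mkappa : measurable_fun setT kappa.
Hypothesis K0 : 0 <= K.
Hypothesis kappa_le : forall s, `|kappa s| <= K.
Hypothesis T0 : 0 <= T.

Notation leb := (@lebesgue_measure R).

(* X is the Wiener integral of kappa over ]0, t]. *)
Definition wiener_limit t (X : Omega -> R) : Prop :=
  measurable_fun setT X /\ forall e, 0 < e -> exists L,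
    ip leb (fun s => step_of L s - \1_(oc0 t) s * kappa s)
           (fun s => step_of L s - \1_(oc0 t) s * kappa s) <= e /\
    (\int[P]_w ((X w - wiener b L w) ^+ 2)%:E <= e%:E)%E.

Let sqint_kappa t : sqint leb (fun s => \1_(oc0 t) s * kappa s).
Proof.
have mt := measurable_oc0 t.
have := @sqint_le _ _ _ leb (fun s => \1_(oc0 t) s * kappa s) (fun s => K * \1_(oc0 t) s).
apply.
- by apply: measurable_funM => //; exact: measurable_indic.
- by apply: sqintZ; exact: sqint_indic_oc0.
- by move=> s; rewrite !normrM mulrC ler_wpM2r// (ger0_norm K0).
Qed.

Let ip_kappa t : 0 <= t ->
  ip leb (fun s => \1_(oc0 t) s * kappa s) (fun s => \1_(oc0 t) s * kappa s) <= K ^+ 2 * t.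
Proof.
move=> t0; have hi := @sqint_indic_oc0 R t; have hk := sqintZ K hi.
have -> : K ^+ 2 * t = ip leb (fun s => K * \1_(oc0 t) s) (fun s => K * \1_(oc0 t) s).
  by rewrite ipZl// ipZr// ip_indic_oc0 minxx (max_r t0) mulrA -expr2.
apply: ip_le => // s; rewrite -!expr2 -(real_normK (num_real (_ * kappa s))).
rewrite lerXn2r ?nnegrE ?mulr_ge0// normrM (ger0_norm (x := \1_(oc0 t) s))//.
by rewrite mulrC ler_wpM2r.
Qed.

Lemma wiener_limit_sqint t X : wiener_limit t X -> sqint P X.
Proof.
move=> [mX /(_ _ ltr01)[L [_ hL]]].
have h : sqint P (fun w => X w - wiener b L w).
  split; last by rewrite (le_lt_trans hL)// ltry.
  by apply: measurable_funB => //; case: (sqint_wiener L).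
have := sqintD h (sqint_wiener L).
by congr sqint; apply/funext => w; rewrite subrK.
Qed.

(** One list [L], accurate on ]0, t], serves all times s <= t through its clips. [X] is close to a
    list [L'] of its own, and by the isometry [L'] differs from the clip of [L] by the two
    approximation errors on ]0, s]. The constant is 2 + 2 (2 + 2) = 10. *)
Lemma wiener_limit_clip s t X L e : 0 < e -> 0 <= s -> s <= t -> wiener_limit s X ->
  ip leb (fun r => step_of L r - \1_(oc0 t) r * kappa r)
         (fun r => step_of L r - \1_(oc0 t) r * kappa r) <= e ->
  ip P (fun w => X w - wiener b (clip s L) w)
       (fun w => X w - wiener b (clip s L) w) <= 10 * e.
Proof.
move=> e0 s0 st hX hL; have hXs := wiener_limit_sqint hX.
have [mX /(_ _ e0)[L' [hL' hXL']]] := hX.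
have hW := sqint_wiener L'; have hC := sqint_wiener (clip s L).
have hk := sqint_kappa.
have hB : sqint P (fun w => X w - wiener b L' w) by exact: sqintB.
have -> : (fun w => X w - wiener b (clip s L) w) =
    (fun w => (X w - wiener b L' w) + (wiener b L' w - wiener b (clip s L) w)).
  by apply/funext => w; rewrite addrA subrK.
apply: le_trans (ip_sqrD hB (sqintB hW hC)) _.
have h1 : ip P (fun w => X w - wiener b L' w) (fun w => X w - wiener b L' w) <= e.
  by rewrite -lee_fin -integral_sqrE.
have -> : (fun w => wiener b L' w - wiener b (clip s L) w) =
    wiener b (L' ++ neg_list (clip s L)).
  by apply/funext => w; rewrite wiener_cat wiener_neg.
rewrite wiener_isometry.
have -> : step_of (L' ++ neg_list (clip s L)) =
   (fun r => (step_of L' r - \1_(oc0 s) r * kappa r) -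
             \1_(oc0 s) r * (step_of L r - \1_(oc0 t) r * kappa r)).
  apply/funext => r; rewrite step_of_cat step_of_neg step_of_clip mulrBr.
  rewrite [_ * (_ * kappa r)]mulrA indic_oc0M min_l//.
  by ring.
have hB1 : sqint leb (fun r => step_of L' r - \1_(oc0 s) r * kappa r).
  by apply: sqintB => //; exact: sqint_step_of.
have hB2 : sqint leb (fun r => step_of L r - \1_(oc0 t) r * kappa r).
  by apply: sqintB => //; exact: sqint_step_of.
have hB3 : sqint leb (fun r => \1_(oc0 s) r * (step_of L r - \1_(oc0 t) r * kappa r)).
  have h0 := @sqint_le _ _ _ leb
    (fun r => \1_(oc0 s) r * (step_of L r - \1_(oc0 t) r * kappa r)) _ _ hB2.
  apply: h0.
    apply: measurable_funM; last by case: hB2.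
    exact: measurable_indic (measurable_oc0 s).
  move=> r; rewrite normrM ler_piMl// indicE; case: (r \in oc0 s); by rewrite ?normr1 ?normr0.
have h2 := ip_sqrB hB1 hB3.
have h3 : ip leb (fun r => \1_(oc0 s) r * (step_of L r - \1_(oc0 t) r * kappa r))
  (fun r => \1_(oc0 s) r * (step_of L r - \1_(oc0 t) r * kappa r)) <= e.
  apply: le_trans hL; apply: ip_le => // r; rewrite -!expr2 exprMn.
  by rewrite ler_piMl ?sqr_ge0//; exact: indic_sqr_le1.
by lra.
Qed.

(** Doob's inequality is applied to the clips of one step list, and the X (t i) are small
    perturbations of them in mean square. The constant 32 collects X^2 <= 2 (X - S)^2 + 2 S^2, the
    maxima of S and of -S with a factor 4 each, and a factor 2 for replacing the step function by
    kappa. *)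
Lemma wiener_limit_finite (X : R -> Omega -> R) (t : nat -> R) N :
  (forall i, 0 <= t i) -> (forall i, t i <= t i.+1) -> (forall i, t i <= T) ->
  (forall i, wiener_limit (t i) (X (t i))) ->
  (exists Y, wiener_limit T Y) ->
  (\int[P]_w (runmax (fun i => X (t i) w ^+ 2) N)%:E <= (32 * K ^+ 2 * T)%:E)%E.
Proof.
move=> t0 tnd tT hX [Y hY].
apply/lee_addgt0Pr => e e0.
(* The errors add up to e: 20 e' from each of the N + 1 times and 32 e' from the approximation of
   kappa. *)
pose e' := e / (20 * N.+1%:R + 32).
have e'0 : 0 < e' by rewrite divr_gt0// addr_gt0// mulr_gt0.
have [_ /(_ _ e'0)[L [hL _]]] := hY.
pose S i := wiener b (clip (t i) L).
(* [S'] is -S: [runmax] is one-sided, and the two maxima together control |S|. *)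
pose S' i := wiener b (clip (t i) (neg_list L)).
pose M w := runmax (S^~ w) N; pose M' w := runmax (S'^~ w) N.
have hM : sqint P M.
  rewrite /M; elim: (N) => [|i ih]; apply: sqint_max => //; try exact: sqint_wiener.
  exact: sqint0.
have hM' : sqint P M'.
  rewrite /M'; elim: (N) => [|i ih]; apply: sqint_max => //; try exact: sqint_wiener.
  exact: sqint0.
have hXi i : sqint P (fun w => X (t i) w - S i w).
  by apply: sqintB; [exact: wiener_limit_sqint (hX i)|exact: sqint_wiener].
have IX i : ip P (fun w => X (t i) w - S i w) (fun w => X (t i) w - S i w) <= 10 * e'.
  exact: wiener_limit_clip (hX i) hL.
have hk := sqint_kappa.
have IS : ip P (S N) (S N) <= 2 * (K ^+ 2 * T) + 2 * e'.
  rewrite wiener_isometry.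
  have hB : sqint leb (fun r => step_of L r - \1_(oc0 T) r * kappa r).
    by apply: sqintB => //; exact: sqint_step_of.
  have : ip leb (step_of (clip (t N) L)) (step_of (clip (t N) L)) <=
         ip leb (step_of L) (step_of L).
    apply: ip_le; try exact: sqint_step_of.
    move=> r; rewrite step_of_clip -!expr2 exprMn ler_piMl ?sqr_ge0//.
  have := ip_sqrD hB (hk T); rewrite (_ : (fun r => _ + _) = step_of L); last first.
    by apply/funext => r; rewrite subrK.
  by have := ip_kappa T0; lra.
have IM : ip P M M <= 4 * ip P (S N) (S N) by exact: doob_runmax.
have IM' : ip P M' M' <= 4 * ip P (S N) (S N).
  have -> : ip P (S N) (S N) = ip P (S' N) (S' N).
    rewrite /S' clip_neg; rewrite /ip; apply: eq_Rintegral => w _.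
    by rewrite wiener_neg mulrNN.
  exact: doob_runmax.
pose G w := 2 * (M w ^+ 2) + 2 * (M' w ^+ 2) + \sum_(i < N.+1) 2 * (X (t i) w - S i w) ^+ 2.
apply: (@le_trans _ _ (\int[P]_w (G w)%:E)%E).
  apply: ge0_le_integral_lower => w _.
    by rewrite lee_fin runmax_ge0.
  rewrite lee_fin.
  have G0 : 0 <= G w.
    apply: addr_ge0; first by rewrite addr_ge0// mulr_ge0// sqr_ge0.
    by apply: sumr_ge0 => i _; rewrite mulr_ge0// sqr_ge0.
  apply: runmax_le => // i iN.
  have h1 : S i w <= M w by exact: (@runmax_ge _ (S^~ w) i N).
  have h2 : - S i w <= M' w.
    have := @runmax_ge _ (S'^~ w) i N iN.
    by rewrite /S' clip_neg wiener_neg.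
  have h3 : S i w ^+ 2 <= M w ^+ 2 + M' w ^+ 2.
    have m0 := runmax_ge0 (S^~ w) N; have m0' := runmax_ge0 (S'^~ w) N.
    rewrite -/(M w) in m0; rewrite -/(M' w) in m0'.
    case: (leP 0 (S i w)) => s0; [have : S i w ^+ 2 <= M w ^+ 2|have : S i w ^+ 2 <= M' w ^+ 2].
    - by rewrite lerXn2r ?nnegrE.
    - by have := sqr_ge0 (M' w); lra.
    - by rewrite -sqrrN lerXn2r ?nnegrE// oppr_ge0 ltW.
    - by have := sqr_ge0 (M w); lra.
  have h4 : 2 * (X (t i) w - S i w) ^+ 2 <= \sum_(j < N.+1) 2 * (X (t j) w - S j w) ^+ 2.
    rewrite (bigD1 (Ordinal (iN : (i < N.+1)%N)))//= lerDl sumr_ge0// => j _; by rewrite mulr_ge0// sqr_ge0.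
  rewrite /G; have := sqr_ge0 (X (t i) w - 2 * S i w); nra.
have m2 f : sqint P f -> measurable_fun setT (fun w => (2 * f w ^+ 2)%:E).
  by move=> [mf _]; apply/measurable_EFinP; apply: measurable_funM => //; exact: measurable_funX.
have p2 f w : (0 <= (2 * f w ^+ 2 : R)%:E)%E by rewrite lee_fin mulr_ge0// sqr_ge0.
have I2 f : sqint P f -> (\int[P]_w (2 * f w ^+ 2)%:E = (2 * ip P f f)%:E)%E.
  move=> hf; under eq_integral do rewrite EFinM.
  rewrite ge0_integralZl//= ?integral_sqrE//.
    by apply/measurable_EFinP; case: hf => mf _; exact: measurable_funX.
  by move=> w _; rewrite lee_fin sqr_ge0.
rewrite /G; under eq_integral do rewrite !EFinD -sumEFin.
rewrite ge0_integralD//=; last first.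
- apply: emeasurable_sum => i; exact: m2.
- by move=> w _; rewrite sume_ge0.
- by apply: emeasurable_funD; exact: m2.
- by move=> w _; rewrite adde_ge0.
rewrite ge0_integralD//=; [|exact: m2..].
rewrite ge0_integral_sum//=; last by move=> i; exact: m2.
rewrite !I2//.
have -> : (\sum_(i < N.+1) \int[P]_w (2 * (X (t i) w - S i w) ^+ 2)%:E =
  (\sum_(i < N.+1) 2 * ip P (fun w => X (t i) w - S i w) (fun w => X (t i) w - S i w))%:E)%E.
  by rewrite -sumEFin; apply: eq_bigr => i _; rewrite I2.
rewrite -!EFinD lee_fin.
have hs : \sum_(i < N.+1) 2 * ip P (fun w => X (t i) w - S i w) (fun w => X (t i) w - S i w) <=
  N.+1%:R * (20 * e').
  rewrite -[N.+1 in leRHS]card_ord mulr_natl -sumr_const.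
  by apply: ler_sum => i _; have := IX i; lra.
have -> : e = (20 * N.+1%:R + 32) * e'.
  by rewrite mulrC divfK// gt_eqF// addr_gt0// mulr_gt0.
by nra.
Qed.

(** Monotone convergence over the running maxima of the first N + 1 times, with a bound that does
    not depend on N. The enumeration [D] is in no particular order, so these times are sorted before
    the finite inequality is applied. *)
Lemma wiener_limit_sup (X : R -> Omega -> R) (D : nat -> R) :
  (forall i, 0 <= D i <= T) ->
  (forall i, wiener_limit (D i) (X (D i))) ->
  (exists Y, wiener_limit T Y) ->
  (\int[P]_w ereal_sup (range (fun i => (X (D i) w ^+ 2)%:E)) <= (32 * K ^+ 2 * T)%:E)%E.
Proof.
move=> D0T hX hT.
pose h N w := runmax (fun i => X (D i) w ^+ 2) N.
pose g N w := (h N w)%:E.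
have h0 N w : 0 <= h N w by exact: runmax_ge0.
have g0 N w : (0 <= g N w)%E by rewrite lee_fin.
have hS N w : h N.+1 w = Num.max (h N w) (X (D N.+1) w ^+ 2) by [].
have hE0 w : h 0%N w = X (D 0%N) w ^+ 2 by rewrite /h /= max_r// sqr_ge0.
have mg N : measurable_fun setT (g N).
  apply/measurable_EFinP; elim: N => [|N ih].
    have -> : h 0%N = (fun w => X (D 0%N) w ^+ 2) by apply/funext.
    by apply: measurable_funX; case: (hX 0%N).
  have -> : h N.+1 = (fun w => Num.max (h N w) (X (D N.+1) w ^+ 2)) by apply/funext.
  by apply: measurable_maxr => //; apply: measurable_funX; case: (hX N.+1).
have gnd w : {homo (fun N => g N w) : a c / (a <= c)%N >-> (a <= c)%E}.
  by apply/nondecreasing_seqP => N; rewrite /g lee_fin hS le_max lexx.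
have gsup w : ereal_sup (range (fun i => (X (D i) w ^+ 2)%:E)) = limn (fun N => g N w).
  apply/esym/cvg_lim => //.
  have := ereal_nondecreasing_cvgn (gnd w).
  suff -> : ereal_sup (range (fun N => g N w)) = ereal_sup (range (fun i => (X (D i) w ^+ 2)%:E)) by [].
  apply/eqP; rewrite eq_le; apply/andP; split.
    apply: ge_ereal_sup => _ [N _ <-]; rewrite /g /h.
    have s0 : (0 <= ereal_sup (range (fun i => (X (D i) w ^+ 2)%:E)))%E.
      apply: (@le_trans _ _ (X (D 0%N) w ^+ 2)%:E); first by rewrite lee_fin sqr_ge0.
      by apply: ereal_sup_ubound; exists 0%N.
    elim: N => [|N ih] /=; rewrite EFin_max ge_max.
      by rewrite s0/=; apply: ereal_sup_ubound; exists 0%N.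
    by rewrite ih/=; apply: ereal_sup_ubound; exists N.+1.
  apply: ge_ereal_sup => _ [i _ <-].
  apply: (@le_trans _ _ (g i w)); first by rewrite lee_fin; exact: (@runmax_ge _ (fun i => X (D i) w ^+ 2)).
  by apply: ereal_sup_ubound; exists i.
under eq_integral do rewrite gsup.
rewrite monotone_convergence//.
apply: lime_le; first by apply: ereal_nondecreasing_is_cvgn => a c ac; exact: ge0_le_integral_lower (fun w _ => gnd w _ _ ac).
near=> N; rewrite /g /h.
(* Beyond index N the sequence [t] repeats the largest time, which keeps it nondecreasing. *)
pose ts := sort <=%O [seq D i | i <- iota 0 N.+1].
have szt : size ts = N.+1 by rewrite size_sort size_map size_iota.
pose t i := nth 0 ts (minn i N).
have mN i : (minn i N < N.+1)%N by rewrite ltnS geq_minr.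
have tD i : exists j, t i = D j.
  have : t i \in ts by rewrite mem_nth// szt.
  by rewrite mem_sort => /mapP[j _ ->]; exists j.
have tb i : 0 <= t i <= T by have [j ->] := tD i.
have tnd i : t i <= t i.+1.
  have st : sorted <=%O ts by apply: sort_sorted; exact: le_total.
  apply: (sorted_leq_nth le_trans lexx) => //; rewrite ?inE ?szt//.
  by rewrite leq_min geq_minr andbT (leq_trans (geq_minl _ _)).
have [Y hY] := hT.
have := @wiener_limit_finite X t N.
move=> /(_ (fun i => proj1 (andP (tb i))) tnd (fun i => proj2 (andP (tb i)))) hN.
apply: le_trans (hN _ hT); last by move=> i; have [j ->] := tD i.
apply: ge0_le_integral_lower => w _; first exact: g0.
rewrite lee_fin; apply: runmax_le; first exact: runmax_ge0.
move=> i iN; have Di : D i \in ts by rewrite mem_sort map_f// mem_iota add0n.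
have jN : (index (D i) ts <= N)%N by rewrite -ltnS -szt index_mem.
have -> : D i = t (index (D i) ts) by rewrite /t (minn_idPl _) ?nth_index.
exact: (@runmax_ge _ (fun j => X (t j) w ^+ 2)).
Unshelve. all: by end_near. Qed.

End maximal.

End brownian.

(** * Weighted square-summable sequences indexed by the integers *)

Section esum_extra.
Context (R : realType).

Lemma esumZl (T : choiceType) (c : R) (a : T -> \bar R) : 0 <= c ->
  (forall i, (0 <= a i)%E) ->
  (\esum_(i in [set: T]) (c%:E * a i) = c%:E * \esum_(i in [set: T]) a i)%E.
Proof.
move=> c0 a0.
(* One inequality for every factor [k]; the converse is the same inequality applied to [c^-1]. *)
have le k (b : T -> \bar R) : 0 <= k -> (forall i, (0 <= b i)%E) ->
  (\esum_(i in [set: T]) (k%:E * b i) <= k%:E * \esum_(i in [set: T]) b i)%E.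
  move=> k0 b0; apply: ge_ereal_sup => _ [X [finX _] <-].
  rewrite -ge0_mule_fsumr//; apply: lee_wpmul2l; first by rewrite lee_fin.
  by apply: ereal_sup_ubound; exists X.
apply/eqP; rewrite eq_le le//=.
have [->|c_neq0] := eqVneq c 0.
  by rewrite mul0e esum_ge0// => i _; rewrite mul0e.
have {}c0 : 0 < c by rewrite lt_def c_neq0.
have -> : (\esum_(i in [set: T]) a i =
    \esum_(i in [set: T]) ((c^-1)%:E * (c%:E * a i)))%E.
  by apply: eq_esum => i _; rewrite muleA -EFinM mulVf// mul1e.
apply: (@le_trans _ _ (c%:E * ((c^-1)%:E * \esum_(i in [set: T]) (c%:E * a i)))%E).
  apply: lee_wpmul2l; first by rewrite lee_fin ltW.
  apply: le; first by rewrite invr_ge0 ltW.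
  by move=> i; apply: mule_ge0 => //; rewrite lee_fin ltW.
by rewrite muleA -EFinM mulfV// mul1e.
Qed.

Lemma esum_swap (T1 T2 : choiceType) (a : T1 -> T2 -> \bar R) :
  (forall i j, (0 <= a i j)%E) ->
  (\esum_(i in [set: T1]) \esum_(j in [set: T2]) a i j =
   \esum_(j in [set: T2]) \esum_(i in [set: T1]) a i j)%E.
Proof.
move=> a0; rewrite !esum_esum//.
rewrite (reindex_esum ([set: T2] `*`` (fun=> [set: T1])) _ (fun x => (x.2, x.1)))//.
split=> //=.
- by move=> [i1 i2] [j1 j2] /= _ _ [-> ->].
- by move=> [i j] _ /=; exists (j, i).
Qed.

Lemma esum_bij (T : choiceType) (e e' : T -> T) (a : T -> \bar R) :
  cancel e e' -> cancel e' e ->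
  (\esum_(i in [set: T]) a (e i) = \esum_(i in [set: T]) a i)%E.
Proof.
move=> ee' e'e; symmetry; apply: (reindex_esum [set: T] [set: T] e).
split=> //=; first by move=> i j _ _; exact: (can_inj ee').
by move=> j _; exists (e' j).
Qed.

Lemma esum_int (a : int -> \bar R) : (forall l, (0 <= a l)%E) ->
  (\esum_(l in [set: int]) a l = \esum_(n in [set: nat]) a (Posz n) +
   \esum_(n in [set: nat]) a (Negz n))%E.
Proof.
move=> a0; rewrite (esumID (range Posz))//= !setTI.
have -> : ~` range Posz = range Negz.
  apply/seteqP; split => [[n|n] /= h|_ [n _ <-] [m _]]//.
    by exfalso; apply: h; exists n.
  by exists n.
by congr (_ + _)%E; apply: esum_image => x y _ _ [].
Qed.

Lemma esum_int_ge (a : int -> \bar R) N : (forall l, (0 <= a l)%E) ->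
  (\sum_(n < N) (a (Posz n) + a (Negz n)) <= \esum_(l in [set: int]) a l)%E.
Proof.
move=> a0; rewrite esum_int// big_split/=; apply: leeD.
  rewrite -nneseries_esumT//; apply: le_trans (nneseries_lim_ge N _); last by [].
  by rewrite big_mkord.
rewrite -nneseries_esumT//; apply: le_trans (nneseries_lim_ge N _); last by [].
by rewrite big_mkord.
Qed.

(** The choice c = x / (2 a) is optimal. This recovers the Cauchy-Schwarz inequality from Young's
    inequality with a free parameter, which can be summed term by term in the extended reals. *)
Lemma le_discriminant (x a b : R) : 0 <= a -> 0 <= b ->
  (forall c, 0 < c -> x <= c * a + b / c) -> 0 <= x -> x ^+ 2 <= 4 * a * b.
Proof.
move=> a0 b0 h; rewrite le_eqVlt => /orP[/eqP<-|x0].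
  by rewrite expr0n/= !mulr_ge0.
move: a0; rewrite le_eqVlt => /orP[/eqP a0|a0].
  (* With a = 0 this c gives x <= x b / (b + 1), impossible for x > 0. *)
  have := h ((b + 1) / x); rewrite -a0 mulr0 add0r invf_div.
  have b1 : 0 < b + 1 by lra.
  move=> /(_ (divr_gt0 b1 x0)); rewrite mulrCA ler_pMr// ler_pdivlMr//; lra.
have := h (x / (2 * a)); rewrite invf_div => /(_ (divr_gt0 x0 (mulr_gt0 (ltr0Sn R 1) a0))).
move=> hx; have h1 : x - x / (2 * a) * a <= b * (2 * a / x) by lra.
have h2 : x - x / (2 * a) * a = x / 2 by field; rewrite gt_eqF.
rewrite h2 mulrA ler_pdivlMr// in h1.
by rewrite expr2; lra.
Qed.

End esum_extra.

Section weighted.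
Context (R : realType).
Variable sigma : nat.
Hypothesis sigma_gt0 : (0 < sigma)%N.
Implicit Types (f g phi A Y : int -> R) (l m : int).

Definition wt l : R := 1 + `|l%:~R| ^+ (2 * sigma).

Definition wnorm f : \bar R := (\esum_(l in [set: int]) (wt l * f l ^+ 2)%:E)%E.

Lemma wt_ge1 l : 1 <= wt l.
Proof. by rewrite /wt lerDl exprn_ge0. Qed.

Lemma wt_gt0 l : 0 < wt l.
Proof. exact: lt_le_trans (wt_ge1 l). Qed.

Lemma wnorm_ge0 f : (0 <= wnorm f)%E.
Proof. by apply: esum_ge0 => l _; rewrite lee_fin mulr_ge0 ?sqr_ge0// ltW// wt_gt0. Qed.

Let c4 : R := 4 ^+ sigma.

(** |l + m| <= 2 max(|l|, |m|), raised to the power 2 sigma; [c4] is 2 ^ (2 sigma). *)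
Lemma wt_add l m : wt (l + m) <= c4 * (wt l + wt m).
Proof.
have c41 : 1 <= c4 by rewrite exprn_ege1// ler1n.
set a : R := `|l%:~R|; set b : R := `|m%:~R|.
have a0 : 0 <= a by exact: normr_ge0. have b0 : 0 <= b by exact: normr_ge0.
have h : `|(l + m)%:~R : R| ^+ (2 * sigma) <= c4 * (a ^+ (2 * sigma) + b ^+ (2 * sigma)).
  have hab : `|(l + m)%:~R : R| <= 2 * Num.max a b.
    rewrite intrD; apply: le_trans (ler_normD _ _) _.
    by rewrite mulr_natl mulr2n lerD// ?le_max ?lexx ?orbT.
  apply: (@le_trans _ _ ((2 * Num.max a b) ^+ (2 * sigma))).
    by rewrite lerXn2r// nnegrE// mulr_ge0// le_max a0.
  rewrite exprMn exprM -natrX ler_wpM2l ?exprn_ge0//.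
  by case: (leP a b) => _; rewrite ?lerDl ?lerDr exprn_ge0.
rewrite /wt -/a -/b; apply: (@le_trans _ _ (c4 + c4 * (a ^+ (2 * sigma) + b ^+ (2 * sigma)))).
  by rewrite lerD.
have c40 : 0 <= c4 by exact: le_trans ler01 c41.
by rewrite !mulrDr; lra.
Qed.

(** Here sigma >= 1 enters, through wt l >= 1 + l^2. The inverse weights are dominated by the
    telescoping terms 4 (1 / (n + 1) - 1 / (n + 2)), whose sum is at most 4 on each half of the
    integers. *)
Lemma esum_inv_wt : (\esum_(l in [set: int]) ((wt l)^-1)%:E <= 8%:E)%E.
Proof.
have h0 l : (0 <= ((wt l)^-1)%:E)%E by rewrite lee_fin invr_ge0 ltW// wt_gt0.
have hsq (l : int) (n : nat) : (n <= `|l|)%N -> (wt l)^-1 <= 4 * (n.+1%:R^-1 - n.+2%:R^-1).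
  move=> nl; have n0 : (0 : R) <= n%:R by [].
  have h1 : 1 + (n%:R : R) ^+ 2 <= wt l.
    rewrite /wt lerD2l -intr_norm.
    case: n nl n0 => [|n] nl n0; first by rewrite expr0n exprn_ge0.
    apply: (@le_trans _ _ (n.+1%:R ^+ (2 * sigma))).
      by apply: ler_weXn2l; rewrite ?ler1n// leq_pmulr.
    by rewrite lerXn2r ?nnegrE// -[leRHS]/(((`|l|%N)%:R : R)) ler_nat.
  apply: (@le_trans _ _ (1 + (n%:R : R) ^+ 2)^-1).
    by rewrite lef_pV2 ?posrE ?wt_gt0// ltr_wpDr// sqr_ge0.
  rewrite -(natr1 n) -(natr1 n.+1) -(natr1 n).
  set x : R := n%:R; have x0 : 0 <= x by [].
  have -> : 4 * ((x + 1)^-1 - (x + 1 + 1)^-1) = 4 / ((x + 1) * (x + 1 + 1)).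
    by field; apply/andP; split; rewrite gt_eqF//; lra.
  rewrite -[leLHS]mul1r ler_pdivrMr; last by nra.
  by rewrite mulrAC ler_pdivlMr; nra.
have half (e : nat -> int) : (forall n, (n <= `|e n|)%N) ->
    (\esum_(n in [set: nat]) ((wt (e n))^-1)%:E <= 4%:E)%E.
  move=> he; rewrite -nneseries_esumT//; apply: lime_le; first exact: is_cvg_nneseries.
  near=> N; rewrite sumEFin lee_fin.
  apply: (@le_trans _ _ (\sum_(0 <= i < N) (- 4 * i.+2%:R^-1 - (- 4 * i.+1%:R^-1)))).
    apply: ler_sum => i _; apply: le_trans (hsq _ _ (he i)) _.
    by rewrite le_eqVlt; apply/orP; left; apply/eqP; ring.
  rewrite (telescope_sumr (fun i => - 4 * i.+1%:R^-1))// (_ : 1%:R^-1 = 1 :> R) ?invr1//.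
  have : 0 <= (N.+1%:R : R)^-1 by [].
  by move: (N.+1%:R^-1) => x x0; lra.
rewrite esum_int//.
have -> : 8%:E = (4%:E + 4%:E)%E :> \bar R by rewrite -EFinD; congr EFin; lra.
by apply: leeD; exact: half.
Unshelve. all: by end_near. Qed.

Definition conv phi A l : \bar R :=
  (\esum_(m in [set: int]) (phi (l - m) * A m)%:E)%E.

Lemma conv_ge0 phi A l : (forall m, 0 <= phi m) -> (forall m, 0 <= A m) ->
  (0 <= conv phi A l)%E.
Proof. by move=> p0 A0; apply: esum_ge0 => m _; rewrite lee_fin mulr_ge0. Qed.

(** Termwise |x| <= w x^2 + 1 / w, then [esum_inv_wt]. This is the embedding of the weighted space
    into l^1, in a non-homogeneous form. *)
Lemma wnorm_l1 phi :
  (\esum_(l in [set: int]) `|phi l|%:E <= wnorm phi + 8%:E)%E.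
Proof.
have h0 l : (0 <= ((wt l)^-1)%:E)%E by rewrite lee_fin invr_ge0 ltW// wt_gt0.
have h1 l : (0 <= (wt l * phi l ^+ 2)%:E)%E.
  by rewrite lee_fin mulr_ge0 ?sqr_ge0// ltW// wt_gt0.
apply: (@le_trans _ _ (\esum_(l in [set: int])
  ((wt l * phi l ^+ 2)%:E + ((wt l)^-1)%:E))%E).
  apply: le_esum => l _; rewrite -EFinD lee_fin -(real_normK (num_real (phi l))).
  set x := `|phi l|; have w0 := wt_gt0 l.
  rewrite -subr_ge0 -(pmulr_rge0 _ w0).
  have -> : wt l * (wt l * x ^+ 2 + (wt l)^-1 - x) = (wt l * x) ^+ 2 + 1 - wt l * x.
    by field; rewrite gt_eqF.
  by nra.
by rewrite esumD//; apply: leeD => //; exact: esum_inv_wt.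
Qed.

Lemma sub_shiftK (m : int) : cancel (fun l => l - m) (fun l => l + m).
Proof. by move=> l; rewrite subrK. Qed.

Lemma add_shiftK (m : int) : cancel (fun l => l + m) (fun l => l - m).
Proof. by move=> l; rewrite addrK. Qed.

Lemma sub_revK (l : int) : cancel (fun m => l - m) (fun m => l - m).
Proof. by move=> m; rewrite opprB addrC subrK. Qed.

(* Cauchy-Schwarz against the kernel w_l / (w_(l-m) w_m), whose sum over m is
   bounded uniformly in l. *)
Lemma conv_wnorm phi A : (forall m, 0 <= phi m) -> (forall m, 0 <= A m) ->
  (wnorm phi < +oo)%E -> (wnorm A < +oo)%E ->
  (forall l, (conv phi A l < +oo)%E) /\
  (wnorm (fun l => fine (conv phi A l)) <= (64 * c4)%:E * (wnorm phi * wnorm A))%E.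
Proof.
move=> p0 A0 hp hA.
have c40 : 0 <= c4 by rewrite exprn_ge0.
have w0 l : 0 <= wt l by rewrite ltW// wt_gt0.
pose Q l := (\esum_(m in [set: int])
  ((wt (l - m) * phi (l - m) ^+ 2) * (wt m * A m ^+ 2))%:E)%E.
have q0 l m : (0 <= ((wt (l - m) * phi (l - m) ^+ 2) * (wt m * A m ^+ 2))%:E)%E.
  by rewrite lee_fin !mulr_ge0// sqr_ge0.
have Q0 l : (0 <= Q l)%E by exact: esum_ge0.
have QE : (\esum_(l in [set: int]) Q l = wnorm phi * wnorm A)%E.
  rewrite /Q esum_swap//.
  have -> : wnorm phi = (fine (wnorm phi))%:E by rewrite fineK// ge0_fin_numE// wnorm_ge0.
  rewrite /wnorm -esumZl; last 2 first.
  - by rewrite fine_ge0// wnorm_ge0.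
  - by move=> m; rewrite lee_fin mulr_ge0// sqr_ge0.
  apply: eq_esum => m _; under eq_esum do rewrite mulrC EFinM.
  rewrite esumZl ?mulr_ge0 ?sqr_ge0//; last by move=> l; rewrite lee_fin mulr_ge0// sqr_ge0.
  rewrite muleC; congr (_ * _)%E.
  rewrite (esum_bij (fun l => (wt l * phi l ^+ 2)%:E) (sub_shiftK m) (add_shiftK m)).
  by rewrite fineK// ge0_fin_numE// wnorm_ge0.
have QA : (wnorm phi * wnorm A < +oo)%E by rewrite lte_mul_pinfty// ?wnorm_ge0// ge0_fin_numE ?wnorm_ge0.
have Qfin l : Q l \is a fin_num.
  rewrite ge0_fin_numE//; apply: le_lt_trans QA; rewrite -QE.
  apply: esum_ge; exists [set l]; first by split.
  by rewrite fsbig_set1.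
have i0 l : (0 <= ((wt l)^-1)%:E)%E by rewrite lee_fin invr_ge0.
(* By [wt_add] the kernel 1 / (w_(l-m) w_m) is at most (c4 / w_l) (1 / w_m + 1 / w_(l-m)), and each
   inverse weight sums to at most 8. *)
have hk l : (\esum_(m in [set: int]) ((wt (l - m))^-1 * (wt m)^-1)%:E <= (16 * c4 / wt l)%:E)%E.
  apply: (@le_trans _ _ (\esum_(m in [set: int])
     ((c4 / wt l)%:E * (((wt m)^-1)%:E + ((wt (l - m))^-1)%:E))%E)%E).
    apply: le_esum => m _; rewrite -EFinD -EFinM lee_fin.
    have := wt_add (l - m) m; rewrite subrK => h.
    have [wl wm wlm] := And3 (wt_gt0 l) (wt_gt0 m) (wt_gt0 (l - m)).
    rewrite -subr_ge0 -(pmulr_rge0 _ (mulr_gt0 wl (mulr_gt0 wm wlm))).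
    have -> : wt l * (wt m * wt (l - m)) * (c4 / wt l * ((wt m)^-1 + (wt (l - m))^-1) - (wt (l - m))^-1 / wt m)
      = c4 * (wt (l - m) + wt m) - wt l by field; rewrite !gt_eqF.
    by rewrite subr_ge0.
  rewrite esumZl ?divr_ge0//; last by move=> m; rewrite adde_ge0.
  have -> : (16 * c4 / wt l)%:E = ((c4 / wt l)%:E * 16%:E)%E :> \bar R.
    by rewrite -EFinM; congr EFin; ring.
  apply: lee_wpmul2l; first by rewrite lee_fin divr_ge0.
  rewrite esumD// (esum_bij (fun m => ((wt m)^-1)%:E) (sub_revK l) (sub_revK l)).
  have -> : 16%:E = (8%:E + 8%:E)%E :> \bar R by rewrite -EFinD; congr EFin; lra.
  by apply: leeD; exact: esum_inv_wt.
(* Young's inequality with a free parameter c; [le_discriminant] turns it into conv^2 <= 4 Q (16 c4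
   / w_l), whence the constant 64 c4. *)
have young l c : 0 < c -> (conv phi A l <= (c * fine (Q l) + (16 * c4 / wt l) / c)%:E)%E.
  move=> c0; apply: (@le_trans _ _ (\esum_(m in [set: int])
    (c%:E * ((wt (l - m) * phi (l - m) ^+ 2) * (wt m * A m ^+ 2))%:E +
     (c^-1)%:E * ((wt (l - m))^-1 * (wt m)^-1)%:E))%E).
    apply: le_esum => m _; rewrite -!EFinM -EFinD lee_fin.
    have [wm wlm] := conj (wt_gt0 m) (wt_gt0 (l - m)).
    set a := wt (l - m) in wlm *; set e := wt m in wm *.
    set x := phi (l - m); set y := A m.
    have z0 : 0 < c * a * e by rewrite !mulr_gt0.
    rewrite -subr_ge0 -(pmulr_rge0 _ z0).
    have -> : c * a * e * (c * (a * x ^+ 2 * (e * y ^+ 2)) + c^-1 * (a^-1 / e) - x * y) =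
       (c * a * e * x * y) ^+ 2 + 1 - c * a * e * x * y by field; rewrite !gt_eqF.
    by set z := c * a * e * x * y; nra.
  have k0 m : (0 <= ((wt (l - m))^-1 * (wt m)^-1)%:E)%E.
    by rewrite lee_fin mulr_ge0// invr_ge0.
  rewrite esumD; last 2 first.
  - by move=> m _; rewrite mule_ge0// lee_fin ltW.
  - by move=> m _; rewrite mule_ge0// lee_fin invr_ge0 ltW.
  rewrite !esumZl ?invr_ge0 ?(ltW c0)// EFinD EFinM fineK//.
  apply: leeD => //; rewrite (mulrC _ c^-1) EFinM.
  by apply: lee_wpmul2l => //; rewrite lee_fin invr_ge0 ltW.
have cfin l : (conv phi A l < +oo)%E by apply: le_lt_trans (young l 1 ltr01) _; rewrite ltry.
split => //; rewrite -QE -esumZl ?mulr_ge0//.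
apply: le_esum => l _; rewrite -[X in (_ * X)%E]fineK// -EFinM lee_fin.
have cf : conv phi A l \is a fin_num by rewrite ge0_fin_numE// conv_ge0.
have := @le_discriminant _ (fine (conv phi A l)) (fine (Q l)) (16 * c4 / wt l).
have h0 : 0 <= fine (conv phi A l) by rewrite fine_ge0// conv_ge0.
have h1 : 0 <= fine (Q l) by rewrite fine_ge0.
have h2 : 0 <= 16 * c4 / wt l by rewrite divr_ge0// mulr_ge0.
move=> /(_ h1 h2) h; have {}h := h _ h0.
apply: (@le_trans _ _ (wt l * (4 * fine (Q l) * (16 * c4 / wt l)))).
  rewrite ler_wpM2l//; apply: h => c c0.
  by rewrite -lee_fin fineK//; exact: young.
rewrite le_eqVlt; apply/orP; left; apply/eqP; field.
by rewrite gt_eqF// wt_gt0.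
Qed.

Lemma wnormD f g : (wnorm (fun l => f l + g l)%R <=
  2%:E * wnorm f + 2%:E * wnorm g)%E.
Proof.
have h k l : (0 <= (wt l * k l ^+ 2 : R)%:E)%E.
  by rewrite lee_fin mulr_ge0 ?sqr_ge0// ltW// wt_gt0.
rewrite /wnorm -!esumZl// -esumD; last 2 first.
- by move=> l _; rewrite mule_ge0.
- by move=> l _; rewrite mule_ge0.
apply: le_esum => l _; rewrite -!EFinM -EFinD lee_fin.
have -> : 2 * (wt l * f l ^+ 2) + 2 * (wt l * g l ^+ 2) =
  wt l * (2 * f l ^+ 2 + 2 * g l ^+ 2) by ring.
by rewrite ler_wpM2l ?(ltW (wt_gt0 _))//; have := sqr_ge0 (f l - g l); nra.
Qed.

Lemma wnormZ c f : wnorm (fun l => c * f l)%R = ((c ^+ 2)%:E * wnorm f)%E.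
Proof.
rewrite /wnorm -esumZl ?sqr_ge0//; last first.
  by move=> l; rewrite lee_fin mulr_ge0 ?sqr_ge0// ltW// wt_gt0.
by apply: eq_esum => l _; rewrite -EFinM exprMn mulrCA.
Qed.

(** * Picard iteration in the weighted space *)

Section picard.
Variables (phi Y : int -> R) (lam : R).
Hypothesis phi0 : forall l, 0 <= phi l.
Hypothesis Y0 : forall l, 0 <= Y l.
Hypothesis hphi : (wnorm phi < +oo)%E.
Hypothesis hY : (wnorm Y < +oo)%E.
Hypothesis lam_gt0 : 0 < lam.
Hypothesis lam_phi : 256 * c4 * fine (wnorm phi) <= lam ^+ 2.
Hypothesis lam_l1 : 2 * (fine (wnorm phi) + 8) <= lam.

Fixpoint picard n : int -> R :=
  if n is n'.+1 then fun l => Y l + lam^-1 * fine (conv phi (picard n') l)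
  else fun=> 0.

Lemma picard_ge0 n l : 0 <= picard n l.
Proof.
elim: n l => [//|n ih] l /=; rewrite addr_ge0// mulr_ge0 ?invr_ge0 ?(ltW lam_gt0)//.
by rewrite fine_ge0// conv_ge0.
Qed.

(** By [conv_wnorm] and [lam_phi], where 256 = 4 * 64, convolution with phi divided by lam reduces
    the squared norm by a factor 4. The induction closes because 2 y + 2 (4 y) / 4 = 4 y. *)
Lemma picard_wnorm n : (wnorm (picard n) <= 4%:E * wnorm Y)%E.
Proof.
have Yf : wnorm Y \is a fin_num by rewrite ge0_fin_numE// wnorm_ge0.
have pf : wnorm phi \is a fin_num by rewrite ge0_fin_numE// wnorm_ge0.
elim: n => [|n ih].
  rewrite /wnorm esum1 ?mule_ge0 ?wnorm_ge0// => l _.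
  by rewrite /= expr0n mulr0.
have fin : (wnorm (picard n) < +oo)%E.
  by apply: le_lt_trans ih _; rewrite -(fineK Yf) -EFinM ltry.
have [_ h] := conv_wnorm phi0 (picard_ge0 n) hphi fin.
apply: le_trans (wnormD _ _) _; rewrite wnormZ.
have nf : wnorm (picard n) \is a fin_num by rewrite ge0_fin_numE// wnorm_ge0.
move: ih h; rewrite -(fineK Yf) -(fineK pf) -(fineK nf) -!EFinM lee_fin => ih h.
have cf : wnorm (fun l => fine (conv phi (picard n) l)) \is a fin_num.
  by rewrite ge0_fin_numE ?wnorm_ge0// (le_lt_trans h) ?ltry.
move: h; rewrite -(fineK cf) -!EFinM -EFinD !lee_fin => h.
set N := fine _ in h *; set M := fine (wnorm (picard n)) in ih h *.
have M0 : 0 <= M by rewrite fine_ge0// wnorm_ge0.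
have lp := lam_phi.
set y := fine (wnorm Y) in ih *; set p := fine (wnorm phi) in h lp *.
have l2 : 0 < lam ^+ 2 by rewrite exprn_gt0.
have : (lam^-1) ^+ 2 * N <= M / 4.
  rewrite exprVn mulrC ler_pdivrMr//; apply: le_trans h _.
  by have := ler_wpM2r M0 lp; lra.
by lra.
Qed.

(** A nonzero constant sequence has infinite weighted norm, so its convolution is estimated through
    the l^1 norm of phi. This carries a uniform bound on the coefficients through one Picard
    step. *)
Lemma conv_add_cst A K l : (forall m, 0 <= A m) -> 0 <= K ->
  (wnorm A < +oo)%E ->
  (conv phi (fun m => A m + K)%R l <=
    (fine (conv phi A l) + K * (fine (wnorm phi) + 8))%:E)%E.
Proof.
move=> A0 K0 hA.
have pf : wnorm phi \is a fin_num by rewrite ge0_fin_numE// wnorm_ge0.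
have [hc _] := conv_wnorm phi0 A0 hphi hA.
rewrite EFinD fineK ?ge0_fin_numE ?conv_ge0//.
rewrite /conv; under eq_esum do rewrite mulrDr EFinD.
rewrite esumD; last 2 first.
- by move=> m _; rewrite lee_fin mulr_ge0.
- by move=> m _; rewrite lee_fin mulr_ge0.
apply: leeD => //; under eq_esum do rewrite mulrC EFinM.
rewrite esumZl//; last by move=> m; rewrite lee_fin.
rewrite EFinM; apply: lee_wpmul2l; first by rewrite lee_fin.
rewrite (esum_bij (fun m => (phi m)%:E) (sub_revK l) (sub_revK l)).
rewrite EFinD fineK//; apply: le_trans (wnorm_l1 phi).
by apply: le_esum => m _; rewrite ger0_norm.
Qed.

(** The constant error 2^-n K is not in the weighted space, but on a finite set of frequencies it
    becomes negligible as n grows, while the iterates obey a bound uniform in n. The passage from 4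
    to 8 is the factor 2 in (a + r)^2 <= 2 a^2 + 2 r^2. *)
Lemma picard_limit (g : int -> R) K : (forall l, 0 <= g l) -> 0 <= K ->
  (forall n l, g l <= picard n l + 2^-1 ^+ n * K) ->
  (wnorm g <= 8%:E * wnorm Y)%E.
Proof.
move=> g0 K0 h.
have Yf : wnorm Y \is a fin_num by rewrite ge0_fin_numE// wnorm_ge0.
apply: ge_ereal_sup => _ [X [finX _] <-].
pose W := \sum_(l <- finmap.enum_fset (fset_set X)) wt l.
have W0 : 0 <= W by apply: sumr_ge0 => l _; rewrite ltW// wt_gt0.
apply/lee_addgt0Pr => e e0.
have [n hn] : exists n, 2 * W * (2^-1 ^+ n * K) ^+ 2 <= e.
  have : (fun n => 2 * W * (2^-1 ^+ n * K) ^+ 2) @ \oo --> 2 * W * (0 * K) ^+ 2.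
    apply: cvgM; first exact: cvg_cst.
    have hc : (fun n => 2^-1 ^+ n * K : R) @ \oo --> 0 * K.
      apply: cvgM; last exact: cvg_cst.
      apply: cvg_expr; rewrite ger0_norm ?invr_ge0// invf_lt1//; lra.
    by rewrite expr2; under eq_fun do rewrite expr2; exact: cvgM.
  rewrite mul0r expr0n mulr0 => /cvgrPdist_le/(_ _ e0)[n _ /(_ n (leqnn n))].
  by rewrite /= sub0r normrN => h'; exists n; rewrite (le_trans (ler_norm _)).
rewrite fsbig_finite//= sumEFin.
apply: (@le_trans _ _ (2%:E * wnorm (picard n) + (2 * W * (2^-1 ^+ n * K) ^+ 2)%:E)%E); last first.
  apply: leeD; last by rewrite lee_fin.
  have -> : 8%:E = (2%:E * 4%:E)%E :> \bar R by rewrite -EFinM; congr EFin; lra.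
  by rewrite -muleA; apply: lee_wpmul2l => //; exact: picard_wnorm.
apply: (@le_trans _ _ (\sum_(l <- finmap.enum_fset (fset_set X)) (2 * (wt l * picard n l ^+ 2) + 2 * wt l * (2^-1 ^+ n * K) ^+ 2))%:E).
  rewrite lee_fin; apply: ler_sum => l _.
  have wl := wt_gt0 l; have := h n l; set a := picard n l; set r := 2^-1 ^+ n * K => hl.
  have hl2 : g l ^+ 2 <= (a + r) ^+ 2.
    by rewrite lerXn2r ?nnegrE// addr_ge0 ?picard_ge0// mulr_ge0// exprn_ge0.
  have -> : 2 * (wt l * a ^+ 2) + 2 * wt l * r ^+ 2 = wt l * (2 * a ^+ 2 + 2 * r ^+ 2) by ring.
  rewrite ler_wpM2l ?(ltW wl)//; apply: le_trans hl2 _.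
  by have := sqr_ge0 (a - r); nra.
rewrite big_split/= EFinD; apply: leeD; last first.
  by rewrite lee_fin -mulr_suml -mulr_sumr.
rewrite -mulr_sumr EFinM; apply: lee_wpmul2l => //.
apply: esum_ge; exists X => //.
by rewrite fsbig_finite//= sumEFin.
Qed.

End picard.

End weighted.

(** * Fourier coefficients *)

Section complex_modulus.
Variable R : realType.
Notation C := (complex R).
Implicit Types (z w : C).

Lemma ReM z w : complex.Re (z * w) =
  complex.Re z * complex.Re w - complex.Im z * complex.Im w.
Proof. by case: z; case: w. Qed.

Lemma ImM z w : complex.Im (z * w) =
  complex.Re z * complex.Im w + complex.Im z * complex.Re w.
Proof. by case: z; case: w. Qed.

Lemma ReD z w : complex.Re (z + w) = complex.Re z + complex.Re w.
Proof. by case: z; case: w. Qed.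

Lemma ImD z w : complex.Im (z + w) = complex.Im z + complex.Im w.
Proof. by case: z; case: w. Qed.

Lemma ReN z : complex.Re (- z) = - complex.Re z.
Proof. by case: z. Qed.

Lemma ImN z : complex.Im (- z) = - complex.Im z.
Proof. by case: z. Qed.

Lemma Re_sum (I : Type) (s : seq I) (F : I -> C) :
  complex.Re (\sum_(i <- s) F i) = \sum_(i <- s) complex.Re (F i).
Proof. by elim/big_ind2: _ => // z a w b <- <-; rewrite ReD. Qed.

Lemma Im_sum (I : Type) (s : seq I) (F : I -> C) :
  complex.Im (\sum_(i <- s) F i) = \sum_(i <- s) complex.Im (F i).
Proof. by elim/big_ind2: _ => // z a w b <- <-; rewrite ImD. Qed.

Lemma complex_ext z w : complex.Re z = complex.Re w ->
  complex.Im z = complex.Im w -> z = w.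
Proof. by case: z; case: w => a b c d /= -> ->. Qed.

Lemma sqabs_ge0 z : 0 <= sqabs z.
Proof. by rewrite addr_ge0 ?sqr_ge0. Qed.

Lemma sqabsM z w : sqabs (z * w) = sqabs z * sqabs w.
Proof. by rewrite /sqabs ReM ImM; ring. Qed.

Lemma sqabs_realC (r : R) : sqabs (realC r) = r ^+ 2.
Proof. by rewrite /sqabs /= expr0n addr0. Qed.

Lemma sqabs_expi (t : R) : sqabs (expi t) = 1.
Proof. by rewrite /sqabs /= cos2Dsin2. Qed.

Lemma sqabsD_le z w : sqabs (z + w) <= 2 * sqabs z + 2 * sqabs w.
Proof.
rewrite /sqabs ReD ImD; have := sqr_ge0 (complex.Re z - complex.Re w).
by have := sqr_ge0 (complex.Im z - complex.Im w); nra.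
Qed.

Lemma sqabsN z : sqabs (- z) = sqabs z.
Proof. by rewrite /sqabs ReN ImN !sqrrN. Qed.

Definition cabs z : R := Num.sqrt (sqabs z).

Lemma cabs_ge0 z : 0 <= cabs z. Proof. exact: sqrtr_ge0. Qed.

Lemma sqr_cabs z : cabs z ^+ 2 = sqabs z.
Proof. by rewrite sqr_sqrtr// sqabs_ge0. Qed.

Lemma cabsM z w : cabs (z * w) = cabs z * cabs w.
Proof. by rewrite /cabs sqabsM sqrtrM// sqabs_ge0. Qed.

Lemma cabs_expi (t : R) : cabs (expi t) = 1.
Proof. by rewrite /cabs sqabs_expi sqrtr1. Qed.

Lemma cabs_realC (r : R) : cabs (realC r) = `|r|.
Proof. by rewrite /cabs sqabs_realC sqrtr_sqr. Qed.

Lemma cabsN z : cabs (- z) = cabs z.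
Proof. by rewrite /cabs sqabsN. Qed.

Lemma cabs0 : cabs (0 : C) = 0.
Proof. by rewrite /cabs /sqabs /= !expr0n addr0 sqrtr0. Qed.

Lemma cabs_le z (r : R) : 0 <= r -> (cabs z <= r) = (sqabs z <= r ^+ 2).
Proof. by move=> r0; rewrite -sqr_cabs ler_pXn2r// nnegrE ?cabs_ge0. Qed.

Lemma cabsD z w : cabs (z + w) <= cabs z + cabs w.
Proof.
rewrite cabs_le ?addr_ge0 ?cabs_ge0// sqrrD !sqr_cabs.
suff h : complex.Re z * complex.Re w + complex.Im z * complex.Im w <= cabs z * cabs w.
  by rewrite /sqabs ReD ImD; lra.
rewrite -cabsM; apply: le_trans (ler_norm _) _.
rewrite -sqrtr_sqr ler_wsqrtr// sqabsM /sqabs.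
have := sqr_ge0 (complex.Re z * complex.Im w - complex.Im z * complex.Re w); nra.
Qed.

Lemma cabs_sum (I : Type) (s : seq I) (F : I -> C) :
  cabs (\sum_(i <- s) F i) <= \sum_(i <- s) cabs (F i).
Proof.
elim/big_ind2: _ => [|z a w b za wb|//]; first by rewrite cabs0.
by apply: le_trans (cabsD _ _) _; exact: lerD.
Qed.

Lemma Re_le_cabs z : `|complex.Re z| <= cabs z.
Proof. by rewrite -sqrtr_sqr ler_wsqrtr// lerDl sqr_ge0. Qed.

Lemma Im_le_cabs z : `|complex.Im z| <= cabs z.
Proof. by rewrite -sqrtr_sqr ler_wsqrtr// lerDr sqr_ge0. Qed.

Lemma expiD (s t : R) : expi (s + t) = expi s * expi t.
Proof. by apply: complex_ext; rewrite ?ReM ?ImM /= ?cosD ?sinD; ring. Qed.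

Lemma expi0 : expi 0 = 1 :> C.
Proof. by apply: complex_ext; rewrite /= ?cos0 ?sin0. Qed.

Lemma realCM (a b : R) : realC (a * b) = realC a * realC b.
Proof. by apply: complex_ext; rewrite ?ReM ?ImM /=; ring. Qed.

End complex_modulus.

(** * Integration over the torus and linearity of Fourier coefficients *)

Section torus_integrals.
Variable R : realType.
Notation C := (complex R).
Notation mu := (@lebesgue_measure R).
Implicit Types (f g w v : R -> C) (z : C) (l m : int).
Notation torus := (@torus R).

Lemma measurable_torus : measurable torus.
Proof. exact: measurable_itv. Qed.
Hint Resolve measurable_torus : core.

Lemma pi2_gt0 : 0 < 2 * pi :> R.
Proof. by rewrite mulr_gt0// pi_gt0. Qed.

Lemma lebesgue_torus : mu torus = (2 * pi)%:E.
Proof.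
rewrite /torus lebesgue_measure_itv/= lte_fin -subr_gt0 opprK addr_gt0 ?pi_gt0//.
by rewrite /= -EFinD; congr EFin; ring.
Qed.

Lemma integral_torus_cst (k : R) :
  (\int[mu]_(x in torus) k%:E = (k * (2 * pi))%:E)%E.
Proof.
by rewrite (integral_cst mu measurable_torus k%:E) [X in (_ * X)%E]lebesgue_torus.
Qed.

Definition cmeas f := measurable_fun torus (fun x => complex.Re (f x)) /\
  measurable_fun torus (fun x => complex.Im (f x)).

Definition cint f := mu.-integrable torus (EFin \o (fun x => complex.Re (f x))) /\
  mu.-integrable torus (EFin \o (fun x => complex.Im (f x))).

Lemma cmeasD f g : cmeas f -> cmeas g -> cmeas (fun x => f x + g x).
Proof.
move=> [f1 f2] [g1 g2]; split.
  by under eq_fun do rewrite ReD; exact: measurable_funD.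
by under eq_fun do rewrite ImD; exact: measurable_funD.
Qed.

Lemma cmeasM f g : cmeas f -> cmeas g -> cmeas (fun x => f x * g x).
Proof.
move=> [f1 f2] [g1 g2]; split.
  by under eq_fun do rewrite ReM; apply: measurable_funB; exact: measurable_funM.
by under eq_fun do rewrite ImM; apply: measurable_funD; exact: measurable_funM.
Qed.

Lemma cmeas_cst z : cmeas (fun=> z).
Proof. by split; exact: measurable_cst. Qed.

Lemma cmeas_expi (a b : R) : cmeas (fun x => expi (a * x + b)).
Proof.
have m : measurable_fun torus (fun x : R => a * x + b).
  by apply: measurable_funD => //; exact: measurable_funM.
split; (apply: measurableT_comp => //=; apply: continuous_measurable_fun).
  exact: continuous_cos.
exact: continuous_sin.
Qed.

Lemma cmeas_sqabs f : cmeas f -> measurable_fun torus (fun x => (sqabs (f x))%:E).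
Proof.
move=> [f1 f2]; apply/measurable_EFinP; apply: measurable_funD; exact: measurable_funX.
Qed.

Lemma L2norm2_ge0 w : (0 <= L2norm2 w)%E.
Proof. by apply: integral_ge0 => x _; rewrite lee_fin sqabs_ge0. Qed.

Lemma L2TP w : L2T w <-> cmeas w /\ (L2norm2 w < +oo)%E.
Proof. by split => [[]//|[[]]]. Qed.

Lemma L2norm2_le w v : (forall x, torus x -> sqabs (w x) <= sqabs (v x)) ->
  (L2norm2 w <= L2norm2 v)%E.
Proof.
move=> wv; apply: ge0_le_integral_lower => x tx; first by rewrite lee_fin sqabs_ge0.
by rewrite lee_fin wv.
Qed.

Lemma L2norm2D_le w v : cmeas w -> cmeas v ->
  (L2norm2 (fun x => w x + v x)%R <= 2%:E * L2norm2 w + 2%:E * L2norm2 v)%E.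
Proof.
move=> mw mv; rewrite /L2norm2.
have h0 f x : (0 <= (sqabs (f x : C))%:E)%E by rewrite lee_fin sqabs_ge0.
rewrite -!ge0_integralZl//; try exact: cmeas_sqabs.
rewrite -ge0_integralD//; last first.
- by apply: emeasurable_funM => //; exact: cmeas_sqabs.
- by move=> x _; rewrite mule_ge0.
- by apply: emeasurable_funM => //; exact: cmeas_sqabs.
- by move=> x _; rewrite mule_ge0.
apply: ge0_le_integral_lower => x _; first by rewrite lee_fin sqabs_ge0.
by rewrite -!EFinM -EFinD lee_fin sqabsD_le.
Qed.

Lemma L2norm2Z z w : cmeas w -> L2norm2 (fun x => z * w x) = ((sqabs z)%:E * L2norm2 w)%E.
Proof.
move=> mw; transitivity (\int[mu]_(x in torus) ((sqabs z)%:E * (sqabs (w x))%:E))%E.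
  by apply: eq_integral => x _; rewrite -EFinM sqabsM.
have m := cmeas_sqabs mw.
by rewrite ge0_integralZl// => [x _|]; rewrite lee_fin sqabs_ge0.
Qed.

Lemma L2TD w v : L2T w -> L2T v -> L2T (fun x => w x + v x).
Proof.
move=> /L2TP[mw Iw] /L2TP[mv Iv]; apply/L2TP; split; first exact: cmeasD.
apply: le_lt_trans (L2norm2D_le mw mv) _.
by rewrite lte_add_pinfty// lte_mul_pinfty.
Qed.

Lemma L2TZ z w : L2T w -> L2T (fun x => z * w x).
Proof.
move=> /L2TP[mw Iw]; apply/L2TP; split; first by apply: cmeasM => //; exact: cmeas_cst.
by rewrite L2norm2Z// lte_mul_pinfty// lee_fin sqabs_ge0.
Qed.

Lemma L2TB w v : L2T w -> L2T v -> L2T (L2sub w v).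
Proof.
move=> hw /(L2TZ (-1)) hv; have := L2TD hw hv.
by congr L2T; apply/funext => x; rewrite /L2sub mulN1r.
Qed.

Lemma L2T_bounded w K : cmeas w -> (forall x, torus x -> sqabs (w x) <= K) -> L2T w.
Proof.
move=> mw hK; apply/L2TP; split => //.
apply: (@le_lt_trans _ _ (\int[mu]_(x in torus) (cst K%:E) x)%E).
  apply: ge0_le_integral_lower => x tx; first by rewrite lee_fin sqabs_ge0.
  by rewrite lee_fin hK.
by rewrite integral_torus_cst ltry.
Qed.

Lemma L2T0 : L2T (fun=> 0 : C).
Proof.
apply: (@L2T_bounded _ 0); first exact: cmeas_cst.
by move=> x _; rewrite /sqabs/= !expr0n addr0.
Qed.

Lemma L2T_sum (I : Type) (s : seq I) (F : I -> R -> C) :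
  (forall i, L2T (F i)) -> L2T (fun x => \sum_(i <- s) F i x).
Proof.
move=> hF; elim: s => [|i s ih].
  by have := L2T0; congr L2T; apply/funext => x; rewrite big_nil.
have := L2TD (hF i) ih; congr L2T.
by apply/funext => x; rewrite big_cons.
Qed.

Lemma L2T_mul_bounded w e K : L2T w -> cmeas e ->
  (forall x, torus x -> sqabs (e x) <= K) -> L2T (fun x => w x * e x).
Proof.
move=> /L2TP[mw Iw] me hK; apply/L2TP; split; first exact: cmeasM.
have K0 : 0 <= Num.max K 0 by rewrite le_max lexx orbT.
apply: (@le_lt_trans _ _ (L2norm2 (fun x => realC (Num.sqrt (Num.max K 0)) * w x))).
  apply: L2norm2_le => x tx; rewrite !sqabsM sqabs_realC sqr_sqrtr// mulrC.
  by rewrite ler_wpM2r ?sqabs_ge0// le_max hK.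
by rewrite L2norm2Z// lte_mul_pinfty// lee_fin sqabs_ge0.
Qed.

Let sqint_torus (h : R -> R) : measurable_fun torus h ->
  (\int[mu]_(x in torus) (h x ^+ 2)%:E < +oo)%E -> sqint mu (h \_ torus).
Proof.
move=> mh Ih; split; first exact/(measurable_restrictT _ _).1.
rewrite integral_mkcond in Ih; apply: le_lt_trans Ih.
apply: ge0_le_integral_lower => x _; first by rewrite lee_fin sqr_ge0.
by rewrite !patchE; case: ifP => _ //; rewrite expr0n.
Qed.

Lemma L2T_sqint w : L2T w ->
  sqint mu ((fun x => complex.Re (w x)) \_ torus) /\
  sqint mu ((fun x => complex.Im (w x)) \_ torus).
Proof.
move=> /L2TP[[m1 m2] Iw]; split; apply: sqint_torus => //; apply: le_lt_trans Iw;
  apply: ge0_le_integral_lower => x _; rewrite ?lee_fin ?sqr_ge0//.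
  by rewrite /sqabs lerDl sqr_ge0.
by rewrite /sqabs lerDr sqr_ge0.
Qed.

Let sqint_torus1 : sqint mu ((fun _ : R => 1 : R) \_ torus).
Proof.
apply: sqint_torus; first exact: measurable_cst.
under eq_integral do rewrite expr1n.
by rewrite integral_torus_cst ltry.
Qed.

Let ip_torus (g h : R -> R) :
  ip mu (g \_ torus) (h \_ torus) = \int[mu]_(x in torus) (g x * h x).
Proof.
rewrite Rintegral_mkcond /ip; apply: eq_Rintegral => x _.
by rewrite !patchE; case: ifP => // _; rewrite mulr0.
Qed.

Let torus_CS (h : R -> R) : sqint mu (h \_ torus) ->
  (\int[mu]_(x in torus) h x) ^+ 2 <= 2 * pi * \int[mu]_(x in torus) (h x ^+ 2).
Proof.
move=> hh; have := ip_CS hh sqint_torus1; rewrite !ip_torus.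
have -> : \int[mu]_(x in torus) (h x * 1) = \int[mu]_(x in torus) h x.
  by apply: eq_Rintegral => x _; rewrite mulr1.
have -> : \int[mu]_(x in torus) (1 * 1 : R) = 2 * pi.
  rewrite /Rintegral; under eq_integral do rewrite mulr1.
  by rewrite integral_torus_cst mul1r.
by rewrite mulrC.
Qed.

Let sqint_torus_integrable (g h : R -> R) : sqint mu (g \_ torus) -> sqint mu (h \_ torus) ->
  mu.-integrable torus (EFin \o (fun x => g x * h x)).
Proof.
move=> hg hh; have h1 := sqint_integrable_mul hg hh.
have := (integrable_restrict mu measurable_torus measurableT (EFin \o (fun x => g x * h x))).
rewrite setTI => ->; apply: eq_integrable h1 => // x _ /=.
by rewrite !patchE; case: ifP => //; rewrite mulr0.
Qed.

Lemma L2T_cint w : L2T w -> cint w.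
Proof.
move=> /L2T_sqint[h1 h2].
have i1 := sqint_torus_integrable h1 sqint_torus1.
have i2 := sqint_torus_integrable h2 sqint_torus1.
by split; [apply: eq_integrable i1|apply: eq_integrable i2] => // x _ /=; rewrite mulr1.
Qed.

Lemma cintD f g : cint f -> cint g -> cint (fun x => f x + g x).
Proof.
move=> [f1 f2] [g1 g2]; split.
  have := integrableD (mu := mu) measurable_torus f1 g1.
  by apply: eq_integrable => // x _ /=; rewrite ReD.
have := integrableD (mu := mu) measurable_torus f2 g2.
by apply: eq_integrable => // x _ /=; rewrite ImD.
Qed.

Lemma cintZ z f : cint f -> cint (fun x => z * f x).
Proof.
move=> [f1 f2]; split.
  have := integrableB (mu := mu) measurable_torus
    (integrableZl (mu := mu) measurable_torus (complex.Re z) f1)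
    (integrableZl (mu := mu) measurable_torus (complex.Im z) f2).
  by apply: eq_integrable => // x _ /=; rewrite ReM.
have := integrableD (mu := mu) measurable_torus
  (integrableZl (mu := mu) measurable_torus (complex.Re z) f2)
  (integrableZl (mu := mu) measurable_torus (complex.Im z) f1).
by apply: eq_integrable => // x _ /=; rewrite ImM.
Qed.

Lemma integralCD f g : cint f -> cint g ->
  integralC (fun x => f x + g x) = integralC f + integralC g.
Proof.
move=> [f1 f2] [g1 g2]; apply: complex_ext; rewrite ?ReD ?ImD /= -RintegralD//.
  by apply: eq_Rintegral => x _; rewrite ReD.
by apply: eq_Rintegral => x _; rewrite ImD.
Qed.

Lemma integralCZ z f : cint f -> integralC (fun x => z * f x) = z * integralC f.
Proof.
move=> [f1 f2].
have j1 c := integrableZl (mu := mu) measurable_torus c f1.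
have j2 c := integrableZl (mu := mu) measurable_torus c f2.
apply: complex_ext; rewrite ?ReM ?ImM /= -!RintegralZl//.
  rewrite -RintegralB//; [|exact: j1|exact: j2].
  by apply: eq_Rintegral => x _; rewrite ReM.
rewrite -RintegralD//; [|exact: j2|exact: j1].
by apply: eq_Rintegral => x _; rewrite ImM.
Qed.

Lemma cint_sum (I : Type) (s : seq I) (F : I -> R -> C) :
  (forall i, cint (F i)) -> cint (fun x => \sum_(i <- s) F i x).
Proof.
move=> hF; elim: s => [|i s ih].
  by have := L2T_cint L2T0; congr cint; apply/funext => x; rewrite big_nil.
have := cintD (hF i) ih; congr cint.
by apply/funext => x; rewrite big_cons.
Qed.

Lemma integralC0 : integralC (fun=> 0 : C) = 0.
Proof. by apply: complex_ext => /=; rewrite /Rintegral integral0_eq. Qed.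

Lemma eq_integralC f g : (forall x, torus x -> f x = g x) -> integralC f = integralC g.
Proof.
by move=> fg; apply: complex_ext => /=; apply: eq_Rintegral => x /set_mem tx; rewrite fg.
Qed.

Lemma integralC_sum (I : Type) (s : seq I) (F : I -> R -> C) :
  (forall i, cint (F i)) ->
  integralC (fun x => \sum_(i <- s) F i x) = \sum_(i <- s) integralC (F i).
Proof.
move=> hF; elim: s => [|i s ih].
  rewrite big_nil; apply: (etrans _ integralC0).
  by apply: eq_integralC => x _; rewrite big_nil.
rewrite big_cons -ih -integralCD//; last exact: cint_sum.
by apply: eq_integralC => x _; rewrite big_cons.
Qed.

Lemma sqabs_integralC_le f : L2T f ->
  ((sqabs (integralC f))%:E <= (4 * pi)%:E * L2norm2 f)%E.
Proof.
move=> hf; have [h1 h2] := L2T_sqint hf; have /L2TP[[m1 m2] If] := hf.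
have i1 := sqint_torus_integrable h1 h1; have i2 := sqint_torus_integrable h2 h2.
have -> : L2norm2 f = (\int[mu]_(x in torus) (complex.Re (f x) ^+ 2) +
                       \int[mu]_(x in torus) (complex.Im (f x) ^+ 2))%:E.
  rewrite -RintegralD//; [|exact: i1..].
  by rewrite /L2norm2 /Rintegral fineK// ge0_fin_numE// L2norm2_ge0.
rewrite -EFinM lee_fin /sqabs /=.
have := torus_CS h1; have := torus_CS h2.
have p0 : 0 < pi :> R := pi_gt0 R.
set a := \int[mu]_(x in _) (_ ^+ 2); set b := \int[mu]_(x in _) (_ ^+ 2).
have a0 : 0 <= a by apply: Rintegral_ge0 => x _; rewrite sqr_ge0.
have b0 : 0 <= b by apply: Rintegral_ge0 => x _; rewrite sqr_ge0.
nra.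
Qed.

Let cpi : C := realC (Num.sqrt (2 * pi))^-1.

Lemma sqabs_cpi : sqabs cpi = (2 * pi)^-1.
Proof. by rewrite /cpi sqabs_realC exprVn sqr_sqrtr// ltW// pi2_gt0. Qed.

Definition echar l x : C := expi (- (l%:~R * x)).

Lemma cmeas_echar l : cmeas (echar l).
Proof.
have := @cmeas_expi (- l%:~R) 0; congr cmeas; apply/funext => x.
by rewrite addr0 mulNr.
Qed.

Lemma L2T_echar w l : L2T w -> L2T (fun x => w x * echar l x).
Proof.
move=> hw; apply: (@L2T_mul_bounded _ _ 1) => //; first exact: cmeas_echar.
by move=> x _; rewrite sqabs_expi.
Qed.

Lemma L2norm2_echar w l : L2norm2 (fun x => w x * echar l x) = L2norm2 w.
Proof. by apply: eq_integral => x _; rewrite sqabsM sqabs_expi mulr1. Qed.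

(** Bessel's inequality for one coefficient, up to a factor 2. It serves for limits in L^2 and for
    crude a priori bounds, so the factor does not reach the final constant. *)
Lemma fourier_bound w l : L2T w -> ((sqabs (fourier w l))%:E <= 2%:E * L2norm2 w)%E.
Proof.
move=> hw; rewrite /fourier sqabsM sqabs_cpi EFinM.
have := sqabs_integralC_le (L2T_echar l hw); rewrite L2norm2_echar => h.
apply: (@le_trans _ _ (((2 * pi)^-1)%:E * ((4 * pi)%:E * L2norm2 w))%E).
  by apply: lee_wpmul2l => //; rewrite lee_fin invr_ge0 ltW// pi2_gt0.
rewrite muleA -EFinM le_eqVlt; apply/orP; left; apply/eqP; congr (_%:E * _)%E.
have p0 : (pi : R) != 0 by apply: lt0r_neq0; exact: pi_gt0.
by move: (pi : R) p0 => p p0; field.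
Qed.

Lemma fourierD w v l : L2T w -> L2T v ->
  fourier (fun x => w x + v x) l = fourier w l + fourier v l.
Proof.
move=> hw hv; rewrite /fourier -mulrDr -integralCD.
- by congr (_ * _); apply: eq_integralC => x _; rewrite mulrDl.
- exact: (L2T_cint (L2T_echar l hw)).
- exact: (L2T_cint (L2T_echar l hv)).
Qed.

Lemma fourierZ z w l : L2T w -> fourier (fun x => z * w x) l = z * fourier w l.
Proof.
move=> hw; rewrite /fourier mulrCA -(integralCZ z); last exact: (L2T_cint (L2T_echar l hw)).
by congr (_ * _); apply: eq_integralC => x _; rewrite mulrA.
Qed.

Lemma fourier0 l : fourier (fun=> 0 : C) l = 0.
Proof.
by have := fourierZ 0 l L2T0; rewrite !mul0r.
Qed.

Lemma fourier_sum (I : Type) (s : seq I) (F : I -> R -> C) l :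
  (forall i, L2T (F i)) ->
  fourier (fun x => \sum_(i <- s) F i x) l = \sum_(i <- s) fourier (F i) l.
Proof.
move=> hF; elim: s => [|i s ih].
  rewrite big_nil -[RHS](fourier0 l); congr fourier; apply/funext => x.
  by rewrite big_nil.
rewrite big_cons -ih -fourierD//; last exact: L2T_sum.
by congr fourier; apply/funext => x; rewrite big_cons.
Qed.

Lemma fourierB w v l : L2T w -> L2T v ->
  fourier (L2sub w v) l = fourier w l - fourier v l.
Proof.
move=> hw hv; rewrite -mulN1r -fourierZ// -fourierD//; last exact: L2TZ.
by congr fourier; apply/funext => x; rewrite mulN1r.
Qed.

Lemma L2eq_fourier w v l : cmeas w -> cmeas v -> L2eq w v -> fourier w l = fourier v l.
Proof.
move=> mw mv wv; have [w1 w2] := cmeasM mw (cmeas_echar l).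
have [v1 v2] := cmeasM mv (cmeas_echar l).
rewrite /fourier; congr (_ * _); apply: complex_ext; rewrite /= /Rintegral; congr fine;
  apply: ae_eq_integral => //; try exact/measurable_EFinP.
- case: wv => N [mN N0 sN]; exists N; split => // x /= nx.
  by apply: sN => /= h; apply: nx => tx; rewrite h.
- case: wv => N [mN N0 sN]; exists N; split => // x /= nx.
  by apply: sN => /= h; apply: nx => tx; rewrite h.
Qed.

End torus_integrals.

(** * Orthonormality of the exponentials *)

Section orthonormal.
Variable R : realType.
Notation C := (complex R).
Notation mu := (@lebesgue_measure R).
Implicit Types (l k : int).
Notation torus := (@torus R).

Lemma sin_natpi (n : nat) : sin (n%:R * pi) = 0 :> R.
Proof.
elim: n => [|n ih]; first by rewrite mul0r sin0.
by rewrite -natr1 mulrDl mul1r sinDpi ih oppr0.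
Qed.

Lemma sin_intpi k : sin (k%:~R * pi) = 0 :> R.
Proof.
case: k => n; first exact: sin_natpi.
by rewrite NegzE mulrNz mulNr sinN sin_natpi oppr0.
Qed.

Let pi_lt : - pi < pi :> R.
Proof. by have := pi_gt0 R; move: (pi : R) => p; lra. Qed.

Lemma FTC_segment (f F : R -> R) a b : a < b -> continuous f ->
  (forall x, @is_derive R R^o R^o x 1 F (f x)) ->
  (\int[mu]_(x in `[a, b]) (f x)%:E = (F b - F a)%:E)%E.
Proof.
move=> ab cf dF.
have cF : continuous F.
  move=> x; apply: (@differentiable_continuous _ R^o R^o).
  by apply/derivable1_diffP; have := dF x; case.
rewrite (@continuous_FTC2 _ f F _ _ ab)//.
- exact: continuous_subspaceT.
- split.
  + by move=> x _; have := dF x; case.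
  + by apply: cvg_at_right_filter; exact: cF.
  + by apply: cvg_at_left_filter; exact: cF.
- by move=> x _; rewrite derive1E; have := dF x; case.
Qed.

Lemma torus_FTC (f F : R -> R) : continuous f ->
  (forall x, @is_derive R R^o R^o x 1 F (f x)) ->
  \int[mu]_(x in torus) f x = F pi - F (- pi).
Proof. by move=> cf dF; rewrite /Rintegral (FTC_segment pi_lt cf dF). Qed.

Lemma integralC_expi k :
  integralC (fun x => expi (k%:~R * x)) = realC (if k == 0 then 2 * pi else 0) :> C.
Proof.
case: eqVneq => [->|k0].
  have -> : (fun x : R => expi (0%:~R * x)) = (fun=> 1 : C).
    by apply/funext => x; rewrite mul0r expi0.
  apply: complex_ext => /=; rewrite /Rintegral integral_torus_cst.
    by rewrite mul1r.
  by rewrite mul0r.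
have k0' : (k%:~R : R) != 0 by rewrite intr_eq0.
have ckx (x : R) : (fun x : R => k%:~R * x) @ x --> k%:~R * x.
  by apply: cvgM; [exact: cvg_cst|exact: cvg_id].
have dsin (x : R) : @is_derive R R^o R^o x 1 (fun x => (k%:~R)^-1 * sin (k%:~R * x))
    (cos (k%:~R * x)).
  by apply: is_derive_eq; rewrite /GRing.scale/=; field.
have dcos (x : R) : @is_derive R R^o R^o x 1 (fun x => - (k%:~R)^-1 * cos (k%:~R * x))
    (sin (k%:~R * x)).
  by apply: is_derive_eq; rewrite /GRing.scale/=; field.
have ccos : continuous (fun x : R => cos (k%:~R * x)).
  by move=> x; apply: continuous_comp (ckx x) _; exact: continuous_cos.
have csin : continuous (fun x : R => sin (k%:~R * x)).
  by move=> x; apply: continuous_comp (ckx x) _; exact: continuous_sin.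
apply: complex_ext => /=.
  by rewrite (torus_FTC ccos dsin) mulrN sinN sin_intpi oppr0 subrr.
by rewrite (torus_FTC csin dcos) mulrN cosN subrr.
Qed.

Lemma fourier_basis k l : fourier (Defs.basis k) l = realC (if k == l then 1 else 0) :> C.
Proof.
have E : (fun x => Defs.basis k x * expi (- (l%:~R * x))) =
    (fun x : R => realC (Num.sqrt (2 * pi))^-1 * expi ((k - l)%:~R * x)).
  apply/funext => x; rewrite /Defs.basis -mulrA -expiD intrB mulrBl.
  by [].
rewrite /fourier E integralCZ; last first.
  apply: L2T_cint; apply: (@L2T_bounded _ _ 1).
    have := @cmeas_expi R (k - l)%:~R 0; congr cmeas; apply/funext => x.
    by rewrite addr0.
  by move=> x _; rewrite sqabs_expi.
rewrite integralC_expi subr_eq0 mulrA -!realCM -expr2 exprVn sqr_sqrtr ?(ltW (pi2_gt0 _))//.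
case: ifP => _; last by rewrite mulr0.
by rewrite mulVf// gt_eqF// pi2_gt0.
Qed.

Lemma L2T_basis k : L2T (@Defs.basis R k).
Proof.
apply: L2TZ; apply: (@L2T_bounded _ _ 1).
  have := @cmeas_expi R k%:~R 0; congr cmeas; apply/funext => x.
  by rewrite addr0.
by move=> x _; rewrite sqabs_expi.
Qed.

Lemma fourier_Qhalf (q : int -> R) k l :
  fourier (Qhalf q k) l = realC (if k == l then Num.sqrt (q k) else 0) :> C.
Proof.
rewrite /Qhalf fourierZ; last exact: L2T_basis.
by rewrite fourier_basis -realCM; case: ifP => _; rewrite ?mulr1 ?mulr0.
Qed.

End orthonormal.

Lemma ae_mono2 d (T : measurableType d) (R : realType)
    (mu : {measure set T -> \bar R}) (P1 P2 Q : T -> Prop) :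
  {ae mu, forall x, P1 x} -> {ae mu, forall x, P2 x} ->
  (forall x, P1 x -> P2 x -> Q x) -> {ae mu, forall x, Q x}.
Proof. by move=> h1 h2 h; apply: filterS2 h1 h2. Qed.

Lemma ae_lebesgue_neq (R : realType) (a : R) :
  {ae (@lebesgue_measure R), forall x, x <> a}.
Proof.
exists [set a]; split => //; first exact: lebesgue_measure_set1.
by move=> x /= /contrapT.
Qed.

(** * Uniqueness of Fourier coefficients *)

Section uniqueness.
Variable R : realType.
Notation C := (complex R).
Notation mu := (@lebesgue_measure R).
Notation torus := (@torus R).
Implicit Types (q : R -> R).

(** Real-valued trigonometric polynomials. Frequencies may repeat in the list, so sums are
    concatenations and products are lists of all pairs. *)
Definition trigpoly q : Prop := exists s : seq (C * int),
  forall x, realC (q x) = \sum_(p <- s) p.1 * expi (p.2%:~R * x).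

Lemma trigpoly_cst (c : R) : trigpoly (fun=> c).
Proof.
exists [:: (realC c, 0)] => x; rewrite big_seq1 /= mul0r expi0 mulr1.
by [].
Qed.

Lemma trigpolyM q1 q2 : trigpoly q1 -> trigpoly q2 -> trigpoly (fun x => q1 x * q2 x).
Proof.
move=> [s1 h1] [s2 h2].
exists [seq (p.1 * r.1, p.2 + r.2) | p <- s1, r <- s2] => x.
rewrite realCM h1 h2 big_allpairs_dep mulr_suml; apply: eq_bigr => p _.
rewrite mulr_sumr; apply: eq_bigr => r _ /=.
rewrite intrD mulrDl expiD; ring.
Qed.

Lemma trigpolyD q1 q2 : trigpoly q1 -> trigpoly q2 -> trigpoly (fun x => q1 x + q2 x).
Proof.
move=> [s1 h1] [s2 h2]; exists (s1 ++ s2) => x.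
by rewrite big_cat/= -h1 -h2; apply: complex_ext; rewrite ?ReD ?ImD/= ?addr0.
Qed.

Lemma trigpolyX q n : trigpoly q -> trigpoly (fun x => q x ^+ n).
Proof.
move=> hq; elim: n => [|n ih]; first exact: trigpoly_cst.
by under eq_fun do rewrite exprS; exact: trigpolyM.
Qed.

Lemma trigpoly_cos m : trigpoly (fun x => cos (x - m)).
Proof.
exists [:: (realC 2^-1 * expi (- m), 1%:Z); (realC 2^-1 * expi m, -1%:Z)] => x.
rewrite big_cons big_seq1 /= mul1r mulrN1z mulN1r -!mulrA -!expiD.
have -> : m - x = - (x - m) by rewrite opprB.
rewrite [- m + x]addrC; apply: complex_ext; rewrite ?ReD ?ImD ?ReM ?ImM /= ?cosN ?sinN.
  by field.
by field.
Qed.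

(* With N close to c ^ - n, the polynomial (1 - s ^ n) ^ N tends to the
   indicator of s < c on [0, 1] away from s = c. *)
Section peak.
Variable c : R.
Hypothesis c01 : 0 < c < 1.

Definition peak n (s : R) : R := (1 - s ^+ n) ^+ (Num.truncn (c ^- n)).+1.

Lemma peak_bound n s : 0 <= s <= 1 -> 0 <= peak n s <= 1.
Proof.
move=> /andP[s0 s1].
have h : 0 <= 1 - s ^+ n <= 1.
  by rewrite subr_ge0 exprn_ile1// lerBlDr lerDl exprn_ge0.
have [h0 h1] := andP h; by rewrite exprn_ge0//= exprn_ile1.
Qed.

Lemma bernoulli_ineq (x : R) N : 0 <= x <= 1 -> 1 - N%:R * x <= (1 - x) ^+ N.
Proof.
move=> /andP[x0 x1]; elim: N => [|N ih]; first by rewrite mul0r subr0.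
rewrite exprS -natr1.
have h : (1 - x) * (1 - N%:R * x) <= (1 - x) * (1 - x) ^+ N.
  by rewrite ler_wpM2l// subr_ge0.
apply: le_trans h; have : 0 <= N%:R * x * x by rewrite !mulr_ge0.
by lra.
Qed.

Lemma bernoulli_ineq2 (x : R) N : 0 <= x <= 1 -> (1 - x) ^+ N * (1 + N%:R * x) <= 1.
Proof.
move=> /andP[x0 x1]; elim: N => [|N ih]; first by rewrite mul0r addr0 mulr1.
rewrite exprSr -mulrA; apply: le_trans ih.
rewrite ler_wpM2l ?exprn_ge0 ?subr_ge0// -natr1.
have : 0 <= N%:R * x * x by rewrite !mulr_ge0.
have : 0 <= x * x by rewrite mulr_ge0.
by lra.
Qed.

(** Bernoulli's inequality gives 1 - N s^n <= [peak n s], and N <= c^-n + 1 makes N s^n at most (s /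
    c)^n + s^n. *)
Lemma peak_cvg1 s : 0 <= s -> s < c -> peak n s @[n --> \oo] --> (1 : R).
Proof.
move=> s0 sc; have [c0 c1] := andP c01.
have h1 : (fun n => (s / c) ^+ n) @ \oo --> (0 : R).
  by apply: cvg_expr; rewrite ger0_norm ?divr_ge0 ?(ltW c0)// ltr_pdivrMr// mul1r.
have h2 : (fun n => s ^+ n) @ \oo --> (0 : R).
  by apply: cvg_expr; rewrite ger0_norm// (lt_trans sc).
have h3 : (fun n => 1 - ((s / c) ^+ n + s ^+ n)) @ \oo --> (1 : R).
  by rewrite -[X in _ --> X]subr0 -[X in _ - X](addr0 0); apply: cvgB; [exact: cvg_cst|exact: cvgD].
apply: (@squeeze_cvgr _ _ _ _ _ (fun=> 1) _ _ _ h3); last exact: cvg_cst.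
near=> n; have s01 : 0 <= s <= 1 by rewrite s0 ltW// (lt_trans sc).
have [_ ->] := andP (peak_bound n s01); rewrite andbT.
have sn : 0 <= s ^+ n <= 1 by rewrite exprn_ge0// exprn_ile1//; have [] := andP s01.
apply: le_trans (bernoulli_ineq _ sn); rewrite lerD2l lerN2.
rewrite -natr1 mulrDl mul1r lerD2r exprMn exprVn mulrC ler_wpM2l ?exprn_ge0//.
by rewrite truncn_le invr_ge0 exprn_ge0// ltW.
Unshelve. all: by end_near. Qed.

(** By [bernoulli_ineq2], [peak n s] is at most 1 / (1 + N s^n), and N > c^-n bounds this by (c /
    s)^n. *)
Lemma peak_cvg0 s : s <= 1 -> c < s -> peak n s @[n --> \oo] --> (0 : R).
Proof.
move=> s1 cs; have [c0 c1] := andP c01; have s0 : 0 < s by exact: lt_trans cs.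
have h1 : (fun n => (c / s) ^+ n) @ \oo --> (0 : R).
  by apply: cvg_expr; rewrite ger0_norm ?divr_ge0 ?(ltW c0) ?(ltW s0)// ltr_pdivrMr// mul1r.
apply: (@squeeze_cvgr _ _ _ _ (fun=> 0) _ _ _ _ _ h1); last exact: cvg_cst.
near=> n; have s01 : 0 <= s <= 1 by rewrite s1 ltW.
have [-> _] := andP (peak_bound n s01); rewrite /=.
have sn : 0 <= s ^+ n <= 1 by rewrite exprn_ge0 ?(ltW s0)// exprn_ile1// ltW.
have := bernoulli_ineq2 (Num.truncn (c ^- n)).+1 sn; rewrite -/(peak n s) => h.
have sn0 : 0 < (s / c) ^+ n by rewrite exprn_gt0// divr_gt0.
have h2 : (s / c) ^+ n <= 1 + (Num.truncn (c ^- n)).+1%:R * s ^+ n.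
  apply: (@le_trans _ _ ((Num.truncn (c ^- n)).+1%:R * s ^+ n)); last by rewrite lerDr.
  rewrite exprMn exprVn mulrC ler_wpM2r ?exprn_ge0 ?(ltW s0)// ltW//.
  exact: truncnS_gt.
have -> : (c / s) ^+ n = ((s / c) ^+ n)^-1 by rewrite -exprVn invf_div.
rewrite -[leRHS]mul1r ler_pdivlMr//; apply: le_trans h.
by rewrite ler_wpM2l//; have [] := andP (peak_bound n s01).
Unshelve. all: by end_near. Qed.

End peak.

Section orthogonal.
Variable g : R -> R.
Hypothesis gint : mu.-integrable torus (EFin \o g).
Hypothesis gorth : forall q, trigpoly q -> \int[mu]_(x in torus) (g x * q x) = 0.

Let mtorus := @measurable_torus R.

(** (1 + cos (x - m)) / 2 is a trigonometric polynomial with values in [0, 1], above c inside the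
    ball and below c outside. Composed with [peak c n] it tends to the indicator of the complement,
    and dominated convergence transfers the orthogonality to that indicator; orthogonality to 1 then
    gives the ball itself. The device comes from elementary proofs of the Stone-Weierstrass
    theorem. *)
Lemma orth_ball m h : 0 < h -> - pi < m - h -> m + h < pi ->
  \int[mu]_(x in torus `&` ball m h) g x = 0.
Proof.
move=> h0 hm1 hm2; have pi0 := pi_gt0 R.
have hpi : h < pi by move: (pi : R) hm1 hm2 => p; lra.
pose s x := (1 + cos (x - m)) / 2.
pose c := (1 + cos h) / 2.
have cosin (y : R) : -1 <= cos y <= 1 by rewrite cos_geN1 cos_le1.
have cosabs (y : R) : cos `|y| = cos y.
  by case: (leP 0 y) => y0; [rewrite ger0_norm|rewrite ltr0_norm// cosN].
have hin : h \in `[0, pi] by rewrite in_itv/= !ltW.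
have c01 : 0 < c < 1.
  have hc1 : cos h < 1 by rewrite -cos0 ltr_cos// in_itv/= lexx ltW.
  have hc2 : -1 < cos h by rewrite -cospi ltr_cos// in_itv/= lexx ltW.
  by rewrite /c; apply/andP; split; lra.
have s01 x : 0 <= s x <= 1 by have := cosin (x - m); rewrite /s; lra.
have tri n : trigpoly (fun x => peak c n (s x)).
  apply: trigpolyX; apply: trigpolyD; first exact: trigpoly_cst.
  have -> : (fun x => - s x ^+ n) = (fun x => -1 * s x ^+ n) by apply/funext => x; rewrite mulN1r.
  apply: trigpolyM; first exact: trigpoly_cst.
  apply: trigpolyX; apply: trigpolyM; last exact: trigpoly_cst.
  by apply: trigpolyD; [exact: trigpoly_cst|exact: trigpoly_cos].
have in_s x : torus x -> `|x - m| < h -> c < s x.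
  move=> tx xh; rewrite /c /s ltr_pM2r ?invr_gt0// ltrD2l.
  rewrite -(cosabs (x - m)).
  by rewrite ltr_cos// in_itv/= normr_ge0/= ltW// (lt_trans xh).
have out_s x : torus x -> h < `|x - m| -> s x < c.
  rewrite /Defs.torus/= in_itv/= => /andP[x1 x2] xh; rewrite /c /s ltr_pM2r ?invr_gt0// ltrD2l.
  rewrite -(cosabs (x - m)).
  (* The distance |x - m| can exceed pi, where cos is increasing again. As the ball lies strictly
     inside the torus, the distance stays below 2 pi - h and can be reflected to 2 pi - |x - m|. *)
  have xm2 : `|x - m| < 2 * pi - h.
    by rewrite ltr_norml; move: (pi : R) x1 x2 hm1 hm2 => p; lra.
  case: (leP `|x - m| pi) => xp; first by rewrite ltr_cos// in_itv/= normr_ge0.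
  have -> : cos `|x - m| = cos (2 * pi - `|x - m|).
    rewrite -[in LHS]cosN -[in LHS]cosD2pi; congr cos.
    by rewrite mulr_natl addrC.
  have hin2 : 2 * pi - `|x - m| \in `[0, pi].
    by rewrite in_itv/=; move: (pi : R) xm2 xp h0 => p; lra.
  by rewrite ltr_cos//; lra.
pose I : set R := ball m h; have mI : measurable I by exact: measurable_ball.
have inI x : I x <-> `|x - m| < h by rewrite /I /ball/= distrC.
have mg : measurable_fun torus g by case/integrableP: gint => /measurable_EFinP.
have mg' : measurable_fun torus (g \_ (~` I)).
  apply/(measurable_restrict _ (measurableC mI) mtorus).
  exact: measurable_funS mg.
have ms : measurable_fun torus s.
  apply: measurable_funM => //; apply: measurable_funD => //.
  have mc : measurable_fun setT (@cos R).
    by apply: continuous_measurable_fun; exact: continuous_cos.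
  by apply: (measurableT_comp mc); exact: measurable_funB.
have mf n : measurable_fun torus (fun x => (g x * peak c n (s x))%:E).
  apply/measurable_EFinP; apply: measurable_funM => //.
  by apply: measurable_funX; apply: measurable_funB => //; exact: measurable_funX.
have mf' : measurable_fun torus (EFin \o (g \_ (~` I))) by exact/measurable_EFinP.
have cvg_ae : \forall x \ae mu, torus x ->
    (g x * peak c n (s x))%:E @[n --> \oo] --> (EFin \o (g \_ (~` I))) x.
  apply: ae_mono2 (ae_lebesgue_neq (m - h)) (ae_lebesgue_neq (m + h)) _.
  move=> x x1 x2 tx; apply: cvg_EFin; first by near=> n.
  have [s0 s1] := andP (s01 x).
  rewrite /comp patchE; case: ifPn => xI.
    have hx : h < `|x - m|.
      rewrite lt_neqAle; apply/andP; split.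
        apply/eqP => hx; move: x1 x2; rewrite hx; case: (leP 0 (x - m)) => xm.
          by rewrite ger0_norm// => _; apply; ring.
        by rewrite ltr0_norm// => + _; apply; ring.
      by rewrite leNgt; apply/negP => xh; move: xI; rewrite inE/=; apply; apply/inI.
    rewrite -[X in _ --> X]mulr1; apply: cvgM; first exact: cvg_cst.
    by apply: peak_cvg1 => //; exact: out_s.
  have hx : `|x - m| < h.
    by apply/inI; move: xI; rewrite notin_setE/= => /contrapT.
  rewrite -[X in _ --> X](mulr0 (g x)); apply: cvgM; first exact: cvg_cst.
  by apply: peak_cvg0 => //; exact: in_s.
have dom : \forall x \ae mu, forall n, torus x -> (`|(g x * peak c n (s x))%:E| <= `|(g x)%:E|)%E.
  exists set0; split => // x /= nx; apply: nx => n tx.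
  have [p0 p1] := andP (peak_bound c n (s01 x)).
  by rewrite lee_fin normrM ler_piMr// ger0_norm.
have [i1 _ H] := dominated_convergence (mu := mu) mtorus mf mf' cvg_ae (integrable_abse gint) dom.
have i0 n : (\int[mu]_(x in torus) (g x * peak c n (s x))%:E = 0)%E.
  have := gorth (tri n); rewrite /Rintegral => h1; rewrite -[LHS]fineK ?h1//.
  apply: integrable_fin_num => //.
  apply: (le_integrable (mu := mu) mtorus (mf n) _ gint) => x tx.
  have [p0 p1] := andP (peak_bound c n (s01 x)).
  by rewrite lee_fin normrM ler_piMr// ger0_norm.
have J0 : \int[mu]_(x in torus) (g \_ (~` I)) x = 0.
  rewrite /Rintegral; have -> : (\int[mu]_(x in torus) ((g \_ (~` I)) x)%:E = 0)%E; last by [].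
  rewrite -(cvg_lim (@ereal_hausdorff R) H).
  rewrite (_ : (fun n => _) = (fun=> 0%E)); first exact: lim_cst.
  by apply/funext => n; exact: i0.
have Jg : \int[mu]_(x in torus) g x = 0.
  have := gorth (trigpoly_cst 1); under eq_Rintegral do rewrite mulr1.
  by [].
have i2 : mu.-integrable torus (EFin \o (g \_ I)).
  apply: (le_integrable (mu := mu) mtorus _ _ gint).
    apply/measurable_EFinP/(measurable_restrict _ mI mtorus).
    exact: measurable_funS mg.
  by move=> x tx; rewrite /= patchE; case: ifP => _ //; rewrite normr0 lee_fin.
rewrite setIC Rintegral_mkcondl.
move: Jg; rewrite (_ : \int[mu]_(x in torus) g x =
  \int[mu]_(x in torus) ((g \_ I) x + (g \_ (~` I)) x)); last first.
  apply: eq_Rintegral => x _; rewrite !patchE in_setC.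
  by case: (_ \in (I : set _)); rewrite ?addr0 ?add0r.
by rewrite RintegralD// J0 addr0.
Unshelve. all: by end_near. Qed.

(** At a Lebesgue point x, the mean of |G - G x| over small balls tends to 0; since G has mean zero
    on these balls by [orth_ball], that mean is at least |G x|. The endpoints are discarded so that
    small balls stay inside the torus. *)
Lemma orth_ae0 : {ae mu, forall x, torus x -> g x = 0}.
Proof.
pose G := g \_ torus.
have locG : locally_integrable setT G by exact: integrable_locally.
apply: ae_mono2 (lebesgue_differentiation locG)
  (ae_mono2 (ae_lebesgue_neq (- pi)) (ae_lebesgue_neq pi) (fun x a b => conj a b)) _.
move=> x Lx [x1 x2] tx.
have [y1 y2] : - pi < x /\ x < pi.
  move: tx; rewrite /Defs.torus/= in_itv/= => /andP[y1 y2].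
  by rewrite !lt_neqAle y1 y2 !andbT; split; apply/eqP => // /esym.
have Gx : G x = g x by rewrite /G patchE mem_set.
rewrite -Gx; apply/eqP; rewrite -normr_le0; apply/ler_addgt0Pr => e e0; rewrite add0r.
have nb : nbhs 0%E [set y : \bar R | (y < e%:E)%E].
  apply: open_nbhs_nbhs; split; first exact: open_ereal_lt_ereal.
  by rewrite /= lte_fin.
have near_e : \forall r \near (0 : R)^'+, (davg G x r < e%:E)%E by exact: Lx nb.
near (0 : R)^'+ => r.
have r0 : 0 < r by near: r; exact: nbhs_right_gt.
have rx1 : r < x + pi by near: r; apply: nbhs_right_lt; move: (pi : R) y1 => p; lra.
have rx2 : r < pi - x by near: r; apply: nbhs_right_lt; move: (pi : R) y2 => p; lra.
have de : (davg G x r < e%:E)%E by near: r.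
have mb : measurable (ball x r : set R) by exact: measurable_ball.
have sub : ball x r `<=` torus.
  move=> y; rewrite /ball/= /Defs.torus/= in_itv/= ltr_norml.
  by move: (pi : R) rx1 rx2 => p; lra.
have J : \int[mu]_(y in ball x r) G y = 0.
  have := @orth_ball x r r0; rewrite Rintegral_mkcondl; apply.
  - by move: (pi : R) rx1 => p; lra.
  - by move: (pi : R) rx2 => p; lra.
have iG : mu.-integrable (ball x r) (EFin \o G).
  have : mu.-integrable (ball x r) (EFin \o g) by exact: (integrableS (mu := mu) mtorus mb sub gint).
  apply: eq_integrable => // y /set_mem yb.
  by rewrite /comp /G patchE mem_set//; exact: sub.
have mub : mu (ball x r : set R) = (r *+ 2)%:E.
  by apply: lebesgue_measure_ball; exact: ltW.
have cstE (k : R) : (\int[mu]_(y in ball x r) k%:E = (k * (r *+ 2))%:E)%E.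
  by rewrite (integral_cst mu mb k%:E) [X in (_ * X)%E]mub.
have ic : mu.-integrable (ball x r) (EFin \o (fun=> G x)).
  apply/integrableP; split; first exact/measurable_EFinP.
  by rewrite (cstE `|G x|) ltry.
have iB := integrableB (mu := mu) mb iG ic.
have key : `|G x| * (r *+ 2) <= \int[mu]_(y in ball x r) `|G y - G x|.
  have := le_normr_Rintegral (mu := mu) mb iB.
  rewrite RintegralB// J sub0r normrN.
  rewrite [X in `|X|](_ : _ = G x * (r *+ 2)); last by rewrite /Rintegral cstE.
  by rewrite normrM (ger0_norm (x := r *+ 2))// mulrn_wge0// ltW.
have r20 : 0 < r *+ 2 by rewrite mulrn_wgt0.
have davgE : davg G x r = ((r *+ 2)^-1 * \int[mu]_(y in ball x r) `|G y - G x|)%:E.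
  rewrite /davg /iavg [X in (X^-1 * _)%E]mub inver gt_eqF// EFinM; congr (_ * _)%E.
  rewrite /Rintegral fineK//; apply: integrable_fin_num => //.
  by have := integrable_norm iB.
rewrite davgE lte_fin ltr_pdivrMl// in de.
rewrite -(@ler_pM2r _ (r *+ 2))//; apply: le_trans key _.
by rewrite mulrC ltW.
Unshelve. all: by end_near. Qed.

End orthogonal.

(** The coefficients vanish exactly when f is orthogonal to all exponentials. Testing against
    real-valued trigonometric polynomials separates the real and imaginary parts, and [orth_ae0]
    applies to each. *)
Lemma fourier_inj (f : R -> C) : L2T f -> (forall l, fourier f l = 0) ->
  {ae mu, forall x, torus x -> f x = 0}.
Proof.
move=> hf f0.
have I0 k : integralC (fun x => f x * expi (k%:~R * x)) = 0.
  have := f0 (- k); rewrite /fourier => /eqP; rewrite mulf_eq0 => /orP[/eqP|/eqP].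
    move=> /(congr1 (@complex.Re R))/= /eqP; rewrite invr_eq0 sqrtr_eq0 leNgt.
    by rewrite pi2_gt0.
  by under eq_fun do rewrite mulrNz mulNr opprK.
have cfe k : cint (fun x => f x * expi (k%:~R * x)).
  apply: L2T_cint; have := L2T_echar (- k) hf; congr L2T; apply/funext => x.
  by rewrite /echar mulrNz mulNr opprK.
have J0 q : trigpoly q -> integralC (fun x => f x * realC (q x)) = 0.
  move=> [s hs].
  have -> : (fun x => f x * realC (q x)) =
      (fun x => \sum_(p <- s) p.1 * (f x * expi (p.2%:~R * x))).
    by apply/funext => x; rewrite hs mulr_sumr; apply: eq_bigr => p _; rewrite mulrCA.
  rewrite integralC_sum; last by move=> p; exact: cintZ.
  by apply: big1 => p _; rewrite integralCZ// I0 mulr0.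
have [i1 i2] := L2T_cint hf.
have h1 : {ae mu, forall x, torus x -> complex.Re (f x) = 0}.
  apply: orth_ae0 => // q hq.
  have /(congr1 (@complex.Re R)) /= h := J0 q hq; rewrite -[RHS]h.
  by apply: eq_Rintegral => x _; rewrite ReM/= mulr0 subr0.
have h2 : {ae mu, forall x, torus x -> complex.Im (f x) = 0}.
  apply: orth_ae0 => // q hq.
  have /(congr1 (@complex.Im R)) /= h := J0 q hq; rewrite -[RHS]h.
  by apply: eq_Rintegral => x _; rewrite ImM/= mulr0 add0r.
apply: ae_mono2 h1 h2 _ => x r0 i0 tx.
by apply: complex_ext; rewrite ?r0 ?i0.
Qed.

End uniqueness.

(** * Uniform convergence of the Fourier series and coefficients of a product *)

Section weierstrass.
Context (R : realType) (psi : nat -> R).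
Hypothesis psi_cvg : cvgn (series psi).

Lemma weierstrass_M (u : nat -> R) : (forall n, `|u n| <= psi n) ->
  cvgn (series u) /\
  forall N, `|limn (series u) - series u N| <= limn (series psi) - series psi N.
Proof.
move=> hu; have cu : cvgn (series u).
  apply: normed_cvg; apply: (series_le_cvg _ _ hu psi_cvg) => n //.
  exact: le_trans (hu n).
split=> // N.
have h1 : (fun M => `|series u M - series u N|) @ \oo --> `|limn (series u) - series u N|.
  by apply: cvg_norm; apply: cvgB; [exact: cu|exact: cvg_cst].
have h2 : (fun M => series psi M - series psi N) @ \oo --> limn (series psi) - series psi N.
  by apply: cvgB; [exact: psi_cvg|exact: cvg_cst].
apply: ler_cvg_to h1 h2 _; near=> M.
have NM : (N <= M)%N by near: M; exact: nbhs_infty_ge.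
rewrite !sub_series_geq//; apply: le_trans (ler_norm_sum _ _ _) _.
exact: ler_sum.
Unshelve. all: by end_near. Qed.

Lemma series_tail_cvg0 : (limn (series psi) - series psi N) @[N --> \oo] --> (0 : R).
Proof.
rewrite -[X in _ --> X](subrr (limn (series psi))).
by apply: cvgB; [exact: cvg_cst|exact: psi_cvg].
Qed.

End weierstrass.

Section product_bound.
Variable R : realType.
Notation C := (complex R).
Notation mu := (@lebesgue_measure R).
Notation torus := (@torus R).
Variable sigma : nat.
Hypothesis sigma_gt0 : (0 < sigma)%N.
Variable Phi : R -> R.
Let PhiC x : C := realC (Phi x).
Hypothesis hPhi : Hsob sigma PhiC.

Let c0 : R := (Num.sqrt (2 * pi))^-1.
Let c0_ge0 : 0 <= c0. Proof. by rewrite invr_ge0 sqrtr_ge0. Qed.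

Definition phi_coef (m : int) : R := c0 * cabs (fourier PhiC m).

Lemma phi_coef_ge0 m : 0 <= phi_coef m.
Proof. by rewrite mulr_ge0// cabs_ge0. Qed.

Lemma wnorm_fourier (w : R -> C) (b : R) : wnorm sigma (fun l => b * cabs (fourier w l)) =
  ((b ^+ 2)%:E * Hnorm2 sigma w)%E.
Proof.
by rewrite wnormZ; congr (_ * _)%E; apply: eq_esum => l _; rewrite sqr_cabs.
Qed.

Lemma wnorm_phi_coef : (wnorm sigma phi_coef < +oo)%E.
Proof.
by rewrite wnorm_fourier lte_mul_pinfty ?lee_fin ?sqr_ge0//; case: hPhi.
Qed.

Let a := fourier PhiC.
(** Grouping the frequencies n and -(n + 1) turns the two-sided Fourier series into a series over
    nat. *)
Let term n (x : R) : C := a (Posz n) * Defs.basis (Posz n) x + a (Negz n) * Defs.basis (Negz n) x.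
Let psi n : R := phi_coef (Posz n) + phi_coef (Negz n).

Let cabs_basis k x : cabs (@Defs.basis R k x) = c0.
Proof. by rewrite cabsM cabs_expi mulr1 cabs_realC ger0_norm. Qed.

Let term_le n x : cabs (term n x) <= psi n.
Proof.
by apply: le_trans (cabsD _ _) _; rewrite !(cabsM (a _)) !cabs_basis !(mulrC _ c0).
Qed.

(** For sigma >= 1 a function in H^sigma has absolutely summable coefficients, by [wnorm_l1]; the
    partial sums are nondecreasing and bounded by the total. *)
Let psi_cvg : cvgn (series psi).
Proof.
have h : (\esum_(l in [set: int]) (phi_coef l)%:E < +oo)%E.
  apply: (@le_lt_trans _ _ (\esum_(l in [set: int]) `|phi_coef l|%:E)%E).
    by apply: le_esum => l _; rewrite lee_fin ler_norm.
  apply: le_lt_trans (wnorm_l1 sigma_gt0 _) _.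
  by rewrite lte_add_pinfty// ?ltry//; exact: wnorm_phi_coef.
have h0 : (0 <= \esum_(l in [set: int]) (phi_coef l)%:E)%E.
  by apply: esum_ge0 => l _; rewrite lee_fin phi_coef_ge0.
apply: nondecreasing_is_cvgn.
  apply/nondecreasing_seqP => n; rewrite !seriesEnat/= big_nat_recr//= lerDl.
  by rewrite addr_ge0// phi_coef_ge0.
exists (fine (\esum_(l in [set: int]) (phi_coef l)%:E)) => _ [N _ <-].
rewrite -lee_fin fineK; last by rewrite ge0_fin_numE.
apply: le_trans (@esum_int_ge _ (fun l => (phi_coef l)%:E) N _); last first.
  by move=> l; rewrite lee_fin phi_coef_ge0.
by rewrite seriesEnat/= big_mkord -sumEFin lee_sum.
Qed.

Let tau N := limn (series psi) - series psi N.

Let L2T_term n : L2T (term n).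
Proof. by apply: L2TD; apply: L2TZ; exact: L2T_basis. Qed.

Let partial N x : C := \sum_(n < N) term n x.

Let Re_partial N x : complex.Re (partial N x) = series (fun n => complex.Re (term n x)) N.
Proof. by rewrite Re_sum seriesEnat/= big_mkord. Qed.

Let Im_partial N x : complex.Im (partial N x) = series (fun n => complex.Im (term n x)) N.
Proof. by rewrite Im_sum seriesEnat/= big_mkord. Qed.

Let L2T_partial N : L2T (partial N).
Proof. exact: L2T_sum. Qed.

(** The sum of the Fourier series, defined at every point; [PhiV] identifies it with Phi almost
    everywhere. *)
Let V x : C := (limn (series (fun n => complex.Re (term n x))) +i*
                limn (series (fun n => complex.Im (term n x))))%C.

Let Re_bound x n : `|complex.Re (term n x)| <= psi n.
Proof. exact: le_trans (Re_le_cabs _) (term_le _ _). Qed.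

Let Im_bound x n : `|complex.Im (term n x)| <= psi n.
Proof. exact: le_trans (Im_le_cabs _) (term_le _ _). Qed.

Let V_partial N x : sqabs (V x - partial N x) <= 2 * tau N ^+ 2.
Proof.
have [_ /(_ N) h1] := weierstrass_M psi_cvg (Re_bound x).
have [_ /(_ N) h2] := weierstrass_M psi_cvg (Im_bound x).
rewrite /sqabs ReD ImD ReN ImN Re_partial Im_partial /=.
have t0 : 0 <= tau N by exact: le_trans h1.
have sq (z : R) : `|z| <= tau N -> z ^+ 2 <= tau N ^+ 2.
  by move=> hz; rewrite -(real_normK (num_real z)) lerXn2r// nnegrE.
by have := sq _ h1; have := sq _ h2; lra.
Qed.

Let cmeas_V : cmeas V.
Proof.
split.
  apply: (@measurable_fun_cvg _ _ _ _ (fun N x => complex.Re (partial N x))).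
    by move=> N; have /L2TP[[]] := L2T_partial N.
  move=> x _; under eq_fun do rewrite Re_partial.
  by have [] := weierstrass_M psi_cvg (Re_bound x).
apply: (@measurable_fun_cvg _ _ _ _ (fun N x => complex.Im (partial N x))).
  by move=> N; have /L2TP[[]] := L2T_partial N.
move=> x _; under eq_fun do rewrite Im_partial.
by have [] := weierstrass_M psi_cvg (Im_bound x).
Qed.

Let L2T_diff N : L2T (L2sub V (partial N)).
Proof.
apply: (@L2T_bounded _ _ (2 * tau N ^+ 2)); last by move=> x _; exact: V_partial.
have -> : L2sub V (partial N) = (fun x => V x + -1 * partial N x).
  by apply/funext => x; rewrite mulN1r.
apply: cmeasD => //; apply: cmeasM; first exact: cmeas_cst.
by have /L2TP[] := L2T_partial N.
Qed.

Let L2T_V : L2T V.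
Proof.
have := L2TD (L2T_diff 0) (L2T_partial 0); congr L2T.
by apply/funext => x; rewrite /L2sub subrK.
Qed.

Let tau_cvg : tau N @[N --> \oo] --> (0 : R).
Proof. exact: series_tail_cvg0. Qed.

Let fourier_partial N l : (`|l| < N)%N -> fourier (partial N) l = a l.
Proof.
move=> lN; rewrite fourier_sum//.
have E n : fourier (term n) l = (if Posz n == l then a (Posz n) else 0) +
                                (if Negz n == l then a (Negz n) else 0).
  rewrite fourierD; [|by apply: L2TZ; exact: L2T_basis..].
  rewrite !(fourierZ (a _)); [|exact: L2T_basis..].
  rewrite !fourier_basis.
  by congr (_ + _); case: ifP => _; apply: complex_ext; rewrite ?ReM ?ImM/=; ring.
under eq_bigr do rewrite E.
case: l lN {E} => n nN.
  rewrite (bigD1 (Ordinal nN))//= eqxx addr0 big1 ?addr0// => i /negbTE iN.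
  rewrite addr0; case: ifP => // /eqP[] h.
  by move: iN; rewrite -val_eqE/= h eqxx.
have nN' : (n < N)%N by exact: ltnW.
rewrite (bigD1 (Ordinal nN'))//= eqxx add0r big1 ?addr0// => i /negbTE iN.
rewrite add0r; case: ifP => // /eqP[] h.
by move: iN; rewrite -val_eqE/= h eqxx.
Qed.

Let fourier_diff_le (w : R -> C) K l : L2T w -> 0 <= K -> (forall x, torus x -> sqabs (w x) <= K) ->
  sqabs (fourier w l) <= 2 * (K * (2 * pi)).
Proof.
move=> hw K0 hK; rewrite -lee_fin; apply: le_trans (fourier_bound l hw) _.
rewrite EFinM; apply: lee_wpmul2l; first by rewrite lee_fin.
rewrite -integral_torus_cst; apply: ge0_le_integral_lower => x tx.
  by rewrite lee_fin sqabs_ge0.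
by rewrite lee_fin hK.
Qed.

Let tau2_cvg (c : R) : (c * tau N ^+ 2) @[N --> \oo] --> (0 : R).
Proof.
rewrite -[X in _ --> X](mulr0 c) -[X in _ * X](mulr0 (0 : R)).
by apply: cvgM; [exact: cvg_cst|under eq_fun do rewrite expr2; exact: cvgM].
Qed.

Let fourier_V l : fourier V l = a l.
Proof.
apply/eqP; rewrite -subr_eq0; apply/eqP.
suff h : sqabs (fourier V l - a l) <= 0.
  have h0 : sqabs (fourier V l - a l) = 0.
    by apply/eqP; rewrite eq_le h sqabs_ge0.
  move/eqP: h0; rewrite /sqabs paddr_eq0 ?sqr_ge0// !sqrf_eq0 => /andP[/eqP h1 /eqP h2].
  exact: complex_ext.
apply: ler_cvg_to (cvg_cst _) (tau2_cvg (2 * (2 * (2 * pi)))) _; near=> N.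
have lN : (`|l| < N)%N by near: N; exact: nbhs_infty_gt.
rewrite -(fourier_partial lN) -fourierB//.
have -> : 2 * (2 * (2 * pi)) * tau N ^+ 2 = 2 * (2 * tau N ^+ 2 * (2 * pi)).
  by move: (pi : R) => p; ring.
apply: fourier_diff_le => //; first by rewrite mulr_ge0// sqr_ge0.
by move=> x _; exact: V_partial.
Unshelve. all: by end_near. Qed.

(** Uniform convergence gives [V] the coefficients of Phi, and [fourier_inj] applies to the
    difference. *)
Let PhiV : {ae mu, forall x, torus x -> PhiC x = V x}.
Proof.
have hP : L2T PhiC by case: hPhi.
have := fourier_inj (L2TB hP L2T_V).
move=> /(_ _)/(ae_mono2 (ae_lebesgue_neq 0)); apply => [l|x _ + tx].
  by rewrite fourierB// fourier_V subrr.
by move=> /(_ tx)/eqP; rewrite /L2sub subr_eq0 => /eqP.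
Qed.

(* The Fourier series of Phi converges uniformly, so the coefficients of a
   product are controlled by a convolution. *)
Lemma fourier_mul_bound (u : R -> C) l : L2T u -> L2T (fun x => PhiC x * u x) ->
  ((cabs (fourier (fun x => PhiC x * u x) l))%:E <=
   conv phi_coef (fun m => cabs (fourier u m)) l)%E.
Proof.
move=> hu hPu; have /L2TP[mu' Iu] := hu; have /L2TP[mPu _] := hPu.
pose n2 := fine (L2norm2 u).
have n2E : L2norm2 u = n2%:E by rewrite fineK// ge0_fin_numE// L2norm2_ge0.
have n20 : 0 <= n2 by rewrite fine_ge0// L2norm2_ge0.
have hVu N : L2T (fun x => (V x - partial N x) * u x).
  under eq_fun do rewrite mulrC.
  have /L2TP[mD _] := L2T_diff N.
  by apply: (@L2T_mul_bounded _ _ _ (2 * tau N ^+ 2)) => // x _; exact: V_partial.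
have hbu k : L2T (fun x => Defs.basis k x * u x).
  under eq_fun do rewrite mulrC.
  apply: (@L2T_mul_bounded _ _ _ (c0 ^+ 2)) => //; first by have /L2TP[] := @L2T_basis R k.
  by move=> x _; rewrite -sqr_cabs cabs_basis.
have hpu N : L2T (fun x => partial N x * u x).
  have -> : (fun x => partial N x * u x) = (fun x => \sum_(n < N)
     (a (Posz n) * (Defs.basis (Posz n) x * u x) + a (Negz n) * (Defs.basis (Negz n) x * u x))).
    apply/funext => x; rewrite mulr_suml; apply: eq_bigr => n _.
    by rewrite /term mulrDl !mulrA.
  by apply: L2T_sum => n; apply: L2TD; exact: L2TZ.
have Fb k : fourier (fun x => Defs.basis k x * u x) l = realC c0 * fourier u (l - k).
  rewrite -fourierZ// /fourier; congr (_ * _); apply: eq_integralC => x _.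
  have -> : expi (- ((l - k)%:~R * x)) = expi (k%:~R * x) * expi (- (l%:~R * x)).
    by rewrite -expiD intrB; congr expi; ring.
  by rewrite /Defs.basis -/c0; ring.
have Fp N : fourier (fun x => partial N x * u x) l = \sum_(n < N)
    (a (Posz n) * (realC c0 * fourier u (l - Posz n)) + a (Negz n) * (realC c0 * fourier u (l - Negz n))).
  have -> : (fun x => partial N x * u x) = (fun x => \sum_(n < N)
     (a (Posz n) * (Defs.basis (Posz n) x * u x) + a (Negz n) * (Defs.basis (Negz n) x * u x))).
    apply/funext => x; rewrite mulr_suml; apply: eq_bigr => n _.
    by rewrite /term mulrDl !mulrA.
  rewrite fourier_sum; last by move=> n; apply: L2TD; exact: L2TZ.
  apply: eq_bigr => n _; rewrite fourierD; [|exact: L2TZ..].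
  by rewrite !(fourierZ (a _))// !Fb.
(* The remainder has a coefficient that vanishes as N grows, by uniform convergence; the other term
   is a finite sum of shifted coefficients of u. *)
have FV N : fourier (fun x => PhiC x * u x) l =
    fourier (fun x => (V x - partial N x) * u x) l + fourier (fun x => partial N x * u x) l.
  rewrite -fourierD//; apply: L2eq_fourier => //.
    by apply: cmeasD; [have /L2TP[] := hVu N|have /L2TP[] := hpu N].
  apply: ae_mono2 PhiV PhiV _ => x h _ tx.
  by rewrite h// -mulrDl subrK.
have B2 N : sqabs (fourier (fun x => (V x - partial N x) * u x) l) <= 2 * (2 * n2) * tau N ^+ 2.
  rewrite -lee_fin; apply: le_trans (fourier_bound l (hVu N)) _.
  have -> : 2 * (2 * n2) * tau N ^+ 2 = 2 * ((2 * tau N ^+ 2) * n2) by ring.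
  have t0 : 0 <= 2 * tau N ^+ 2 by apply: mulr_ge0 => //; exact: sqr_ge0.
  rewrite EFinM; apply: lee_wpmul2l; first by rewrite lee_fin.
  apply: (@le_trans _ _ (L2norm2 (fun x => realC (Num.sqrt (2 * tau N ^+ 2)) * u x))).
    apply: L2norm2_le => x tx; rewrite !sqabsM; apply: ler_wpM2r; first exact: sqabs_ge0.
    by rewrite sqabs_realC (sqr_sqrtr t0); exact: V_partial.
  by rewrite (L2norm2Z _ mu') n2E sqabs_realC (sqr_sqrtr t0).
have B1 N : cabs (fourier (fun x => PhiC x * u x) l) <=
    cabs (fourier (fun x => (V x - partial N x) * u x) l) +
    \sum_(n < N) (phi_coef (Posz n) * cabs (fourier u (l - Posz n)) +
                  phi_coef (Negz n) * cabs (fourier u (l - Negz n))).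
  rewrite (FV N); apply: le_trans (cabsD _ _) _; rewrite lerD2l Fp.
  apply: le_trans (cabs_sum _ _) _.
  apply: ler_sum => n _; apply: le_trans (cabsD _ _) _.
  have E k : cabs (a k * (realC c0 * fourier u (l - k))) = phi_coef k * cabs (fourier u (l - k)).
    rewrite (cabsM (a k) (realC c0 * fourier u (l - k))).
    rewrite (cabsM (realC c0) (fourier u (l - k))) cabs_realC (ger0_norm c0_ge0).
    by rewrite /phi_coef mulrCA mulrA.
  by rewrite !E.
clear hVu hbu hpu Fb Fp FV n2E mPu mu'.
pose F m := (phi_coef m * cabs (fourier u (l - m)))%:E.
have F0 m : (0 <= F m)%E.
  by rewrite lee_fin; apply: mulr_ge0; [exact: phi_coef_ge0|exact: cabs_ge0].
have convE : conv phi_coef (fun m => cabs (fourier u m)) l = (\esum_(m in [set: int]) F m)%E.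
  rewrite -(esum_bij F (sub_revK l) (sub_revK l)) /F; apply: eq_esum => m _.
  by rewrite (sub_revK l m).
have B3 N : ((\sum_(n < N) (phi_coef (Posz n) * cabs (fourier u (l - Posz n)) +
                  phi_coef (Negz n) * cabs (fourier u (l - Negz n))))%:E <=
    \esum_(m in [set: int]) F m)%E.
  by apply: le_trans (esum_int_ge N F0); rewrite -sumEFin.
have E0 : (0 <= \esum_(m in [set: int]) F m)%E by apply: esum_ge0 => m _; exact: F0.
rewrite convE; move: E0 B3; move: (\esum_(m in [set: int]) F m)%E => E E0 B3.
clear F F0 convE.
case: E E0 B3 => [E| |] E0 B3; last by []; last exact: leey.
rewrite lee_fin; apply/ler_addgt0Pl => e e0.
have /cvgrPdist_lt/(_ _ (exprn_gt0 2 e0)) hN := tau2_cvg (2 * (2 * n2)).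
near \oo => N.
have small : 2 * (2 * n2) * tau N ^+ 2 <= e ^+ 2.
  have : `|0 - 2 * (2 * n2) * tau N ^+ 2| < e ^+ 2 by near: N.
  by rewrite sub0r normrN => /ltW/(le_trans (ler_norm _)).
apply: le_trans (B1 N) _; apply: lerD; last by have := B3 N; rewrite lee_fin.
rewrite cabs_le; last exact: ltW.
exact: le_trans (B2 N) small.
Unshelve. all: by end_near. Qed.

End product_bound.

(** * Fourier coefficients of vector-valued integrals *)

Section step_functions.
Variable R : realType.
Notation C := (complex R).
Notation mu := (@lebesgue_measure R).
Implicit Types (f : step_fun R) (t s : R) (l : int) (z : C).

Lemma cabs_fourier_le (w : R -> C) l : L2T w ->
  ((cabs (fourier w l))%:E <= 2%:E * L2norm w)%E.
Proof.
move=> hw; have /L2TP[_ Iw] := hw; have h0 := L2norm2_ge0 w.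
have := fourier_bound l hw; rewrite /L2norm; move: (L2norm2 w) h0 Iw => [r| |]// r0 _.
rewrite lee_fin in r0; rewrite /= -!EFinM !lee_fin => h.
rewrite cabs_le ?mulr_ge0 ?sqrtr_ge0// exprMn sqr_sqrtr//.
by apply: le_trans h _; rewrite ler_wpM2r// expr2; lra.
Qed.

Lemma L2norm_ge0 (w : R -> C) : (0 <= L2norm w)%E.
Proof. exact: sqrte_ge0. Qed.

Section step.
Variables (t : R) (f : step_fun R).
Hypothesis hf : is_step_fun t f.

Let n := step_size f.
Let node := step_node f.

Lemma node_le i j : (i <= j)%N -> (j <= n)%N -> node i <= node j.
Proof.
move=> ij jn; have [_ _ h _] := hf.
elim: j ij jn => [|j ih]; first by rewrite leqn0 => /eqP->.
rewrite leq_eqVlt => /orP[/eqP->//|]; rewrite ltnS => ij jn.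
by apply: le_trans (ih ij (ltnW jn)) _; exact: h.
Qed.

Lemma node_ge0 i : (i <= n)%N -> 0 <= node i.
Proof. by move=> jn; have [h _ _ _] := hf; apply: le_trans h _; exact: node_le. Qed.

Lemma node_le_t i : (i <= n)%N -> node i <= t.
Proof. by move=> jn; have [_ h _ _] := hf; apply: le_trans h; exact: node_le. Qed.

Lemma L2T_coef (k : 'I_n) : L2T (step_coef f k).
Proof. by case: hf => _ _ _; apply; exact: ltn_ord. Qed.

Lemma L2T_step_val s : L2T (step_val f s).
Proof.
apply: L2T_sum => k; case: (_ && _); first exact: L2T_coef.
exact: L2T0.
Qed.

Lemma fourier_step_val s l : fourier (step_val f s) l =
  \sum_(k < n) (if (node k < s) && (s <= node k.+1) then fourier (step_coef f k) l else 0).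
Proof.
rewrite fourier_sum => [|k]; last first.
  by case: (_ && _); [exact: L2T_coef|exact: L2T0].
by apply: eq_bigr => k _; case: (_ && _) => //; exact: fourier0.
Qed.

Lemma L2T_step_integral (m : R -> R) : L2T (step_integral f m).
Proof. by apply: L2T_sum => k; apply: L2TZ; exact: L2T_coef. Qed.

Lemma fourier_step_integral (m : R -> R) l : fourier (step_integral f m) l =
  \sum_(k < n) realC (m (node k.+1) - m (node k)) * fourier (step_coef f k) l.
Proof.
rewrite fourier_sum => [|k]; last by apply: L2TZ; exact: L2T_coef.
by apply: eq_bigr => k _; rewrite fourierZ//; exact: L2T_coef.
Qed.

Lemma indic_node (k : 'I_n) s :
  \1_(oc0 (node k.+1)) s - \1_(oc0 (node k)) s =
  ((node k < s) && (s <= node k.+1))%:R :> R.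
Proof.
have h0 : 0 <= node k by apply: node_ge0; exact: ltnW.
have h1 : node k <= node k.+1 by exact: node_le.
rewrite !indicE /oc0 !mem_setE !in_itv/=.
case: (leP s (node k)) => h2.
  by rewrite (le_trans h2 h1) !andbT subrr.
by rewrite (le_lt_trans h0 h2)/= subr0.
Qed.

Lemma node_interval_inj (i j : 'I_n) s : node i < s -> s <= node i.+1 ->
  node j < s -> s <= node j.+1 -> i = j.
Proof.
have h (k m : 'I_n) : s <= node k.+1 -> node m < s -> (m <= k)%N.
  move=> k2 m1; rewrite leqNgt; apply/negP => km.
  have := node_le km (ltnW (ltn_ord m)).
  by move=> /(le_trans k2); rewrite leNgt m1.
by move=> i1 i2 j1 j2; apply/val_inj/eqP; rewrite eqn_leq !h.
Qed.

(** At each s at most one interval is active, so the modulus passes through the sum. *)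
Lemma sum_cabs_step s l :
  \sum_(k < n) cabs (fourier (step_coef f k) l) *
    (\1_(oc0 (node k.+1)) s - \1_(oc0 (node k)) s) = cabs (fourier (step_val f s) l).
Proof.
rewrite fourier_step_val; under eq_bigr do rewrite indic_node.
pose c (i : 'I_n) := (node i < s) && (s <= node i.+1).
have [[k kc]|h] := pselect (exists k, c k).
  have ck i : i != k -> c i = false.
    move=> ik; apply/negP => /andP[i1 i2]; case/andP: kc => k1 k2.
    by rewrite (node_interval_inj i1 i2 k1 k2) eqxx in ik.
  have -> : \sum_(i < n) cabs (fourier (step_coef f i) l) * (c i)%:R = cabs (fourier (step_coef f k) l).
    rewrite (bigD1 k)//= kc mulr1 big1 ?addr0// => i ik.
    by rewrite (ck _ ik) mulr0.
  congr cabs; rewrite (bigD1 k)//= -/(c k) kc big1 ?addr0// => i ik.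
  by rewrite -/(c i) (ck _ ik).
have ck i : c i = false by apply/negP => hi; case: h; exists i.
have -> : \sum_(i < n) cabs (fourier (step_coef f i) l) * (c i)%:R = 0.
  by rewrite big1// => i _; rewrite ck mulr0.
by rewrite big1 ?cabs0// => i _; rewrite -/(c i) ck.
Qed.

Lemma measurable_cabs_step l :
  measurable_fun setT (fun s => cabs (fourier (step_val f s) l)).
Proof.
rewrite (_ : (fun s => _) = (fun s => \sum_(k < n) cabs (fourier (step_coef f k) l) *
    (\1_(oc0 (node k.+1)) s - \1_(oc0 (node k)) s))); last first.
  by apply/funext => s; rewrite sum_cabs_step.
apply: measurable_sum => k; apply: measurable_funM; first exact: measurable_cst.
by apply: measurable_funB; apply: measurable_indic; exact: measurable_oc0.
Qed.

Lemma cabs_fourier_step_integral_le l :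
  ((cabs (fourier (step_integral f id) l))%:E <=
   \int[mu]_(s in `[0%R, t]) (cabs (fourier (step_val f s) l))%:E)%E.
Proof.
rewrite fourier_step_integral.
pose g (k : 'I_n) s := cabs (fourier (step_coef f k) l) * ((node k < s) && (s <= node k.+1))%:R.
have mI a b : measurable [set s | (a < s) && (s <= b :> R)].
  by have := @measurable_itv R `]a, b]; congr measurable; apply/seteqP; split => s /=; rewrite in_itv.
have mg k : measurable_fun setT (g k).
  apply: measurable_funM; first exact: measurable_cst.
  rewrite (_ : (fun x => _) = \1_([set s | (node k < s) && (s <= node k.+1)])); last first.
    by apply/funext => s; rewrite indicE mem_setE.
  by apply: measurable_indic; exact: mI.
have g0 k s : 0 <= g k s by rewrite mulr_ge0 ?cabs_ge0.
have E s : cabs (fourier (step_val f s) l) = \sum_(k < n) g k s.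
  by rewrite -sum_cabs_step; apply: eq_bigr => k _; rewrite indic_node.
under eq_integral do rewrite E -sumEFin.
have mg' k : measurable_fun `[0, t] (fun s => (g k s)%:E).
  by apply/measurable_EFinP; apply: measurable_funTS; exact: mg.
have g0' k s : `[0, t]%classic s -> (0 <= (g k s)%:E)%E by rewrite lee_fin.
rewrite ge0_integral_sum//.
apply: le_trans (_ : ((\sum_(k < n) (node k.+1 - node k) * cabs (fourier (step_coef f k) l))%:E <= _)%E).
  rewrite lee_fin; apply: le_trans (cabs_sum _ _) _; apply: ler_sum => k _.
  rewrite (cabsM (realC _)) cabs_realC ger0_norm// subr_ge0; apply: node_le => //.
rewrite -sumEFin; apply: lee_sum => k _.
rewrite /g; under eq_integral do rewrite EFinM.
have mi : measurable_fun `[0, t] (fun s => (((node k < s) && (s <= node k.+1))%:R : R)%:E).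
  apply/measurable_EFinP; apply: measurable_funTS.
  rewrite (_ : (fun x => _) = \1_([set s | (node k < s) && (s <= node k.+1)])); last first.
    by apply/funext => s; rewrite indicE mem_setE.
  by apply: measurable_indic; exact: mI.
have c0 : (0 <= (cabs (fourier (step_coef f k) l))%:E)%E by rewrite lee_fin cabs_ge0.
rewrite ge0_integralZl//.
rewrite mulrC EFinM; apply: lee_wpmul2l; first by rewrite lee_fin cabs_ge0.
rewrite (_ : (fun x => _) = (fun x => (\1_([set s | (node k < s) && (s <= node k.+1)]) x)%:E)); last first.
  by apply/funext => s; rewrite indicE mem_setE.
rewrite integral_indic//.
have -> : [set s | (node k < s) && (s <= node k.+1)] `&` `[0, t] = `]node k, node k.+1]%classic.
  apply/seteqP; split => s /=; rewrite !in_itv/=; first by case.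
  move=> /andP[h1 h2]; rewrite h1 h2; split=> //.
  rewrite (le_trans (node_ge0 _) (ltW h1)) ?(le_trans h2 (node_le_t _))//; exact: ltnW.
rewrite [leRHS](lebesgue_measure_itv `]node k, node k.+1])/= lte_fin; case: ltP => // h.
by rewrite lee_fin subr_le0.
exact: mI.
Qed.

End step.

(** The coefficient of f(s) is not itself integrated. The step functions are measurable in s and
    exceed the majorant [h] by at most twice their L^2 distance to f(s), whose integral tends to
    0. *)
Lemma bochner_fourier_bound t (f : R -> R -> C) (D : R -> C) (h : R -> R) l :
  bochner_integral t f D -> measurable_fun setT h -> (forall s, 0 <= h s) ->
  (forall s, s \in `[0, t] -> cabs (fourier (f s) l) <= h s) ->
  ((cabs (fourier D l))%:E <= \int[mu]_(s in `[0%R, t]) (h s)%:E)%E.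
Proof.
move=> [hf hD [fn [hfn _ cb] ca]] mh h0 fh.
apply/lee_addgt0Pr => e e0.
have e4 : 0 < e / 4 by rewrite divr_gt0.
have nE (u : nat -> \bar R) : (forall n, (0 <= u n)%E) -> u n @[n --> \oo] --> 0%E ->
    \forall n \near \oo, (u n < (e / 4)%:E)%E.
  move=> u0 cu; apply: (cu [set x | (x < (e / 4)%:E)%E]).
  by apply: open_ereal_lt'; rewrite lte_fin.
have L0 (w : R -> C) : (0 <= L2norm w)%E by exact: L2norm_ge0.
near \oo => n.
have an : (L2norm (L2sub D (step_integral (fn n) id)) < (e / 4)%:E)%E.
  by near: n; apply: nE.
have bn : (\int[mu]_(s in `[0%R, t]) L2norm (L2sub (f s) (step_val (fn n) s)) ^+ 1 < (e / 4)%:E)%E.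
  near: n; apply: nE => // m; apply: integral_ge0 => s _.
  exact: L0.
have hn := hfn n.
(* One half of e pays for replacing [D] by the step integral, the other for replacing f by the step
   function; the factors 2 come from [cabs_fourier_le]. *)
have -> : (e = e / 4 * 2 + e / 4 * 2)%R by field.
have hT := L2T_step_integral hn id.
have -> : fourier D l = fourier (L2sub D (step_integral (fn n) id)) l + fourier (step_integral (fn n) id) l.
  by rewrite fourierB// subrK.
apply: (@le_trans _ _ ((cabs (fourier (L2sub D (step_integral (fn n) id)) l))%:E +
   (cabs (fourier (step_integral (fn n) id) l))%:E))%E.
  by rewrite -EFinD lee_fin cabsD.
rewrite [leLHS]addeC EFinD addeA; apply: leeD; last first.
  apply: le_trans (cabs_fourier_le l (L2TB hD hT)) _.
  by rewrite mulrC EFinM; apply: lee_wpmul2l => //; exact: ltW.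
apply: le_trans (cabs_fourier_step_integral_le hn l) _.
pose phi s := cabs (fourier (step_val (fn n) s) l).
(* [G] is the excess of the step function over the majorant; it is measurable, unlike possibly its
   bound, the L^2 distance. *)
pose G s := Num.max 0 (phi s - h s).
have mphi : measurable_fun setT phi by exact: (measurable_cabs_step hn l).
have mG : measurable_fun setT G.
  by apply: measurable_maxr; [exact: measurable_cst|exact: measurable_funB].
have mh' : measurable_fun `[0, t] (fun s => (h s)%:E).
  by apply/measurable_EFinP; exact: measurable_funTS.
have mG' : measurable_fun `[0, t] (fun s => (G s)%:E).
  by apply/measurable_EFinP; exact: measurable_funTS.
have G0 s : (0 <= (G s)%:E)%E by rewrite lee_fin le_max lexx.
apply: (@le_trans _ _ (\int[mu]_(s in `[0%R, t]) ((h s)%:E + (G s)%:E)))%E.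
  apply: ge0_le_integral_lower => s _; first by rewrite lee_fin cabs_ge0.
  by rewrite -EFinD lee_fin -/(phi s) /G; case: (leP 0 (phi s - h s)); lra.
have h0' s : (0 <= (h s)%:E)%E by rewrite lee_fin.
rewrite ge0_integralD//; apply: leeD => //.
(* Halving [G] moves the factor 2 to the side known to be measurable. *)
apply: (@le_trans _ _ (2%:E * \int[mu]_(s in `[0%R, t]) ((2^-1)%:E * (G s)%:E)))%E.
  have c0 : (0 <= (2^-1 : R)%:E)%E by rewrite lee_fin invr_ge0.
  by rewrite ge0_integralZl// muleA -EFinM divff// mul1e.
rewrite mulrC EFinM; apply: lee_wpmul2l => //.
apply: le_trans (ltW bn); apply: ge0_le_integral_lower => s st.
  by rewrite mule_ge0// lee_fin invr_ge0.
have /(fh s) fs : s \in `[0, t] by rewrite inE in st *.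
have hs : L2T (f s) by apply: hf; rewrite inE in st *.
have hv := L2T_step_val hn s.
rewrite /G; case: (leP 0 (phi s - h s)) => hp; last by rewrite mule0 L0.
apply: (@le_trans _ _ (2^-1%:E * (2%:E * L2norm (L2sub (f s) (step_val (fn n) s)))))%E; last first.
  by rewrite muleA -EFinM mulVf// mul1e.
apply: lee_wpmul2l; first by rewrite lee_fin invr_ge0.
apply: le_trans (cabs_fourier_le l (L2TB hs hv)); rewrite lee_fin fourierB//.
rewrite lerBlDr; apply: le_trans (lerD (lexx _) fs).
rewrite /phi -(cabsN (_ - _)) opprB.
by apply: le_trans (cabsD _ _); rewrite subrK.
Unshelve. all: by end_near. Qed.

End step_functions.

(** * Fourier coefficients of stochastic integrals *)

Section functional.
Variables (R : realType) (d : measure_display) (Omega : measurableType d).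
Notation C := (complex R).
Variables (z : C) (l : int).
Hypothesis z1 : sqabs z = 1.

(** A real functional, so that the theory of real Wiener integrals applies. The unimodular z selects
    the real part (z = 1) or the imaginary part (z = -i), and can absorb a phase. *)
Definition coord (w : R -> C) : R := complex.Re (z * fourier w l).

Lemma sqr_coord_le_sqabs w : coord w ^+ 2 <= sqabs (fourier w l).
Proof.
have -> : sqabs (fourier w l) = sqabs (z * fourier w l) by rewrite sqabsM z1 mul1r.
by rewrite lerDl sqr_ge0.
Qed.

Lemma sqr_coord_le w : L2T w -> ((coord w ^+ 2)%:E <= 2%:E * L2norm2 w)%E.
Proof.
move=> hw; apply: le_trans (fourier_bound l hw).
by rewrite lee_fin sqr_coord_le_sqabs.
Qed.

Lemma coordB w v : L2T w -> L2T v -> coord (L2sub w v) = coord w - coord v.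
Proof. by move=> hw hv; rewrite /coord fourierB// mulrBr ReD ReN. Qed.

Lemma coord_sum n (w : 'I_n -> R -> C) : (forall i, L2T (w i)) ->
  coord (fun x => \sum_(i < n) w i x) = \sum_(i < n) coord (w i).
Proof. by move=> hw; rewrite /coord fourier_sum// mulr_sumr Re_sum. Qed.

(** Continuity of [coord] for the L^2 norm, in the form that transfers measurability from L^2-valued
    variables to their coordinates. *)
Lemma L2open_coord (a : R) : L2open [set v | a < coord v].
Proof.
move=> w hw /= aw; exists ((coord w - a) / 2); first by rewrite divr_gt0// subr_gt0.
move=> v hv hvw; rewrite -subr_gt0.
have h : `|coord (L2sub v w)| < coord w - a.
  rewrite -lte_fin; apply: (@le_lt_trans _ _ (cabs (fourier (L2sub v w) l))%:E).
    rewrite lee_fin -ler_sqr ?nnegrE ?cabs_ge0// sqr_cabs real_normK ?num_real//.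
    exact: sqr_coord_le_sqabs.
  apply: le_lt_trans (cabs_fourier_le l (L2TB hv hw)) _.
  have -> : (coord w - a) = 2 * ((coord w - a) / 2) by field.
  by rewrite EFinM lte_pmul2l.
by move: h; rewrite coordB// ltr_norml => /andP[]; lra.
Qed.

Lemma measurable_coord (X : Omega -> R -> C) : L2rv measurable X ->
  measurable_fun setT (fun w => coord (X w)).
Proof.
move=> [_ hX] mD; apply: (measurability _ (RGenOInfty.measurableE R)) => //.
move=> _ [_ [a ->] <-]; rewrite setTI.
have -> : (fun w => coord (X w)) @^-1` `]a, +oo[%classic = X @^-1` [set v | a < coord v].
  by apply/seteqP; split => w /=; rewrite in_itv/= andbT.
by apply: hX; exact: L2open_coord.
Qed.

(** Each interval ]a, b] with value c is written as c on ]0, b] minus c on ]0, a], hence two entries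
    per step. *)
Definition step_list (f : step_fun R) : seq (R * R) :=
  [seq (complex.Re (z * fourier (step_coef f k) l), step_node f k.+1) | k <- index_iota 0 (step_size f)] ++
  [seq (- complex.Re (z * fourier (step_coef f k) l), step_node f k) | k <- index_iota 0 (step_size f)].

Section step_list.
Variables (t : R) (f : step_fun R).
Hypothesis hf : is_step_fun t f.

Lemma step_list_sum (m : R -> R) :
  \sum_(p <- step_list f) p.1 * m p.2 = coord (step_integral f m).
Proof.
rewrite /coord (fourier_step_integral hf) big_cat !big_map !big_mkord /= -big_split/=.
rewrite mulr_sumr Re_sum; apply: eq_bigr => k _.
move: (fourier _ l) (m _) (m _) => a c e; rewrite (ReM z (_ * _)) ReM ImM ReM /=.
move: (complex.Re z) (complex.Im z) (complex.Re a) (complex.Im a) => x y v w; ring.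
Qed.

Lemma step_list_node p : p \in step_list f -> 0 <= p.2 <= t.
Proof.
rewrite mem_cat => /orP[] /mapP[k]; rewrite mem_index_iota => /= kn -> /=.
  by rewrite (node_ge0 hf)// (node_le_t hf).
by rewrite (node_ge0 hf) ?(node_le_t hf)// ltnW.
Qed.

Lemma step_of_step_list s : step_of (step_list f) s = coord (step_val f s).
Proof.
rewrite /step_of (step_list_sum (fun r => \1_(oc0 r) s)) /coord.
rewrite (fourier_step_integral hf) (fourier_step_val hf); congr (complex.Re (z * _)).
apply: eq_bigr => k _; rewrite (indic_node hf).
by case: (_ && _); [rewrite mul1r|rewrite mul0r].
Qed.

Lemma wiener_step_list (b : R -> Omega -> R) w :
  wiener b (step_list f) w = coord (step_integral f (fun s => b s w)).
Proof.
rewrite -step_list_sum; apply: eq_big_seq => p /step_list_node/andP[p0 _].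
by rewrite (max_idPr p0).
Qed.

Lemma step_of_step_list_out s : ~ oc0 t s -> step_of (step_list f) s = 0.
Proof.
move=> hs; apply: big1_seq => p /andP[_ /step_list_node/andP[p0 pt]].
rewrite indicE memNset ?mulr0// => h; apply: hs; move: h; rewrite /oc0 /= !in_itv/=.
by move=> /andP[-> /le_trans]; apply.
Qed.

End step_list.
End functional.

Lemma near_lt0 (R : realType) (I : Type) (G : set_system I) (u : I -> \bar R) (e : R) :
  0 < e -> u n @[n --> G] --> 0%E -> \forall n \near G, (u n < e%:E)%E.
Proof.
move=> e0 cu; apply: (cu [set x | (x < e%:E)%E]).
by apply: open_ereal_lt'; rewrite lte_fin.
Qed.

Lemma sqint_eq0 d (T : measurableType d) (R : realType) (mu : {measure set T -> \bar R})
    (f : T -> R) : measurable_fun setT f -> (\int[mu]_x (f x ^+ 2)%:E <= 0)%E ->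
  {ae mu, forall x, f x = 0}.
Proof.
move=> mf hf; have h : (\int[mu]_x `|(f x ^+ 2)%:E| = 0)%E.
  apply/eqP; rewrite eq_le integral_ge0// andbT.
  by under eq_integral do rewrite gee0_abs ?lee_fin ?sqr_ge0//.
have /ae_eq_integral_abs : measurable_fun setT (fun x => (f x ^+ 2)%:E).
  by apply/measurable_EFinP; exact: measurable_funX.
move=> /(_ mu measurableT)[/(_ h) + _]; apply: filterS => x /= /(_ I).
by move=> [/eqP]; rewrite sqrf_eq0 => /eqP.
Qed.

(** In the uses [g] is a squared L^2 norm whose measurability is not known, so the factor 2 is moved
    to the side of [f] before integrals are compared. *)
Lemma integral_sqr_le2 d (T : measurableType d) (R : realType) (mu : {measure set T -> \bar R})
    (f : T -> R) (g : T -> \bar R) (e : R) : measurable_fun setT f ->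
  (forall x, ((f x ^+ 2)%:E <= 2%:E * g x)%E) -> (\int[mu]_x g x <= (e / 2)%:E)%E ->
  (\int[mu]_x (f x ^+ 2)%:E <= e%:E)%E.
Proof.
move=> mf fg ge; rewrite (_ : e%:E = 2%:E * (e / 2)%:E)%E; last first.
  by rewrite -EFinM; congr EFin; field.
have m2 : measurable_fun setT (fun s => (2^-1 * f s ^+ 2)%:E).
  apply/measurable_EFinP; apply: measurable_funM; first exact: measurable_cst.
  exact: measurable_funX.
have EE s : ((f s ^+ 2)%:E = 2%:E * (2^-1 * f s ^+ 2)%:E)%E.
  by rewrite -EFinM mulrA divff// mul1r.
under eq_integral do rewrite EE.
have p0 s : setT s -> (0 <= (2^-1 * f s ^+ 2)%:E)%E.
  by rewrite lee_fin mulr_ge0 ?sqr_ge0.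
rewrite ge0_integralZl//; apply: lee_wpmul2l => //.
apply: le_trans ge; apply: ge0_le_integral_lower => s _; first exact: p0.
rewrite EFinM; apply: (@le_trans _ _ (2^-1%:E * (2%:E * g s)))%E.
  by apply: lee_wpmul2l => //; rewrite lee_fin invr_ge0.
by rewrite muleA -EFinM mulVf// mul1e.
Qed.

Section wiener_coord.
Variables (R : realType) (d : measure_display) (Omega : measurableType d).
Variable P : probability Omega R.
Notation C := (complex R).
Notation mu := (@lebesgue_measure R).
Variables (z : C) (l : int).
Hypothesis z1 : sqabs z = 1.

(** Applying [coord] to the L^2-valued step functions yields real step lists. Their distance to
    kappa and the distance of their Wiener sums to the integral are controlled by the corresponding
    L^2 distances. *)
Lemma wiener_integral_limit (b : R -> Omega -> R) t (g : R -> R -> C) I (kappa : R -> R) :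
  (forall s, 0 <= s -> measurable_fun setT (b s)) ->
  wiener_integral P b t g I -> measurable_fun setT kappa ->
  (forall s, s \in `[0, t] -> kappa s = coord z l (g s)) ->
  wiener_limit P b kappa t (fun w => coord z l (I w)).
Proof.
move=> mb [hg hI [fn [hfn _ cg] cI]] mk kg; split; first exact: measurable_coord.
move=> e e0; have e2 : 0 < e / 2 by rewrite divr_gt0.
near \oo => n.
have an : (\int[mu]_(s in `[0%R, t]) L2norm (L2sub (g s) (step_val (fn n) s)) ^+ 2 < (e / 2)%:E)%E.
  by near: n; exact: near_lt0.
have bn : (\int[P]_w L2norm2 (L2sub (I w) (step_integral (fn n) (fun s => b s w))) < (e / 2)%:E)%E.
  by near: n; exact: near_lt0.
have hn := hfn n; have [hIL _] := hI.
exists (step_list z l (fn n)); split.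
  pose h s := step_of (step_list z l (fn n)) s - \1_(oc0 t) s * kappa s.
  have mh : measurable_fun setT h.
    apply: measurable_funB; first by have [] := sqint_step_of (step_list z l (fn n)).
    by apply: measurable_funM => //; apply: measurable_indic; exact: measurable_oc0.
  have hle : (\int[mu]_s (h s ^+ 2)%:E <= e%:E)%E.
    move/ltW: an; rewrite integral_mkcond; apply: integral_sqr_le2 => // s.
    have [st|st] := pselect (oc0 t s); last first.
      rewrite /h (step_of_step_list_out z l hn st) indicE memNset//= mul0r subrr expr0n/=.
      rewrite patchE; case: ifP => _; last by rewrite mule0.
      by rewrite mule_ge0// mule_ge0// L2norm_ge0.
    have st' : s \in `[0, t].
      by move: st; rewrite /oc0 /= !in_itv/= => /andP[/ltW-> ->].
    have hgs := hg _ st'; have hv := L2T_step_val hn s.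
    rewrite patchE mem_set//= -expe2 sqr_sqrte ?L2norm2_ge0//.
    rewrite /h (step_of_step_list z l hn) indicE mem_set//= mul1r (kg _ st').
    rewrite -sqrrN opprB -coordB//; apply: sqr_coord_le => //; exact: L2TB.
  have sh : sqint mu h by split => //; apply: le_lt_trans hle _; exact: ltry.
  by rewrite -lee_fin -(integral_sqrE sh).
move/ltW: bn; apply: integral_sqr_le2.
  apply: measurable_funB; first exact: measurable_coord.
  apply: measurable_sum => p; apply: measurable_funM; first exact: measurable_cst.
  by apply: mb; rewrite le_max lexx.
move=> w; rewrite (wiener_step_list z l hn).
have hs := L2T_step_integral hn (fun s => b s w).
by rewrite -coordB//; apply: sqr_coord_le => //; exact: L2TB.
Unshelve. all: by end_near. Qed.

End wiener_coord.

Section stochastic_coord.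
Variables (R : realType) (d : measure_display) (Omega : measurableType d).
Variable P : probability Omega R.
Variables (F : R -> set (set Omega)) (beta : int -> R -> Omega -> R).
Hypothesis hF : normal_filtration P F.
Hypothesis hbeta : iid_brownian P F beta.
Notation C := (complex R).

Lemma iid_standard l : standard_brownian P (beta l).
Proof. by case: hbeta => h _ _ _; exact: h. Qed.

Lemma iid_adapted l (t : R) (B : set R) : 0 <= t -> measurable B -> F t (beta l t @^-1` B).
Proof. by case: hbeta => _ h _ _; exact: h. Qed.

Lemma iid_independent l (s t : R) A (B : set R) : 0 <= s -> s < t -> F s A -> measurable B ->
  P (A `&` (fun w => beta l t w - beta l s w) @^-1` B) =
  (P A * P ((fun w => (beta l t w - beta l s w)%R) @^-1` B))%E.
Proof.
case: hbeta => _ _ h _ s0 st FA mB; apply: (h s t) => //.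
apply: sub_sigma_algebra; exists l => //; exists B => //.
Qed.

Lemma iid_measurable l (t : R) : 0 <= t -> measurable_fun setT (beta l t).
Proof. exact: (measurable_brownian hF (@iid_adapted l)). Qed.

(** The maximal inequality with K = 0, applied to the single time t. *)
Lemma wiener_limit0 l (t : R) X : 0 <= t -> wiener_limit P (beta l) (fun=> 0) t X ->
  {ae P, forall w, X w = 0}.
Proof.
move=> t0 hX; have [mX _] := hX; apply: sqint_eq0 => //.
have n0 (s : R) : `|(fun=> 0 : R) s| <= (0 : R) by rewrite normr0.
have tt (i : nat) : 0 <= (fun=> t) i <= t by rewrite t0 lexx.
have := @wiener_limit_sup _ _ _ P F (beta l) hF (iid_standard l) (@iid_adapted l)
  (@iid_independent l) (fun=> 0) 0 t (measurable_cst _) (lexx _) n0 t0 (fun=> X) (fun=> t)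
  tt (fun=> hX) (ex_intro _ X hX).
rewrite expr0n/= mulr0 mul0r; apply: le_trans.
apply: ge0_le_integral_lower => w _; first by rewrite lee_fin sqr_ge0.
by apply: ereal_sup_ubound; exists 0%N.
Qed.

(** The operator is diagonal, so a mode k <> l contributes to the l-th coefficient the Wiener
    integral of the zero function, which vanishes almost surely. As soon as N >= |l|, the symmetric
    partial sum therefore has the coordinate of its mode l alone. *)
Lemma stochastic_integral_limit z l (t : R) Psi Z (kappa : R -> R) : sqabs z = 1 ->
  0 <= t -> stochastic_integral P beta t Psi Z -> measurable_fun setT kappa ->
  (forall s, s \in `[0, t] -> kappa s = coord z l (Psi s l)) ->
  (forall s k, s \in `[0, t] -> k != l -> fourier (Psi s k) l = 0) ->
  wiener_limit P (beta l) kappa t (fun w => coord z l (Z w)).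
Proof.
move=> z1 t0 [hZ [I hI cZ]] mk kl knl.
have mZ := measurable_coord l z1 hZ; split => // e e0.
have hIl : wiener_limit P (beta l) kappa t (fun w => coord z l (I l w)).
  by apply: (wiener_integral_limit z1 _ (hI l)) => // s s0; exact: iid_measurable.
have I0 k : k != l -> {ae P, forall w, coord z l (I k w) = 0}.
  move=> kl'; apply: (wiener_limit0 t0 (l := k)).
  apply: (wiener_integral_limit z1 _ (hI k)) => // [s s0|s st]; first exact: iid_measurable.
  by rewrite /coord knl// mulr0.
(* The modes are enumerated through [unpickle], so that the exceptional sets form a countable
   union. *)
have I0' : {ae P, forall w, forall n : nat, (unpickle n : option int) != Some l ->
    if unpickle n is Some k then coord z l (I k w) = 0 else True}.
  apply: ae_foralln => n; case: (unpickle n : option int) => [k|]; last exact: aeW.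
  have [->|kl'] := eqVneq k l; first by apply: aeW => w; rewrite eqxx.
  by apply: filterS (I0 k kl') => w ->.
have hIT k w : L2T (I k w) by case: (hI k) => _ [h _] _; exact: h.
have [_ /(_ _ (divr_gt0 e0 (ltr0n R 4)))[L [hL1 hL2]]] := hIl.
exists L; split; first by apply: le_trans hL1 _; lra.
(* The second halving compensates the factor 2 between a squared coordinate and the squared L^2
   norm. *)
have e8 : 0 < e / 4 / 2 by rewrite !divr_gt0.
pose S N w x := \sum_(k < N.*2.+1) I (k%:Z - N%:Z)%R w x.
have hS N w : L2T (S N w) by exact: L2T_sum.
near \oo => N.
have lN : (`|l| <= N)%N by near: N; exact: nbhs_infty_ge.
have zN : (\int[P]_w L2norm2 (L2sub (Z w) (S N w)) < (e / 4 / 2)%:E)%E.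
  by near: N; exact: (near_lt0 e8 cZ).
have [hZT _] := hZ.
pose X k w := coord z l (I k w).
have mX k : measurable_fun setT (X k).
  by apply: measurable_coord => //; case: (hI k).
have cS w : coord z l (S N w) = \sum_(k < N.*2.+1) X (k%:Z - N%:Z)%R w by exact: coord_sum.
pose U w := coord z l (Z w) - coord z l (S N w).
have mS : measurable_fun setT (fun w => coord z l (S N w)).
  by under eq_fun do rewrite cS; exact: measurable_sum.
have mU : measurable_fun setT U by exact: measurable_funB.
have hU : (\int[P]_w (U w ^+ 2)%:E <= (e / 4)%:E)%E.
  move/ltW: zN; apply: integral_sqr_le2 => // w.
  by rewrite /U -coordB//; apply: sqr_coord_le => //; exact: L2TB.
have mW : measurable_fun setT (wiener (beta l) L).
  apply: measurable_sum => p; apply: measurable_funM; first exact: measurable_cst.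
  by apply: iid_measurable; rewrite le_max lexx.
have mXW : measurable_fun setT (fun w => X l w - wiener (beta l) L w) by exact: measurable_funB.
have p1 w : setT w -> (0 <= (U w ^+ 2)%:E)%E by rewrite lee_fin sqr_ge0.
have p2 w : setT w -> (0 <= ((X l w - wiener (beta l) L w) ^+ 2)%:E)%E by rewrite lee_fin sqr_ge0.
have m1 : measurable_fun setT (fun w => (U w ^+ 2)%:E).
  by apply/measurable_EFinP; exact: measurable_funX.
have m2 : measurable_fun setT (fun w => ((X l w - wiener (beta l) L w) ^+ 2)%:E).
  by apply/measurable_EFinP; exact: measurable_funX.
apply: (@le_trans _ _ (\int[P]_w (2%:E * (U w ^+ 2)%:E +
    2%:E * ((X l w - wiener (beta l) L w) ^+ 2)%:E))%E).
  apply: ae_ge0_le_integral_lower => //.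
  - by move=> w; rewrite lee_fin sqr_ge0.
  - by move=> w; rewrite adde_ge0// mule_ge0// lee_fin sqr_ge0.
  - by apply: emeasurable_funD; apply: measurable_funeM.
  apply: (filterS _ I0') => w h0 /=.
  have -> : coord z l (Z w) = U w + X l w.
    rewrite /U cS.
    (* Mode l sits at index l + N of the symmetric sum. *)
    have kN : (`|(l + N%:Z)%R| < N.*2.+1)%N by lia.
    have lE : l = (Posz `|(l + N%:Z)%R|%N - N%:Z)%R by lia.
    rewrite (bigD1 (Ordinal kN))//= -lE big1 ?addr0 ?subrK// => i iN.
    have iL : (i%:Z - N%:Z)%R != l.
      by apply: contra iN => /eqP iE; rewrite -val_eqE/=; apply/eqP; lia.
    have := h0 (pickle (i%:Z - N%:Z)%R); rewrite pickleK; apply.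
    by apply: contra iL => /eqP[->].
  rewrite -!EFinM -EFinD lee_fin.
  have := sqr_ge0 (U w - (X l w - wiener (beta l) L w)).
  by move: (wiener _ _ _) (X l w) (U w) => a b c; nra.
rewrite ge0_integralD//; [|by move=> w _; rewrite mule_ge0// p1|exact: measurable_funeM|
  by move=> w _; rewrite mule_ge0// p2|exact: measurable_funeM].
rewrite !ge0_integralZl//.
have eE : (e%:E = 2%:E * (e / 4)%:E + 2%:E * (e / 4)%:E)%E.
  by rewrite -!EFinM -EFinD; congr EFin; field.
rewrite eE; apply: leeD; apply: lee_wpmul2l => //.
Unshelve. all: by end_near. Qed.

End stochastic_coord.

(** * Growth of the Fourier coefficients along a path *)

Section dense_sequence.
Variable R : realType.

(* An enumeration of the points of [0, T] with rational ratio to T. *)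
Definition dense_seq (T : R) (n : nat) : R :=
  if unpickle n is Some (p, q) then T * Num.min 1 (p%:R / q.+1%:R) else 0.

Lemma dense_seq_itv (T : R) n : 0 <= T -> 0 <= dense_seq T n <= T.
Proof.
move=> T0; rewrite /dense_seq; case: unpickle => [[p q]|]; last by rewrite lexx T0.
have m0 : 0 <= Num.min 1 (p%:R / q.+1%:R) :> R by rewrite le_min ler01 divr_ge0.
by rewrite mulr_ge0//= ler_piMr// ge_min lexx.
Qed.

Lemma dense_seq_approx (T t e : R) : 0 < T -> 0 <= t <= T -> 0 < e ->
  exists n, `|dense_seq T n - t| < e.
Proof.
move=> T0 /andP[t0 tT] e0.
(* The mesh T / (q + 1) is smaller than e, and p / (q + 1) is t / T rounded down to the grid. *)
pose q := Num.truncn (T / e); pose p := Num.truncn (t / T * q.+1%:R).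
exists (pickle (p, q)); rewrite /dense_seq pickleK.
have q0 : 0 < q.+1%:R :> R by rewrite ltr0n.
have hq : T / e < q.+1%:R by have /andP[] := truncn_itv (divr_ge0 (ltW T0) (ltW e0)).
have /andP[p1 p2] : p%:R <= t / T * q.+1%:R < p.+1%:R.
  by apply: truncn_itv; rewrite mulr_ge0 ?divr_ge0// ltW.
rewrite -[p.+1%:R]natr1 in p2; move: p1 p2 hq; move: (q.+1%:R : R) q0 (p%:R : R) => Q Q0 x x1 x2 hQ.
have xQ : x / Q <= t / T by rewrite ler_pdivrMr.
have tT1 : t / T <= 1 by rewrite ler_pdivrMr// mul1r.
rewrite (min_idPr (le_trans xQ tT1)).
have h1 : T * (x / Q) <= t by rewrite mulrC -ler_pdivlMr.
have h2 : t < T * (x / Q) + e.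
  have : t / T < (x + 1) / Q by rewrite ltr_pdivlMr.
  rewrite ltr_pdivrMr// => /lt_le_trans; apply.
  rewrite !mulrDl (mulrC T) lerD2l mul1r (mulrC Q^-1) ler_pdivrMr// mulrC -ler_pdivrMr//.
  exact: ltW.
by rewrite ltr_norml; apply/andP; split; lra.
Qed.

End dense_sequence.

Section path.
Variable R : realType.
Notation C := (complex R).
Notation mu := (@lebesgue_measure R).
Variable u : R -> R -> C.
Hypothesis uL2 : forall t : R, 0 <= t -> L2T (u t).
Hypothesis ucont : forall t : R, 0 <= t ->
  L2norm (L2sub (u s) (u t)) @[s --> within `[0, +oo[ (nbhs t)] --> 0%E.

Let a t l : R := cabs (fourier (u t) l).

Lemma cabs_dist (z w : C) : `|cabs z - cabs w| <= cabs (z - w).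
Proof.
have h1 : cabs z <= cabs (z - w) + cabs w by apply: le_trans (cabsD _ _); rewrite subrK.
have h2 : cabs w <= cabs (z - w) + cabs z.
  by rewrite -(cabsN (z - w)) opprB; apply: le_trans (cabsD _ _); rewrite subrK.
by rewrite ler_norml; apply/andP; split; lra.
Qed.

(** All coefficients of a difference are bounded by the same multiple of its L^2 norm, so the
    neighbourhood of t does not depend on the frequency. The compactness argument below relies on
    this uniformity. *)
Lemma coef_near (t e : R) : 0 <= t -> 0 < e ->
  \forall s \near t, 0 <= s -> forall l, `|a s l - a t l| < e.
Proof.
move=> t0 e0; have e2 : 0 < e / 2 by rewrite divr_gt0.
have : \forall s \near within `[0, +oo[ (nbhs t), (L2norm (L2sub (u s) (u t)) < (e / 2)%:E)%E.
  exact: (near_lt0 e2 (ucont t0)).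
rewrite near_withinE; apply: filterS => s hs s0 l.
have {}hs : (L2norm (L2sub (u s) (u t)) < (e / 2)%:E)%E.
  by apply: hs; rewrite /= in_itv/= s0.
rewrite -lte_fin; apply: (@le_lt_trans _ _ (cabs (fourier (L2sub (u s) (u t)) l))%:E).
  by rewrite lee_fin fourierB ?cabs_dist//; exact: uL2.
apply: le_lt_trans (cabs_fourier_le l (L2TB (uL2 s0) (uL2 t0))) _.
have -> : e = 2 * (e / 2) by field.
by rewrite EFinM lte_pmul2l.
Qed.

(** Compactness of [0, T] and local boundedness uniform in l. The constant depends on the path; it
    starts the Picard induction and disappears through the factors 2^-n. *)
Lemma coef_bounded (T : R) : exists2 K : R, 0 <= K &
  forall (t : R) l, 0 <= t <= T -> a t l <= K.
Proof.
have /compact_near_coveringP := @segment_compact R 0 T.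
move=> /(_ nat \oo (fun n s => 0 <= s -> forall l, a s l <= n%:R) _) h.
have {h} : \forall n \near \oo, (`[0, T] `<=` fun s => 0 <= s -> forall l, a s l <= n%:R).
  apply: h => t; rewrite /= in_itv/= => /andP[t0 tT].
  have [K hK] : exists K, forall l, a t l <= K.
    have h0 := L2norm_ge0 (u t).
    have hf : L2norm (u t) \is a fin_num.
      have /L2TP[_ h] := uL2 t0.
      by rewrite sqrte_fin_num ?L2norm2_ge0// ge0_fin_numE ?L2norm2_ge0.
    exists (fine (2%:E * L2norm (u t))) => l.
    by rewrite -lee_fin fineK ?fin_numM//; exact: (cabs_fourier_le l (uL2 t0)).
  exists ([set s | 0 <= s -> forall l, `|a s l - a t l| < 1], [set n | K + 1 <= n%:R]).
    by split; [exact: coef_near|exact: nbhs_infty_ger].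
  move=> [s n] /= [hs hn] s0 l.
  by move: (hs s0 l) (hK l); rewrite ltr_norml => /andP[]; lra.
move=> [N _ /(_ N (leqnn N)) h]; exists N%:R => // t l tT.
by apply: h; rewrite /= ?in_itv//=; case/andP: tT.
Qed.

(** Both sides are continuous in t, so an inequality on the dense sequence, where Duhamel's formula
    is available, extends to the whole interval. *)
Lemma dense_bound (T : R) (E : R -> R) l : 0 < T -> continuous E ->
  (forall n, a (dense_seq T n) l <= E (dense_seq T n)) ->
  forall t, 0 <= t <= T -> a t l <= E t.
Proof.
move=> T0 cE h t /andP[t0 tT]; apply/ler_addgt0Pl => e e0.
have e2 : 0 < e / 2 by rewrite divr_gt0.
have /cvgrPdist_lt/(_ _ e2) hE := cE t.
have ha := coef_near t0 e2.
have [r /= r0 hr] : \forall s \near t, (0 <= s -> forall l, `|a s l - a t l| < e / 2) /\ `|E t - E s| < e / 2.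
  near=> s; split; last by near: s.
  by near: s.
have [n hn] := dense_seq_approx T0 (introT andP (conj t0 tT)) r0.
have [/(_ _ l) h1 h2] := hr (dense_seq T n) (etrans (congr1 (fun x => x < r) (distrC _ _)) hn).
have /andP[d0 _] := dense_seq_itv n (ltW T0).
have := h n; have := h1 d0; rewrite ltr_norml => /andP[+ _].
by move: h2; rewrite ltr_norml => /andP[+ _]; lra.
Unshelve. all: by end_near. Qed.

End path.

(** * Growth bound for a single path *)

Section growth.
Variable R : realType.
Notation C := (complex R).
Notation mu := (@lebesgue_measure R).

Lemma integral_expR_le (k c t : R) : 0 <= k -> 0 < c -> 0 <= t ->
  (\int[mu]_(s in `[0%R, t]) (k * expR (c * s))%:E <= (k * c^-1 * expR (c * t))%:E)%E.
Proof.
move=> k0 c0; rewrite le_eqVlt => /orP[/eqP<-|t0].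
  by rewrite set_itv1 integral_set1 lee_fin !mulr_ge0 ?invr_ge0 ?expR_ge0// ltW.
have de (x : R) : @is_derive R R^o R^o x 1 (fun s => k * c^-1 * expR (c * s)) (k * expR (c * x)).
  have c1 : c != 0 by rewrite gt_eqF.
  by apply: is_derive_eq; rewrite /GRing.scale/=; field.
rewrite (FTC_segment (F := fun s => k * c^-1 * expR (c * s)) t0) ?lee_fin//.
  by rewrite mulr0 expR0 gerBl mulr1 mulr_ge0 ?invr_ge0// ltW.
move=> x; apply: (@continuousM R R^o (cst k) (fun s => expR (c * s))); first exact: cst_continuous.
apply: (@continuous_comp _ _ _ (fun s => c * s) expR); first exact: mulrl_continuous.
exact: continuous_expR.
Qed.

Section duhamel.
Variables (t eps : R) (w0 v0 ut Zt D : R -> C) (f : R -> R -> C).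
Hypotheses (hut : L2T ut) (hZt : L2T Zt).

Lemma duhamel_coef l : 0 <= eps -> schrodinger_group t w0 v0 -> bochner_integral t f D ->
  L2eq ut (fun x => v0 x - (0 +i* (eps ^+ 2))%C * D x + realC eps * Zt x) ->
  cabs (fourier ut l) <= cabs (fourier w0 l) + eps * cabs (fourier Zt l) +
    eps ^+ 2 * cabs (fourier D l).
Proof.
move=> e0 [_ hv0 hv] [_ hD _] hu.
pose i2 := (0 +i* (eps ^+ 2))%C : C.
have hDi : L2T (fun x => - i2 * D x) by exact: L2TZ.
have hZe : L2T (fun x => realC eps * Zt x) by exact: L2TZ.
have hs := L2TD (L2TD hv0 hDi) hZe.
have -> : fourier ut l = fourier v0 l + - i2 * fourier D l + realC eps * fourier Zt l.
  rewrite -(fourierZ (- i2))// -(fourierZ (realC eps))// -fourierD// -fourierD//; last exact: L2TD.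
  apply: L2eq_fourier; [by have /L2TP[] := hut|by have /L2TP[] := hs|].
  by have hu' := hu; apply: ae_mono2 hu hu' _ => x h _ tx; rewrite (h tx) mulNr.
apply: le_trans (cabsD _ _) _; apply: le_trans (lerD (cabsD _ _) (lexx _)) _.
rewrite hv (cabsM (expi _)) cabs_expi mul1r (cabsM (- i2)) cabsN (cabsM (realC _)).
have -> : cabs i2 = eps ^+ 2.
  by rewrite /cabs /sqabs /= expr0n add0r sqrtr_sqr ger0_norm// sqr_ge0.
rewrite cabs_realC (ger0_norm e0).
by rewrite addrAC.
Qed.

End duhamel.

Section path_growth.
Variables (sigma : nat) (Phi : R -> R) (w0 : R -> C) (lam eps T : R).
Hypothesis sigma_gt0 : (0 < sigma)%N.
Hypothesis hPhi : Hsob sigma (fun x => realC (Phi x)).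
Hypothesis eps0 : 0 < eps.
Hypothesis T0 : 0 < T.
Hypothesis lam0 : 0 < lam.
Hypothesis lam_phi : 256 * 4 ^+ sigma * fine (wnorm sigma (phi_coef Phi)) <= lam ^+ 2.
Hypothesis lam_l1 : 2 * (fine (wnorm sigma (phi_coef Phi)) + 8) <= lam.
Variables u Z : R -> R -> C.
Hypothesis uL2 : forall t : R, 0 <= t -> L2T (u t).
Hypothesis ucont : forall t : R, 0 <= t ->
  L2norm (L2sub (u s) (u t)) @[s --> within `[0, +oo[ (nbhs t)] --> 0%E.
Hypothesis ZL2 : forall t : R, 0 <= t -> L2T (Z t).
Hypothesis duhamel : forall n, let t := dense_seq T n in
  exists (v0 : R -> C) (f : R -> R -> C) (D : R -> C),
   [/\ schrodinger_group t w0 v0,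
       forall s, s \in `[0, t] ->
         schrodinger_group (t - s) (fun x => realC (Phi x) * u s x) (f s),
       bochner_integral t f D
     & L2eq (u t) (fun x => v0 x - (0 +i* (eps ^+ 2))%C * D x + realC eps * Z t x)].
Variable Y : int -> R.
Hypothesis hY : (wnorm sigma Y < +oo)%E.
Hypothesis YE : forall n l,
  cabs (fourier w0 l) + eps * cabs (fourier (Z (dense_seq T n)) l) <= Y l.

Let Y0 l : 0 <= Y l.
Proof.
by apply: le_trans (YE 0 l); rewrite addr_ge0 ?cabs_ge0// mulr_ge0 ?cabs_ge0// ltW.
Qed.

Let phi := phi_coef Phi.
Let A n := picard phi Y lam n.
Let c := lam * eps ^+ 2.
Let c0 : 0 < c. Proof. by rewrite mulr_gt0// exprn_gt0. Qed.

Let A0 n l : 0 <= A n l. Proof. by apply: picard_ge0 => // m; exact: phi_coef_ge0. Qed.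

Let hA n : (wnorm sigma (A n) < +oo)%E.
Proof.
apply: le_lt_trans (picard_wnorm sigma_gt0 _ Y0 _ hY lam0 lam_phi n) _.
- by move=> m; exact: phi_coef_ge0.
- exact: wnorm_phi_coef.
- by rewrite lte_mul_pinfty.
Qed.

(* The weight exp (lam eps^2 t) absorbs the integral in Duhamel's formula. *)
Lemma picard_bound K n : 0 <= K ->
  (forall t l, 0 <= t <= T -> cabs (fourier (u t) l) <= K) ->
  forall t l, 0 <= t <= T ->
    cabs (fourier (u t) l) <= expR (c * t) * (A n l + 2^-1 ^+ n * K).
Proof.
move=> K0 hK; have e1 (t : R) : 0 <= t -> 1 <= expR (c * t).
  by move=> t0; rewrite -expR0 ler_expR mulr_ge0// ltW.
elim: n => [|n ih] t l tT.
  rewrite add0r expr0 mul1r; apply: le_trans (hK t l tT) _.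
  by rewrite ler_peMl// e1//; case/andP: tT.
(* By the induction hypothesis k e^(c s) majorises the l-th coefficient of Phi u(s), and its time
   integral is explicit. *)
pose k := fine (conv phi (A n) l) + 2^-1 ^+ n * K * (fine (wnorm sigma phi) + 8).
have K20 : 0 <= 2^-1 ^+ n * K by rewrite mulr_ge0// exprn_ge0// invr_ge0.
have phi0 m : 0 <= phi m by exact: phi_coef_ge0.
have W0 : 0 <= fine (wnorm sigma phi) by rewrite fine_ge0// wnorm_ge0.
have k0 : 0 <= k.
  by rewrite addr_ge0 ?fine_ge0 ?conv_ge0// mulr_ge0// addr_ge0.
(* Duhamel's formula is at hand only on the dense sequence, whereas the induction hypothesis is used
   under the integral at all earlier times. *)
apply: (@dense_bound R u uL2 ucont T (fun t => expR (c * t) * (A n.+1 l + 2^-1 ^+ n.+1 * K)) l T0 _ _ t tT).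
  move=> x; apply: (@continuousM R R^o (fun s => expR (c * s)) (cst _)); last exact: cst_continuous.
  apply: (@continuous_comp _ _ _ (fun s => c * s) expR); first exact: mulrl_continuous.
  exact: continuous_expR.
move=> i; have /andP[t0 ti] := dense_seq_itv i (ltW T0).
have [v0 [f [D [hv hf hD hu]]]] := duhamel i.
move: (YE i l) t0 ti hv hf hD hu; move: (dense_seq T i) => s Ys s0 sT hv hf hD hu.
have h1 := duhamel_coef (uL2 s0) (ZL2 s0) l (ltW eps0) hv hD hu.
have h2 : cabs (fourier D l) <= k * c^-1 * expR (c * s).
  rewrite -lee_fin; apply: le_trans (integral_expR_le k0 c0 s0).
  apply: (bochner_fourier_bound hD).
  - apply: measurable_funM; first exact: measurable_cst.
    apply: measurableT_comp => //; apply: measurable_funM => //; exact: measurable_cst.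
  - by move=> r; rewrite mulr_ge0// expR_ge0.
  move=> r rs; have [hP _ ->] := hf _ rs.
  move: rs; rewrite in_itv/= => /andP[r0 rs].
  rewrite (cabsM (expi _)) cabs_expi mul1r -lee_fin.
  apply: le_trans (fourier_mul_bound sigma_gt0 hPhi l (uL2 r0) hP) _.
  apply: (@le_trans _ _ (conv phi (fun m => expR (c * r) * (A n m + 2^-1 ^+ n * K)) l)).
    apply: le_esum => m _; rewrite lee_fin ler_wpM2l// ih// r0/=.
    exact: le_trans rs sT.
  have -> : conv phi (fun m => expR (c * r) * (A n m + 2^-1 ^+ n * K)) l =
      ((expR (c * r))%:E * conv phi (fun m => A n m + 2^-1 ^+ n * K)%R l)%E.
    rewrite /conv -esumZl ?expR_ge0//; last first.
      by move=> m; rewrite lee_fin mulr_ge0// addr_ge0.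
    by apply: eq_esum => m _; rewrite -EFinM mulrCA.
  rewrite (mulrC k) EFinM; apply: lee_wpmul2l; first by rewrite lee_fin expR_ge0.
  apply: conv_add_cst => //; exact: wnorm_phi_coef.
apply: le_trans h1 _.
(* Since c = lam eps^2, the factor eps^2 in front of the integral cancels against 1 / c and leaves 1
   / lam. *)
have h3 : eps ^+ 2 * cabs (fourier D l) <= expR (c * s) * (lam^-1 * k).
  apply: (@le_trans _ _ (eps ^+ 2 * (k * c^-1 * expR (c * s)))).
    by rewrite ler_wpM2l// sqr_ge0.
  have -> : c^-1 = lam^-1 / eps ^+ 2 by rewrite /c invfM.
  have en : eps ^+ 2 != 0 by rewrite expf_neq0// gt_eqF.
  move: (expR _) (lam^-1) (eps ^+ 2) en => x y z zn.
  by rewrite le_eqVlt; apply/orP; left; apply/eqP; field.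
(* By [lam_l1] the quotient of fine (wnorm phi) + 8 by lam is at most 1 / 2, so the constant error
   is halved. *)
have h4 : lam^-1 * k <= lam^-1 * fine (conv phi (A n) l) + 2^-1 ^+ n.+1 * K.
  rewrite /k mulrDr lerD2l exprS -[leRHS]mulrA mulrCA [leRHS]mulrC; apply: ler_wpM2l => //.
  rewrite ler_pdivrMl// -/phi; move: lam_l1; rewrite -/phi.
  by move: (fine _) => w; lra.
have h5 : Y l <= expR (c * s) * Y l by rewrite ler_peMl// e1.
have -> : A n.+1 l = Y l + lam^-1 * fine (conv phi (A n) l) by [].
have h6 : expR (c * s) * (lam^-1 * k) <= expR (c * s) *
   (lam^-1 * fine (conv phi (A n) l) + 2^-1 ^+ n.+1 * K) by rewrite ler_wpM2l// expR_ge0.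
apply: le_trans (lerD (le_trans Ys h5) (le_trans h3 h6)) _.
by rewrite -mulrDr addrA.
Qed.

(** With the exponential weight removed, the coefficients lie below every Picard iterate up to 2^-n
    K, which is the situation of [picard_limit]. The 2 in the exponent comes from squaring. *)
Lemma path_growth t : 0 <= t <= T ->
  (Hnorm2 sigma (u t) <= (8 * expR (2 * (lam * (eps ^+ 2 * T))))%:E * wnorm sigma Y)%E.
Proof.
move=> tT; have /andP[t0 tT'] := tT.
have [K K0 hK] := coef_bounded uL2 ucont T.
pose g l := expR (- (c * t)) * cabs (fourier (u t) l).
have g0 l : 0 <= g l by rewrite mulr_ge0 ?expR_ge0 ?cabs_ge0.
have hg n l : g l <= A n l + 2^-1 ^+ n * K.
  have := picard_bound n K0 hK l tT.
  by rewrite /g expRN ler_pdivrMl// expR_gt0.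
have := picard_limit sigma_gt0 (phi_coef_ge0 Phi) Y0 (wnorm_phi_coef hPhi) hY lam0 lam_phi g0 K0 hg.
rewrite /g wnorm_fourier => h.
have -> : Hnorm2 sigma (u t) = ((expR (c * t) ^+ 2)%:E * ((expR (- (c * t)) ^+ 2)%:E * Hnorm2 sigma (u t)))%E.
  by rewrite muleA -EFinM -exprMn expRxMexpNx_1 expr1n mul1e.
apply: le_trans (lee_wpmul2l _ h) _; first by rewrite lee_fin sqr_ge0.
rewrite muleA -EFinM; apply: lee_wpmul2r; first exact: wnorm_ge0.
rewrite lee_fin mulrC ler_wpM2l// expr2 -expRD ler_expR.
have : c * t <= c * T by rewrite ler_wpM2l// ltW.
by rewrite /c; move: (eps ^+ 2) => e; lra.
Qed.

End path_growth.

End growth.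

(** * Countable suprema and sums over the integers *)

Section measurable_series.
Context d (T : measurableType d) (R : realType).
Variable mu : {measure set T -> \bar R}.

Lemma measurable_ereal_sup_range (f : nat -> T -> \bar R) :
  (forall n, measurable_fun setT (f n)) ->
  measurable_fun setT (fun x => ereal_sup (range (f^~ x))).
Proof.
move=> mf; have := measurable_fun_esups mf 0.
congr measurable_fun; apply/funext => x; rewrite /esups /=; congr ereal_sup.
by apply/seteqP; split => _ [n _ <-]; exists n.
Qed.

Lemma measurable_esum_int (f : int -> T -> \bar R) :
  (forall l, measurable_fun setT (f l)) -> (forall l x, (0 <= f l x)%E) ->
  measurable_fun setT (fun x => \esum_(l in [set: int]) f l x)%E.
Proof.
move=> mf f0.
rewrite (_ : (fun x => _) = (fun x => \sum_(0 <= n <oo) f (Posz n) x + \sum_(0 <= n <oo) f (Negz n) x)%E); last first.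
  by apply/funext => x; rewrite esum_int// !nneseries_esumT.
by apply: emeasurable_funD; apply: ge0_emeasurable_sum.
Qed.

Lemma ge0_integral_esum_int (f : int -> T -> \bar R) :
  (forall l, measurable_fun setT (f l)) -> (forall l x, (0 <= f l x)%E) ->
  (\int[mu]_x (\esum_(l in [set: int]) f l x) = \esum_(l in [set: int]) \int[mu]_x f l x)%E.
Proof.
move=> mf f0.
have i0 l : (0 <= \int[mu]_x f l x)%E by apply: integral_ge0.
rewrite esum_int// -!nneseries_esumT//.
rewrite -!integral_nneseries// -ge0_integralD//.
- by apply: eq_integral => x _; rewrite esum_int// !nneseries_esumT.
- by move=> x _; apply: nneseries_ge0 => n _ _; exact: f0.
- exact: ge0_emeasurable_sum.
- by move=> x _; apply: nneseries_ge0 => n _ _; exact: f0.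
- exact: ge0_emeasurable_sum.
Qed.

End measurable_series.

(** * Supremum in time of the stochastic convolution *)

Section noise.
Variables (R : realType) (d : measure_display) (Omega : measurableType d).
Variable P : probability Omega R.
Variables (F : R -> set (set Omega)) (beta : int -> R -> Omega -> R).
Hypothesis hF : normal_filtration P F.
Hypothesis hbeta : iid_brownian P F beta.
Notation C := (complex R).
Variables (q : int -> R) (T : R) (Z : R -> Omega -> R -> C).
Hypothesis q0 : forall l, 0 <= q l.
Hypothesis T0 : 0 < T.
Hypothesis hZ : forall t, 0 <= t -> exists Psi : R -> int -> R -> C,
  (forall s l, s \in `[0, t] -> schrodinger_group (t - s) (Qhalf q l) (Psi s l)) /\
  stochastic_integral P beta t Psi (Z t).

(* e^{i l^2 t} \hat Z_l(t) is a Wiener integral of sqrt (q_l) e^{i l^2 s}, an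
   integrand that no longer depends on t. *)
Let rot (z : C) l t : C := z * expi (l%:~R ^+ 2 * t).
Let kappa (z : C) l s : R := complex.Re (rot z l s) * Num.sqrt (q l).

Let sqabs_rot z l t : sqabs (rot z l t) = sqabs z.
Proof. by rewrite sqabsM sqabs_expi mulr1. Qed.

Let kappa_measurable z l : measurable_fun setT (kappa z l).
Proof.
apply: measurable_funM; last exact: measurable_cst.
rewrite (_ : (fun x => _) = (fun s => complex.Re z * cos (l%:~R ^+ 2 * s) - complex.Im z * sin (l%:~R ^+ 2 * s))); last first.
  by apply/funext => s; rewrite ReM.
have ml : measurable_fun setT (fun s : R => l%:~R ^+ 2 * s).
  by apply: measurable_funM => //; exact: measurable_cst.
apply: measurable_funB; (apply: measurable_funM; first exact: measurable_cst).
  by apply: measurableT_comp ml; apply: continuous_measurable_fun; exact: continuous_cos.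
by apply: measurableT_comp ml; apply: continuous_measurable_fun; exact: continuous_sin.
Qed.

Let kappa_le z l s : sqabs z = 1 -> `|kappa z l s| <= Num.sqrt (q l).
Proof.
move=> z1; rewrite normrM (ger0_norm (sqrtr_ge0 _)) ler_piMl ?sqrtr_ge0//.
by apply: le_trans (Re_le_cabs _) _; rewrite cabs_le// sqabs_rot z1 expr1n.
Qed.

Let X z l t w : R := coord (rot z l t) l (Z t w).

Let X_limit z l (t : R) : sqabs z = 1 -> 0 <= t ->
  wiener_limit P (beta l) (kappa z l) t (X z l t).
Proof.
move=> z1 t0; have [Psi [hPsi hS]] := hZ t0.
apply: (stochastic_integral_limit hF hbeta _ t0 hS) => //; first by rewrite sqabs_rot.
- move=> s st; have [_ _ hE] := hPsi s l st; rewrite /coord hE fourier_Qhalf eqxx.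
  rewrite mulrA /rot -(mulrA z) -expiD.
  have -> : l%:~R ^+ 2 * t + - (l%:~R ^+ 2 * (t - s)) = l%:~R ^+ 2 * s by ring.
  by rewrite [RHS]ReM/= mulr0 subr0.
- move=> s k st /negbTE kl; have [_ _ ->] := hPsi s k st; rewrite fourier_Qhalf kl.
  by apply: complex_ext; rewrite ?ReM ?ImM/= !mulr0 ?subr0 ?addr0.
Qed.

Let supX z l w : \bar R :=
  ereal_sup (range (fun n => (X z l (dense_seq T n) w ^+ 2)%:E)).

Let supX_le z l : sqabs z = 1 -> (\int[P]_w supX z l w <= (32 * q l * T)%:E)%E.
Proof.
move=> z1; have dT n := dense_seq_itv n (ltW T0).
have := wiener_limit_sup hF (iid_standard hbeta l) (iid_adapted hbeta l)
  (iid_independent hbeta l) (kappa_measurable z l) (sqrtr_ge0 (q l))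
  (fun s => kappa_le l s z1) (ltW T0) dT _ _ (X := X z l).
rewrite sqr_sqrtr//; apply => [i|]; first by apply: X_limit => //; case/andP: (dT i).
by exists (X z l T); apply: X_limit => //; exact: ltW.
Qed.

Let measurable_supX z l : sqabs z = 1 -> measurable_fun setT (supX z l).
Proof.
move=> z1; apply: (@measurable_ereal_sup_range _ _ _ (fun n w => (X z l (dense_seq T n) w ^+ 2)%:E)) => n.
apply/measurable_EFinP; apply: measurable_funX.
have /andP[t0 _] := dense_seq_itv n (ltW T0).
by have [] := X_limit l z1 t0.
Qed.

Let minus_i : C := (0 +i* -1)%C.
Let sqabs1 : sqabs (1 : C) = 1. Proof. by rewrite /sqabs/=; ring. Qed.
Let sqabs_minus_i : sqabs minus_i = 1. Proof. by rewrite /sqabs/=; ring. Qed.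

(** The choices z = 1 and z = -i give the real and imaginary parts of the rotated coefficient, whose
    modulus is that of the coefficient itself. Each part costs 32 q_l T, hence 64. The supremum is
    packaged as a measurable majorant. *)
Lemma noise_sup l : exists S : Omega -> \bar R,
  [/\ measurable_fun setT S, forall w, (0 <= S w)%E,
      forall n w, ((sqabs (fourier (Z (dense_seq T n) w) l))%:E <= S w)%E
    & (\int[P]_w S w <= (64 * q l * T)%:E)%E].
Proof.
have s0 z w : (0 <= supX z l w)%E.
  apply: (@le_trans _ _ (X z l (dense_seq T 0) w ^+ 2)%:E); first by rewrite lee_fin sqr_ge0.
  by apply: ereal_sup_ubound; exists 0%N.
exists (fun w => supX 1%R l w + supX minus_i l w)%E; split.
- by apply: emeasurable_funD; exact: measurable_supX.
- by move=> w; rewrite adde_ge0.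
- move=> n w; pose t := dense_seq T n.
  have -> : sqabs (fourier (Z t w) l) = X 1 l t w ^+ 2 + X minus_i l t w ^+ 2.
    have -> : sqabs (fourier (Z t w) l) = sqabs (expi (l%:~R ^+ 2 * t) * fourier (Z t w) l).
      by rewrite sqabsM sqabs_expi mul1r.
    rewrite /X /coord /rot mul1r -mulrA; move: (expi _ * _) => v.
    by rewrite ReM mul0r sub0r mulN1r opprK.
  by rewrite EFinD; apply: leeD; apply: ereal_sup_ubound; exists n.
rewrite ge0_integralD//; [|exact: measurable_supX|exact: measurable_supX].
have -> : 64 * q l * T = 32 * q l * T + 32 * q l * T by ring.
by rewrite EFinD; apply: leeD; exact: supX_le.
Qed.

End noise.

(** * The bound uniform in eps *)

Lemma Hnorm2_ge0 (R : realType) sigma (w : R -> complex R) : (0 <= Hnorm2 sigma w)%E.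
Proof.
apply: esum_ge0 => l _; rewrite lee_fin mulr_ge0 ?sqabs_ge0//.
Qed.

Lemma esum_ge_term (R : realType) (I : choiceType) (a : I -> \bar R) i :
  (a i <= \esum_(j in [set: I]) a j)%E.
Proof.
apply: esum_ge; exists [set i]; first by split=> //; exact: finite_set1.
by rewrite fsbig_set1.
Qed.

(** The image of the l-th basis vector has l-th coefficient sqrt(q_l), so the left-hand side keeps
    one term of each H^sigma norm. The Hilbert-Schmidt hypothesis thereby controls the sum of the
    noise bounds. *)
Lemma esum_wt_Qhalf (R : realType) sigma (q : int -> R) : (forall l, 0 <= q l) ->
  (\esum_(l in [set: int]) (wt R sigma l * q l)%:E <=
   \esum_(l in [set: int]) Hnorm2 sigma (Qhalf q l))%E.
Proof.
move=> q0; apply: le_esum => l _.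
apply: le_trans (esum_ge_term (fun k => ((1 + `|k%:~R : R| ^+ (2 * sigma)) * sqabs (fourier (Qhalf q l) k))%:E) l).
by rewrite fourier_Qhalf eqxx sqabs_realC sqr_sqrtr.
Qed.

Theorem proposition3p5 (R : realType) (d : measure_display)
    (Omega : measurableType d) (P : probability Omega R)
    (F : R -> set (set Omega)) (beta : int -> R -> Omega -> R)
    (T : R) (sigma : nat) (u0 : R -> complex R) (Phi : R -> R) (q : int -> R)
    (hF : normal_filtration P F) (hbeta : iid_brownian P F beta)
    (hT : 0 < T) (hsigma : (0 < sigma)%N)
    (hu0 : Hsob sigma u0)
    (hPhi : Hsob sigma (fun x => realC (Phi x)))
    (hq : forall l, 0 <= q l)
    (hQ : hilbert_schmidt sigma (Qhalf q)) :
  exists2 c : R, 0 < c &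
    forall (eps : R) (u : R -> Omega -> R -> complex R),
      0 < eps -> eps < 1 ->
      mild_solution P F beta u0 Phi q eps u ->
      (\int[P]_w ereal_sup
         [set Hnorm2 sigma (u t w) | t in `[0%R, (T / eps ^+ 2)%R]]
       <= c%:E)%E.
Proof.
pose W := fine (wnorm sigma (phi_coef Phi)).
have W0 : 0 <= W by rewrite fine_ge0// wnorm_ge0.
pose B := 256 * 4 ^+ sigma * W.
have B0 : 0 <= B by rewrite !mulr_ge0// exprn_ge0.
(* A sum of both requirements on lam; as lam >= 1, the inequality B <= lam also gives B <= lam^2.
   Only Phi and sigma enter. *)
pose lam := 1 + B + 2 * (W + 8).
have lam1 : 1 <= lam by rewrite /lam; lra.
have lam0 : 0 < lam by exact: lt_le_trans lam1.
have lam_phi : B <= lam ^+ 2.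
  apply: (@le_trans _ _ lam); first by rewrite /lam; lra.
  by rewrite expr2 ler_peMl// ltW.
have lam_l1 : 2 * (W + 8) <= lam by rewrite /lam; lra.
(* The factor of [path_growth] on [0, T / eps^2], where eps^2 times the length is T. *)
pose K := 8 * expR (2 * (lam * T)).
have K0 : 0 < K by rewrite mulr_gt0// expR_gt0.
pose h0 := fine (Hnorm2 sigma u0).
have h0E : Hnorm2 sigma u0 = h0%:E.
  by rewrite fineK// ge0_fin_numE ?Hnorm2_ge0//; case: hu0.
have h00 : 0 <= h0 by rewrite fine_ge0// Hnorm2_ge0.
pose Q := fine (\esum_(l in [set: int]) Hnorm2 sigma (Qhalf q l))%E.
have Q00 : (0 <= \esum_(l in [set: int]) Hnorm2 sigma (Qhalf q l))%E.
  by apply: esum_ge0 => l _; exact: Hnorm2_ge0.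
have QE : (\esum_(l in [set: int]) Hnorm2 sigma (Qhalf q l) = Q%:E)%E.
  by rewrite fineK// ge0_fin_numE//; case: hQ.
have Q0 : 0 <= Q by rewrite fine_ge0.
(* The final + 1 ensures strict positivity when both the initial datum and the noise vanish. *)
exists (K * (2 * h0 + 2 * (64 * T * Q)) + 1).
  by rewrite ltr_wpDl// mulr_ge0 ?(ltW K0)// addr_ge0// !mulr_ge0// ltW.
move=> eps u eps0 eps1 [hrv hcont hduh].
have e20 : 0 < eps ^+ 2 by rewrite exprn_gt0.
pose Te := T / eps ^+ 2.
have Te0 : 0 < Te by rewrite divr_gt0.
have TeE : eps ^+ 2 * Te = T by rewrite mulrC divfK// gt_eqF.
pose noisy t (Z : Omega -> R -> complex R) := 0 <= t ->
  (exists Psi : R -> int -> R -> complex R,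
    (forall s l, s \in `[0, t] -> schrodinger_group (t - s) (Qhalf q l) (Psi s l)) /\
    stochastic_integral P beta t Psi Z) /\
  {ae P, forall w, exists (v0 : R -> complex R) (f : R -> R -> complex R) (D : R -> complex R),
     [/\ schrodinger_group t u0 v0,
         forall s, s \in `[0, t] ->
           schrodinger_group (t - s) (fun x => realC (Phi x) * u s w x) (f s),
         bochner_integral t f D
       & L2eq (u t w) (fun x => v0 x - (0 +i* (eps ^+ 2))%C * D x + realC eps * Z w x)]}.
(* The choice of Z is made over all real t; at negative times a dummy value is taken. *)
have /choice[Z hZ] : forall t, exists Z, noisy t Z.
  move=> t; have [t0|t0] := leP 0 t; last by exists (fun _ _ => 0) => /(lt_le_trans t0); rewrite ltxx.
  have [Psi [Z [h1 h2 h3]]] := hduh t t0.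
  by exists Z => _; split => //; exists Psi.
have hZs t (t0 : 0 <= t) := (hZ t t0).1.
have [S hS] := choice (noise_sup hF hbeta hq Te0 hZs).
have S0 l w : (0 <= S l w)%E by case: (hS l).
have wS0 l w : (0 <= (wt R sigma l)%:E * S l w)%E.
  by rewrite mule_ge0// lee_fin ltW// wt_gt0.
have mwS l : measurable_fun setT (fun w => (wt R sigma l)%:E * S l w)%E.
  by apply: measurable_funeM; case: (hS l).
pose G w := (\esum_(l in [set: int]) ((wt R sigma l)%:E * S l w))%E.
have G0 w : (0 <= G w)%E by apply: esum_ge0.
have mG : measurable_fun setT G by exact: measurable_esum_int.
(* The expectation grows like the length T / eps^2 of the time interval; in [bound] it is multiplied
   by eps^2. *)
have hG : (\int[P]_w G w <= (64 * Te * Q)%:E)%E.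
  rewrite ge0_integral_esum_int// EFinM -QE.
  apply: (@le_trans _ _ ((64 * Te)%:E * \esum_(l in [set: int]) (wt R sigma l * q l)%:E))%E; last first.
    apply: lee_wpmul2l; last exact: esum_wt_Qhalf.
    by rewrite lee_fin mulr_ge0// ltW.
  have Te64 : 0 <= 64 * Te by rewrite mulr_ge0// ltW.
  have wq l : (0 <= (wt R sigma l * q l)%:E)%E by rewrite lee_fin mulr_ge0// ltW// wt_gt0.
  rewrite -esumZl//.
  apply: le_esum => l _; have [mS _ _ iS] := hS l.
  rewrite ge0_integralZl//; last by rewrite lee_fin ltW// wt_gt0.
  apply: le_trans (lee_wpmul2l _ iS) _; first by rewrite lee_fin ltW// wt_gt0.
  by rewrite -!EFinM lee_fin le_eqVlt; apply/orP; left; apply/eqP; ring.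
pose bound w := (K%:E * ((2 * h0)%:E + (2 * eps ^+ 2)%:E * G w))%E.
have b0 w : (0 <= (2 * h0)%:E + (2 * eps ^+ 2)%:E * G w)%E.
  by rewrite adde_ge0 ?lee_fin ?mulr_ge0// mule_ge0// lee_fin mulr_ge0// ltW.
have ae_growth : {ae P, forall w,
    (ereal_sup [set Hnorm2 sigma (u t w) | t in `[0%R, Te]] <= bound w)%E}.
  (* A countable intersection: one event of full probability carries Duhamel's formula at all times
     of the dense sequence. *)
  have ae_duhamel := ae_foralln (fun n => (hZ _ (proj1 (andP (dense_seq_itv n (ltW Te0))))).2).
  apply: ae_mono2 hcont ae_duhamel _ => w hc hd.
  have KE : ((2 * eps ^+ 2)%:E * +oo = +oo :> \bar R)%E by rewrite gt0_muley// lte_fin mulr_gt0.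
  (* Where [G] is infinite the bound is trivial; elsewhere each [S l w] is finite and its square
     root is a real majorant of the noise coefficient. *)
  have [Ginf|Gfin] := eqVneq (G w) +oo%E.
    by rewrite /bound Ginf KE addey// gt0_muley ?leey// lte_fin.
  have {}Gfin : (G w < +oo)%E by rewrite ltey.
  have SE l : S l w = (fine (S l w))%:E.
    rewrite fineK// ge0_fin_numE// ltey; apply/negP => /eqP Sinf.
    move: Gfin; rewrite ltNge => /negP; apply.
    apply: le_trans (esum_ge_term (fun l => (wt R sigma l)%:E * S l w)%E l).
    by rewrite Sinf gt0_muley// lte_fin wt_gt0.
  pose v l := Num.sqrt (fine (S l w)).
  pose Y l := cabs (fourier u0 l) + eps * v l.
  have hY : (wnorm sigma Y <= (2 * h0)%:E + (2 * eps ^+ 2)%:E * G w)%E.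
    apply: le_trans (wnormD _ _ _) _; rewrite wnormZ.
    have -> : ((2 * eps ^+ 2)%:E * G w = 2%:E * ((eps ^+ 2)%:E * G w))%E by rewrite EFinM muleA.
    apply: leeD.
      rewrite EFinM -h0E; apply: lee_wpmul2l => //; apply: le_esum => l _.
      by rewrite lee_fin sqr_cabs.
    apply: lee_wpmul2l => //; apply: lee_wpmul2l; first by rewrite lee_fin sqr_ge0.
    apply: le_esum => l _; rewrite /v sqr_sqrtr ?EFinM -?SE//.
    by rewrite fine_ge0.
  have hYfin : (wnorm sigma Y < +oo)%E.
    apply: le_lt_trans hY _; rewrite lte_add_pinfty ?ltry// lte_mul_pinfty// lee_fin.
    by rewrite mulr_ge0// ltW.
  apply: ge_ereal_sup => _ [t tT <-].
  apply: le_trans (lee_wpmul2l _ hY); last by rewrite lee_fin ltW.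
  rewrite /K -TeE.
  apply: (@path_growth R sigma Phi u0 lam eps Te hsigma hPhi eps0 Te0 lam0 lam_phi lam_l1
    (fun t => u t w) (fun t => Z t w) _ _ _ hd Y hYfin _ t).
  - by move=> s s0; case: (hrv s s0).
  - by move=> s s0; exact: hc.
  - by move=> s s0; case: (hZs s s0) => Psi [_ [[h _] _]]; exact: h.
  - move=> n l; rewrite lerD2l ler_wpM2l ?(ltW eps0)//.
    rewrite cabs_le ?sqrtr_ge0// sqr_sqrtr ?fine_ge0// -lee_fin -SE.
    by case: (hS l).
  - by move: tT; rewrite /= in_itv.
have mb : measurable_fun setT (fun w => (2 * h0)%:E + (2 * eps ^+ 2)%:E * G w)%E.
  by apply: emeasurable_funD => //; exact: measurable_funeM.
(* The supremum over all times enters only through its almost sure domination by the measurable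
   [bound]. *)
apply: (@le_trans _ _ (\int[P]_w bound w)%E).
  apply: ae_ge0_le_integral_lower => //.
  - move=> w; apply: (@le_trans _ _ (Hnorm2 sigma (u 0 w))); first exact: Hnorm2_ge0.
    by apply: ereal_sup_ubound; exists 0 => //=; rewrite in_itv/= lexx ltW.
  - by move=> w; rewrite mule_ge0// lee_fin ltW.
  - exact: measurable_funeM.
rewrite /bound ge0_integralZl//; last by rewrite lee_fin ltW.
apply: (@le_trans _ _ (K * (2 * h0 + 2 * (64 * T * Q)))%:E); last first.
  by rewrite lee_fin lerDl.
rewrite (EFinM K); apply: lee_wpmul2l; first by rewrite lee_fin ltW.
rewrite ge0_integralD//; last 3 first.
- by move=> w _; rewrite lee_fin mulr_ge0.
- by move=> w _; rewrite mule_ge0// lee_fin mulr_ge0// ltW.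
- exact: measurable_funeM.
rewrite integral_cst// EFinD; apply: leeD.
  by rewrite [X in (_ * X)%E]probability_setT mule1.
rewrite ge0_integralZl//; last by rewrite lee_fin mulr_ge0// ltW.
apply: le_trans (lee_wpmul2l _ hG) _; first by rewrite lee_fin mulr_ge0// ltW.
(* The factor eps^2 meets the length of the time interval, and their product T no longer depends on
   eps. *)
rewrite -EFinM lee_fin -TeE le_eqVlt; apply/orP; left; apply/eqP; ring.
Qed.
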